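(* Let $d\ge 2$, let $\Omega\subset\mathbb{R}^d$ be open, and let $V\in L^\infty_{\mathrm{loc}}(\Omega)$ be a measurable function with $V\ge 0$ a.e. in $\Omega$. Let $k\ge 1$ and $1\le p\le\infty$. If $$\widetilde{\mathcal{L}}_{k,p}(\Omega)<\widetilde{\mathcal{T}}_{k,p}(\Omega),$$ then $\widetilde{\mathcal{L}}_{k,p}(\Omega)$ is achieved at some $u_1,\ldots,u_k\in H^1_{0,V}(\Omega)\setminus\{0\}$ with $u_i\cdot u_j\equiv 0$ for every $i\ne j$.
   Context: All functions are real valued. $H^1_{0,V}(\Omega)=\{u\in H^1_0(\Omega):\int_\Omega V|u|^2\,dx<\infty\}$; for $u\in H^1_{0,V}(\Omega)\setminus\{0\}$ the Rayleigh quotient is $$\mathcal{R}_V(u)=\frac{\int_\Omega(|\nabla u|^2+V|u|^2)\,dx}{\int_\Omega|u|^2\,dx}.$$ For open $\omega\subset\Omega$, $\lambda(\omega)=\inf_{u\in H^1_{0,V}(\omega)\setminus\{0\}}\mathcal{R}_V(u)$. $\Sigma(\Omega)\in[0,\infty]$ denotes the infimum of the essential spectrum of $-\Delta+V$ on $\Omega$ with Dirichlet boundary conditions, which by Persson's theorem equals $\sup_{\mathcal{K}}\lambda(\Omega\setminus\mathcal{K})$, the supremum being over compact $\mathcal{K}\subset\overline{\Omega}$ (with $\inf\emptyset=+\infty$; $\Sigma=\infty$ if there is no essential spectrum). The relaxed functional is $\widetilde\Lambda_{k,p}(u_1,\ldots,u_k)=\left(\sum_{i=1}^k\mathcal{R}_V(u_i)^p\right)^{1/p}$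 for $1\le p<\infty$ and $\widetilde\Lambda_{k,\infty}(u_1,\ldots,u_k)=\max_i\mathcal{R}_V(u_i)$. The relaxed problem is $$\widetilde{\mathcal{L}}_{k,p}(\Omega)=\inf\{\widetilde\Lambda_{k,p}(u_1,\ldots,u_k):u_i\in H^1_{0,V}(\Omega)\setminus\{0\},\ u_i\cdot u_j=0\text{ a.e. for }i\ne j\},$$ with the convention $\widetilde{\mathcal{L}}_{0,p}(\Omega)=0$. The threshold value is $\widetilde{\mathcal{T}}_{k,p}(\Omega)=\left(\widetilde{\mathcal{L}}_{k-1,p}(\Omega)^p+\Sigma(\Omega)^p\right)^{1/p}$ for $1\le p<\infty$ and $\widetilde{\mathcal{T}}_{k,\infty}(\Omega)=\Sigma(\Omega)$ (values in $[0,\infty]$). *)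

(* Defs.v *)
From HB Require Import structures.
From mathcomp Require Import all_boot all_order all_algebra.
From mathcomp Require Import all_classical all_reals all_analysis.

Set Implicit Arguments.
Unset Strict Implicit.
Unset Printing Implicit Defensive.

Import Order.TTheory GRing.Theory Num.Theory.
Import numFieldNormedType.Exports.

Local Open Scope classical_set_scope.
Local Open Scope ring_scope.

(* The library has no measurable structure on row vectors.  We use the product
   sigma-algebra (as the library does for tuples), which on R^n is the Borel
   sigma-algebra. *)
Section measurable_rV.
Context {R : realType} (n : nat).

Let coord : 'I_n -> 'rV[R]_n -> R := fun i x => x ord0 i.

Let rV_set0 : g_sigma_preimage coord set0.
Proof. exact: sigma_algebra0. Qed.

Let rV_setC A : g_sigma_preimage coord A -> g_sigma_preimage coord (~` A).
Proof. exact: sigma_algebraC. Qed.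

Let rV_bigcup (F : (set 'rV[R]_n)^nat) : (forall i, g_sigma_preimage coord (F i)) ->
  g_sigma_preimage coord (\bigcup_i (F i)).
Proof. exact: sigma_algebra_bigcup. Qed.

HB.instance Definition _ := @isMeasurable.Build default_measure_display
  'rV[R]_n (g_sigma_preimage coord) rV_set0 rV_setC rV_bigcup.

End measurable_rV.

Section measurable_fun_rV.
Context {R : realType}.

Lemma measurable_coord_rV n (i : 'I_n) :
  measurable_fun [set: 'rV[R]_n] (fun x => x ord0 i).
Proof.
move=> _ Y mY; rewrite setTI; apply: sub_sigma_algebra => /=.
rewrite -bigcup_seq/=; exists i => /=; first by rewrite mem_index_enum.
by exists Y => //; rewrite setTI.
Qed.

Lemma measurable_fun_rV d (T : measurableType d) n (f : T -> 'rV[R]_n) :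
  (forall i, measurable_fun [set: T] (fun x => f x ord0 i)) ->
  measurable_fun [set: T] f.
Proof.
move=> mf _ Y; rewrite setTI; move: Y.
pose G := [set A : set 'rV[R]_n | measurable (f @^-1` A)].
suff : (measurable : set (set 'rV[R]_n)) `<=` G by [].
apply: smallest_sub.
  split=> /= [|A mA|F mF].
  - by rewrite /G /= preimage_set0.
  - by rewrite /G /= setTD preimage_setC; apply: measurableC.
  - by rewrite /G /= preimage_bigcup; apply: bigcupT_measurable => i; exact: mF.
move=> A /=; rewrite -bigcup_seq => -[i _ [B mB <-]].
rewrite setTI /G /= -[X in measurable X]setTI.
exact: mf.
Qed.

End measurable_fun_rV.

Section lebesgue_rV.
Context {R : realType}.

Definition cons_rV n (x : R * 'rV[R]_n) : 'rV[R]_n.+1 :=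
  row_mx (\row_(_ < 1) x.1) x.2.

Lemma cons_rV0 n (x : R * 'rV[R]_n) : cons_rV x ord0 ord0 = x.1.
Proof.
have := row_mxEl (\row_(_ < 1) x.1) x.2 ord0 ord0; rewrite mxE => <-.
by congr (row_mx _ _ _ _); exact/val_inj.
Qed.

Lemma cons_rVS n (x : R * 'rV[R]_n) j : cons_rV x ord0 (lift ord0 j) = x.2 ord0 j.
Proof.
have <- := row_mxEr (\row_(_ < 1) x.1) x.2 ord0 j.
by congr (row_mx _ _ _ _); exact/val_inj.
Qed.

Definition uncons_rV n (y : 'rV[R]_n.+1) : R * 'rV[R]_n :=
  (y ord0 ord0, \row_j y ord0 (lift ord0 j)).

Lemma cons_rVK n : cancel (@cons_rV n) (@uncons_rV n).
Proof.
move=> [a x]; rewrite /uncons_rV cons_rV0; congr pair.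
by apply/rowP => j; rewrite mxE cons_rVS.
Qed.

Lemma uncons_rVK n : cancel (@uncons_rV n) (@cons_rV n).
Proof.
move=> y; apply/rowP => i.
by case: (unliftP ord0 i) => [j ->|->]; rewrite ?cons_rVS ?cons_rV0//= mxE.
Qed.

Lemma measurable_cons_rV n : measurable_fun setT (@cons_rV n).
Proof.
apply: measurable_fun_rV => i.
case: (unliftP ord0 i) => [j ->|->].
  rewrite (_ : (fun _ => _) = (fun y : 'rV[R]_n => y ord0 j) \o snd).
    exact: measurableT_comp (@measurable_coord_rV R n j) measurable_snd.
  by apply/funext => x; rewrite /= cons_rVS.
rewrite (_ : (fun _ => _) = fst); first exact: measurable_fst.
by apply/funext => x; rewrite cons_rV0.
Qed.

Lemma measurable_uncons_rV n : measurable_fun setT (@uncons_rV n).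
Proof.
apply: measurable_fun_pair; first exact: measurable_coord_rV.
apply: measurable_fun_rV => j.
rewrite (_ : (fun _ => _) = fun y : 'rV[R]_n.+1 => y ord0 (lift ord0 j)).
  exact: measurable_coord_rV.
by apply/funext => y; rewrite mxE.
Qed.

Local Open Scope ereal_scope.

Section step.
Context n (mu : {sigma_finite_measure set 'rV[R]_n -> \bar R}).

Definition lebesgue_rV_step : set 'rV[R]_n.+1 -> \bar R :=
  pushforward (@lebesgue_measure R \x mu) (@cons_rV n).

Let m_preimage A : measurable A -> measurable (@cons_rV n @^-1` A).
Proof. by move=> mA; rewrite -[X in measurable X]setTI; exact: measurable_cons_rV. Qed.

Let step0 : lebesgue_rV_step set0 = 0.
Proof. by rewrite /lebesgue_rV_step /pushforward preimage_set0 measure0. Qed.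

Let step_ge0 A : 0 <= lebesgue_rV_step A.
Proof. by rewrite /lebesgue_rV_step /pushforward; exact: measure_ge0. Qed.

Let step_sigma_additive : semi_sigma_additive lebesgue_rV_step.
Proof.
move=> F mF tF mUF; rewrite /lebesgue_rV_step /pushforward preimage_bigcup.
apply: measure_semi_sigma_additive.
- by move=> i; exact: m_preimage.
- apply/trivIsetP => /= i j _ _ ij; rewrite -preimage_setI.
  by move/trivIsetP : tF => /(_ _ _ _ _ ij) ->//; rewrite preimage_set0.
- by rewrite -preimage_bigcup; exact: m_preimage.
Qed.

HB.instance Definition _ := isMeasure.Build _ _ _ lebesgue_rV_step
  step0 step_ge0 step_sigma_additive.

Let step_sigma_finite : sigma_finite setT lebesgue_rV_step.
Proof.
have /sigma_finiteP[F [TF ndF Foo]] := sigma_finiteT (@lebesgue_measure R).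
have /sigma_finiteP[G [TG ndG Goo]] := sigma_finiteT mu.
exists (fun i => @uncons_rV n @^-1` (F i `*` G i)).
  rewrite -preimage_bigcup; apply/esym; rewrite -subTset => y _ /=.
  have [i _ Fi] : (\bigcup_i F i) (uncons_rV y).1 by rewrite -TF.
  have [j _ Gj] : (\bigcup_i G i) (uncons_rV y).2 by rewrite -TG.
  exists (maxn i j) => //; split.
  - by move: Fi; exact/subsetPset/ndF/leq_maxl.
  - by move: Gj; exact/subsetPset/ndG/leq_maxr.
move=> i; have [mF Fi] := Foo i; have [mG Gi] := Goo i; split.
  rewrite -[X in measurable X]setTI.
  by apply: measurable_uncons_rV => //; exact: measurableX.
rewrite /lebesgue_rV_step /pushforward.
rewrite (_ : _ @^-1` _ = F i `*` G i); last first.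
  rewrite -comp_preimage (_ : _ \o _ = id) ?preimage_id//.
  by apply/funext; exact: cons_rVK.
by rewrite product_measure1E// lte_mul_pinfty// ge0_fin_numE.
Qed.

HB.instance Definition _ := Measure_isSigmaFinite.Build _ _ _ lebesgue_rV_step
  step_sigma_finite.

End step.

(* Lebesgue measure on R^n, as an iterated product. *)
Fixpoint lebesgue_rV n : {sigma_finite_measure set 'rV[R]_n -> \bar R} :=
  match n with
  | 0 => dirac (0%R : 'rV[R]_0)
  | m.+1 => lebesgue_rV_step (lebesgue_rV m)
  end.

Lemma lebesgue_rV_box n (A : 'I_n -> set R) : (forall i, measurable (A i)) ->
  lebesgue_rV n [set x | forall i, A i (x ord0 i)] =
  \prod_(i < n) lebesgue_measure (A i).
Proof.
elim: n A => [|n IH] A mA.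
  rewrite big_ord0 /= diracE mem_set//=.
  by move=> -[].
pose B := [set x : 'rV[R]_n | forall i, A (lift ord0 i) (x ord0 i)].
have mB : measurable B.
  rewrite (_ : B = \big[setI/setT]_(i < n)
      ((fun x : 'rV[R]_n => x ord0 i) @^-1` A (lift ord0 i))).
    apply: bigsetI_measurable => i _.
    by rewrite -[X in measurable X]setTI; exact: measurable_coord_rV.
  apply/seteqP; split => x.
    by move=> Bx; rewrite -bigcap_seq => i _; exact: Bx.
  by rewrite -bigcap_seq => Bx i; apply: Bx; exact: mem_index_enum.
rewrite big_ord_recl -(IH (fun i => A (lift ord0 i)))//.
apply: etrans (@product_measure1E _ _ _ _ _ (@lebesgue_measure R) (lebesgue_rV n)
  _ _ (mA ord0) mB).
rewrite /= /lebesgue_rV_step /pushforward; congr (product_measure1 _ _ _).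
apply/seteqP; split => -[a x] /=.
  move=> Ax; split=> [|i]; first by have := Ax ord0; rewrite cons_rV0.
  by have := Ax (lift ord0 i); rewrite cons_rVS.
by move=> [Aa Ax] i; case: (unliftP ord0 i) => [j ->|->];
  rewrite ?cons_rVS ?cons_rV0//; exact: Ax.
Qed.

End lebesgue_rV.

(* Functions on Omega are represented by functions on the whole space of which
   only the restriction to Omega matters; Sobolev functions are identified when
   they agree a.e. in Omega.  Measurable means Borel measurable, which loses no
   a.e. class of Lebesgue measurable functions. *)
Section sobolev.
Context {R : realType} {d : nat}.
Local Notation E := 'rV[R]_d.
Local Notation mu := (@lebesgue_rV R d).
Implicit Types (Omega : set E) (u v f g V : E -> R).

Definition ae_zero Omega u := {ae mu, forall x, Omega x -> u x = 0}.

Definition sq_norm Omega u : \bar R := (\int[mu]_(x in Omega) ((u x) ^+ 2)%:E)%E.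

Definition L2 Omega u := measurable_fun Omega u /\ (sq_norm Omega u < +oo)%E.

Definition partial (i : 'I_d) u : E -> R := fun x => 'D_(delta_mx 0 i) u x.

Definition smooth u := forall s : seq 'I_d,
  continuous (foldr partial u s) /\
  forall i x, derivable (foldr partial u s) x (delta_mx 0 i).

Definition test_function Omega u :=
  let supp := closure [set x | u x != 0] in
  [/\ smooth u, compact supp & supp `<=` Omega].

Definition weak_gradient Omega u (G : 'I_d -> E -> R) :=
  forall i, L2 Omega (G i) /\
    forall phi, test_function Omega phi ->
      \int[mu]_(x in Omega) (u x * partial i phi x) =
      - \int[mu]_(x in Omega) (G i x * phi x).

Definition H1 Omega u := L2 Omega u /\ exists G, weak_gradient Omega u G.

(* A choice of representative of the weak gradient, which is unique a.e. in
   Omega; meaningful for u in H1. *)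
Definition grad Omega u : 'I_d -> E -> R :=
  xget (fun _ _ => 0) [set G | weak_gradient Omega u G].

(* The closure of the test functions in H1. *)
Definition H10 Omega u := H1 Omega u /\
  forall eps : R, 0 < eps -> exists2 phi, test_function Omega phi &
    (sq_norm Omega (u \- phi)%R +
     \sum_(i < d) sq_norm Omega (grad Omega u i \- partial i phi)%R
       < (eps ^+ 2)%:E)%E.

Definition H10V Omega V u :=
  H10 Omega u /\ (\int[mu]_(x in Omega) (V x * (u x) ^+ 2)%:E < +oo)%E.

Definition Linfty_loc Omega V := measurable_fun Omega V /\
  forall K : set E, compact K -> K `<=` Omega ->
    exists M : R, {ae mu, forall x, K x -> `|V x| <= M}.

Definition rayleigh Omega V u : R :=
  (\int[mu]_(x in Omega)
     ((\sum_(i < d) (grad Omega u i x) ^+ 2) + V x * (u x) ^+ 2)) /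
  (\int[mu]_(x in Omega) ((u x) ^+ 2)).

(* The self-adjoint operator A = - Delta + V on L2 Omega with Dirichlet boundary
   conditions, i.e. the operator associated with the closed quadratic form of
   domain H10V; dirichlet_schrodinger Omega V u f reads: u is in the domain of A
   and A u = f. *)
Definition dirichlet_schrodinger Omega V u f :=
  [/\ H10V Omega V u, L2 Omega f &
    forall v, H10V Omega V v ->
      \int[mu]_(x in Omega)
        ((\sum_(i < d) grad Omega u i x * grad Omega v i x) + V x * u x * v x) =
      \int[mu]_(x in Omega) (f x * v x)].

Definition shifted_kernel Omega V (lambda : R) : set (E -> R) :=
  [set u | dirichlet_schrodinger Omega V u (fun x => lambda * u x)].

Definition shifted_range Omega V (lambda : R) : set (E -> R) :=
  [set f | L2 Omega f /\
    exists u, dirichlet_schrodinger Omega V u (fun x => lambda * u x + f x)].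

(* A - lambda is Fredholm: finite-dimensional kernel, and closed range of finite
   codimension in L2 Omega. *)
Definition fredholm_at Omega V (lambda : R) :=
  [/\ exists n (w : 'I_n -> E -> R), forall u, shifted_kernel Omega V lambda u ->
        exists c : 'I_n -> R,
          ae_zero Omega (fun x => u x - \sum_(j < n) c j * w j x),
      forall (f : nat -> E -> R) g,
        (forall m, shifted_range Omega V lambda (f m)) -> L2 Omega g ->
        sq_norm Omega (f m \- g) @[m --> \oo] --> 0%E ->
        shifted_range Omega V lambda g &
      exists n (w : 'I_n -> E -> R), (forall j, L2 Omega (w j)) /\
        forall f, L2 Omega f -> exists c : 'I_n -> R,
          shifted_range Omega V lambda
            (fun x => f x - \sum_(j < n) c j * w j x)].

Definition essential_spectrum Omega V : set R :=
  [set lambda | ~ fredholm_at Omega V lambda].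

Definition Sigma Omega V : \bar R :=
  ereal_inf [set lambda%:E | lambda in essential_spectrum Omega V].

Definition admissible Omega V k (u : 'I_k -> E -> R) :=
  (forall i, H10V Omega V (u i) /\ ~ ae_zero Omega (u i)) /\
  (forall i j, i != j -> ae_zero Omega (fun x => u i x * u j x)).

(* The exponent p ranges over [1, +oo].  Rayleigh quotients are nonnegative, so
   that starting the maximum at 0 is harmless. *)
Definition relaxed_functional Omega V (p : \bar R) k (u : 'I_k -> E -> R) : R :=
  if p is q%:E then
    (\sum_(i < k) (rayleigh Omega V (u i)) `^ q) `^ q^-1
  else \big[Num.max/0]_(i < k) rayleigh Omega V (u i).

Definition relaxed_inf Omega V (p : \bar R) k : \bar R :=
  if k is 0 then 0%E else
  ereal_inf [set (relaxed_functional Omega V p u)%:E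
            | u in @admissible Omega V k].

Definition threshold Omega V (p : \bar R) k : \bar R :=
  if p is q%:E then
    ((relaxed_inf Omega V p k.-1 `^ q + Sigma Omega V `^ q) `^ q^-1)%E
  else Sigma Omega V.

End sobolev.

(* Main.v *)
From HB Require Import structures.
Require Import Defs.
From mathcomp Require Import all_boot all_order all_algebra.
From mathcomp Require Import all_classical all_reals all_analysis.
From mathcomp Require Import measurable_realfun ring lra.
Import Order.TTheory GRing.Theory Num.Theory.
Import numFieldNormedType.Exports.

Set Implicit Arguments.
Unset Strict Implicit.
Unset Printing Implicit Defensive.

Local Open Scope classical_set_scope.
Local Open Scope ring_scope.

(** The proof is the direct method, with the essential spectrum as the only place
    where compactness can fail.

    A minimising sequence of admissible tuples is normalised in L2; its energies
    are then bounded by the value of the functional.  Along an ultrafilter the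
    Rayleigh quotients of the [i]-th components converge to some [r i], and the
    components converge weakly in the form domain ([ultra_weak_limit]) to
    functions [w i].  By Rellich's theorem the convergence is strong on bounded
    sets, so the [w i] still have pairwise disjoint supports
    ([weak_limit_disjoint]).  On an unbounded set a part of the mass may however
    escape to infinity, and the point is to show that it costs too much.

    If [r i] is at least [Sigma], then the [i]-th component contributes at least
    [Sigma] to the limit and the remaining components, which are admissible for the
    problem with one function less, contribute at least its infimum; so the
    infimum is at least the threshold ([threshold_le]), against the hypothesis.

    So [r i < Sigma] for all [i].  For [s < Sigma] the form of the operator minus
    [s] is nonnegative on a subspace of finite codimension
    ([Sigma_almost_nonneg]).  Such a form is weakly lower semicontinuous, since its
    negative part only sees a finite dimensional projection, on which weak and
    strong convergence agree ([almost_nonneg_lsc]).  Taking [s] slightly above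
    [r i] shows that [w i] is not zero, and [s = r i] that its Rayleigh quotient is
    at most [r i] ([rayleigh_weak_limit]).  The functional is monotone in the
    Rayleigh quotients, so [w] is a minimiser ([minimiser_below_threshold]).

    The link with the essential spectrum, defined by the failure of the Fredholm
    property, goes through the supremum [s] of the numbers at which the form is
    nonnegative in finite codimension.  If the range of the operator minus [s] had
    finite codimension, one could choose unit vectors, orthogonal to more and more
    vectors and with smaller and smaller values of the form, that tend to zero
    exponentially fast against every vector; this contradicts the uniform
    boundedness principle ([unit_not_fast_weak_null],
    [threshold_infinite_codim]).

    Rellich's theorem is derived from the Poincare inequality on cubes
    ([poincare_cube]): on a bounded set cut into small cubes, the L2 norm is
    controlled by finitely many averages, up to a small multiple of the energy
    ([rellich]).  The linear structure of the form domain rests on the uniqueness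
    of weak gradients, proved with bump functions approximating the indicators of
    boxes ([test_orthogonal_ae0]). *)

(** * Semi-Hilbert spaces *)

(** A Hilbert space in which vectors of norm zero are not identified: functions
    can then be used as vectors instead of their classes modulo equality almost
    everywhere, and the domain is a predicate on a common space of functions.
    Completeness is stated for rapidly Cauchy sequences, for which a pointwise
    limit exists without extracting subsequences. *)
Record semihilbert (R : realType) (X : lmodType R) := SemiHilbert {
  dom : X -> Prop;
  ip : X -> X -> R;
  dom0 : dom 0;
  domZD : forall c u v, dom u -> dom v -> dom (c *: u + v);
  ipC : forall u v, dom u -> dom v -> ip u v = ip v u;
  ipZDl : forall c u v w, dom u -> dom v -> dom w ->
    ip (c *: u + v) w = c * ip u w + ip v w;
  ip_ge0 : forall u, dom u -> 0 <= ip u u;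
  ip_complete : forall (f : nat -> X) K, (forall n, dom (f n)) ->
    (forall n, ip (f n.+1 - f n) (f n.+1 - f n) <= K * 4^-1 ^+ n) ->
    exists2 u, dom u & ip (f n - u) (f n - u) @[n --> \oo] --> (0 : R) }.

Section semihilbert_theory.
Context {R : realType} {X : lmodType R} (H : semihilbert X).
Local Notation D := (dom H).
Local Notation "<< u , v >>" := (ip H u v) (at level 0, format "<< u ,  v >>").
Implicit Types u v w : X.

Lemma domD u v : D u -> D v -> D (u + v).
Proof. by move=> du dv; rewrite -[u]scale1r; exact: domZD. Qed.

Lemma domZ c u : D u -> D (c *: u).
Proof. by move=> du; rewrite -[_ *: _]addr0; apply: domZD => //; exact: dom0. Qed.

Lemma domN u : D u -> D (- u).
Proof. by rewrite -scaleN1r; exact: domZ. Qed.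

Lemma domB u v : D u -> D v -> D (u - v).
Proof. by move=> du dv; apply: domD => //; exact: domN. Qed.

Lemma dom_sum I (s : seq I) (P : pred I) (F : I -> X) :
  (forall i, P i -> D (F i)) -> D (\sum_(i <- s | P i) F i).
Proof. by move=> h; apply: big_ind => //; [exact: dom0|exact: domD]. Qed.

Lemma ipDl u v w : D u -> D v -> D w -> <<u + v, w>> = <<u, w>> + <<v, w>>.
Proof. by move=> *; rewrite -[u in LHS]scale1r ipZDl// mul1r. Qed.

Lemma ip0l w : D w -> <<0, w>> = 0.
Proof.
move=> dw; have d0 := dom0 H.
by have := ipDl d0 d0 dw; rewrite addr0 => /eqP; rewrite addrC -subr_eq subrr => /eqP <-.
Qed.

Lemma ipZl c u w : D u -> D w -> <<c *: u, w>> = c * <<u, w>>.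
Proof.
by move=> du dw; rewrite -[_ *: _]addr0 ipZDl// ?ip0l ?addr0//; exact: dom0.
Qed.

Lemma ipNl u w : D u -> D w -> <<- u, w>> = - <<u, w>>.
Proof. by move=> *; rewrite -scaleN1r ipZl// mulN1r. Qed.

Lemma ipBl u v w : D u -> D v -> D w -> <<u - v, w>> = <<u, w>> - <<v, w>>.
Proof. by move=> *; rewrite ipDl ?ipNl//; exact: domN. Qed.

Lemma ipDr u v w : D u -> D v -> D w -> <<w, u + v>> = <<w, u>> + <<w, v>>.
Proof. by move=> *; rewrite ipC ?ipDl ?[<<w, _>>]ipC//; exact: domD. Qed.

Lemma ipZr c u w : D u -> D w -> <<w, c *: u>> = c * <<w, u>>.
Proof. by move=> *; rewrite ipC ?ipZl ?[<<w, _>>]ipC//; exact: domZ. Qed.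

Lemma ip0r w : D w -> <<w, 0>> = 0.
Proof. by move=> ?; rewrite ipC ?ip0l//; exact: dom0. Qed.

Lemma ip_suml I (s : seq I) (P : pred I) (F : I -> X) w :
  (forall i, P i -> D (F i)) -> D w ->
  <<\sum_(i <- s | P i) F i, w>> = \sum_(i <- s | P i) <<F i, w>>.
Proof.
move=> dF dw.
suff: D (\sum_(i <- s | P i) F i) /\
  <<\sum_(i <- s | P i) F i, w>> = \sum_(i <- s | P i) <<F i, w>> by case.
apply: (big_rec2 (fun x y => D x /\ <<x, w>> = y)); first by rewrite ip0l//; split=> //; exact: dom0.
by move=> i x y Pi [dy <-]; split; [apply: domD => //; exact: dF|rewrite ipDl//; exact: dF].
Qed.

Lemma ip_sqrDZ t u v : D u -> D v ->
  <<u + t *: v, u + t *: v>> = <<u, u>> + 2 * t * <<u, v>> + t ^+ 2 * <<v, v>>.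
Proof.
move=> du dv; have dtv := domZ t dv.
rewrite ipDl ?ipDr ?ipZl ?ipZr//; last exact: domD.
by rewrite [<<v, u>>]ipC//; ring.
Qed.

Lemma ip_sqrB u v : D u -> D v ->
  <<u - v, u - v>> = <<u, u>> - 2 * <<u, v>> + <<v, v>>.
Proof. by move=> du dv; rewrite -scaleN1r ip_sqrDZ//; ring. Qed.

Lemma ip_sqrBC u v : D u -> D v -> <<u - v, u - v>> = <<v - u, v - u>>.
Proof. by move=> du dv; rewrite !ip_sqrB// [<<v, u>>]ipC//; ring. Qed.

End semihilbert_theory.

(* Membership of linear combinations in the domain. *)
Ltac dm := solve [repeat first [assumption | apply: dom0 | apply: domD
  | apply: domB | apply: domZ | apply: domN | match goal with h : forall _, dom _ _ |- _ => apply: h end]].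

Lemma quadratic_ge0_discr (R : realFieldType) (a b c : R) :
  0 <= a -> (forall t, 0 <= c + 2 * t * b + t ^+ 2 * a) -> b ^+ 2 <= a * c.
Proof.
rewrite le0r => /predU1P[->|a0] h.
  rewrite mul0r; have [->|b0] := eqVneq b 0; first by rewrite expr0n.
  exfalso; have := h (- (c + 1) / (2 * b)); rewrite mulr0 addr0.
  have -> : c + 2 * (- (c + 1) / (2 * b)) * b = -1 by field.
  by rewrite ler0N1.
have := h (- b / a).
have -> : c + 2 * (- b / a) * b + (- b / a) ^+ 2 * a = c - b ^+ 2 / a by field; rewrite gt_eqF.
by rewrite subr_ge0 ler_pdivrMr// mulrC.
Qed.

Lemma cvg_sum (R : realType) (I T : Type) (F : set_system T) (FF : Filter F)
    (r : seq I) (P : pred I) (f : I -> T -> R) (a : I -> R) :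
  (forall i, P i -> f i x @[x --> F] --> a i) ->
  \sum_(i <- r | P i) f i x @[x --> F] --> \sum_(i <- r | P i) a i.
Proof.
move=> fa; elim: r => [|i r IH].
  by rewrite big_nil; under eq_fun do rewrite big_nil; exact: cvg_cst.
rewrite big_cons; under eq_fun do rewrite big_cons.
by case: ifPn => // Pi; apply: cvgD => //; exact: fa.
Qed.

Lemma cvg0_squeeze (R : realType) (T : Type) (F : set_system T) (FF : Filter F)
    (f g : T -> R) :
  (forall n, 0 <= f n <= g n) -> g n @[n --> F] --> (0 : R) -> f n @[n --> F] --> (0 : R).
Proof.
move=> fg g0; apply/cvgr0Pnorm_lt => e e0; move/cvgr0Pnorm_lt : g0 => /(_ e e0).
apply: filterS => n; have /andP[f0 le] := fg n.
by rewrite !ger0_norm// ?(le_trans f0 le)//; exact: le_lt_trans.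
Qed.

Section hilbert_theory.
Context {R : realType} {X : lmodType R} (H : semihilbert X).
Local Notation D := (dom H).
Local Notation "<< u , v >>" := (ip H u v) (at level 0, format "<< u ,  v >>").
Implicit Types u v w : X.

Lemma cauchy_schwarz u v : D u -> D v -> <<u, v>> ^+ 2 <= <<u, u>> * <<v, v>>.
Proof.
move=> du dv; rewrite mulrC; apply: quadratic_ge0_discr; first exact: ip_ge0.
by move=> t; rewrite -ip_sqrDZ//; apply: ip_ge0; dm.
Qed.

Lemma cvg_ip_strong (T : Type) (F : set_system T) (FF : Filter F) (f : T -> X) u w :
  (forall n, D (f n)) -> D u -> D w ->
  <<f n - u, f n - u>> @[n --> F] --> (0 : R) -> <<f n, w>> @[n --> F] --> <<u, w>>.
Proof.
move=> df du dw h.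
have h1 : <<f n - u, w>> @[n --> F] --> (0 : R).
  apply/cvgr0Pnorm_lt => e e0.
  have e1 : 0 < e ^+ 2 / (<<w, w>> + 1).
    by rewrite divr_gt0 ?exprn_gt0// ltr_wpDl// ip_ge0.
  move/cvgr0Pnorm_lt : h => /(_ _ e1); apply: filterS => n.
  have dfn : D (f n - u) by dm.
  rewrite ger0_norm ?ip_ge0// => hn.
  rewrite -(@ltr_pXn2r _ 2) ?nnegrE ?normr_ge0 ?ltW// real_normK ?num_real//.
  apply: le_lt_trans (cauchy_schwarz dfn dw) _.
  have w0 := ip_ge0 dw; have := ip_ge0 dfn.
  move: hn; rewrite ltr_pdivlMr ?ltr_wpDl// => hn hh; nra.
rewrite (_ : (fun n => _) = (fun n => <<f n - u, w>> + <<u, w>>)).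
  by rewrite -[X in _ --> X]add0r; apply: cvgD => //; exact: cvg_cst.
by apply/funext => n; rewrite ipBl// subrK.
Qed.

Lemma cvg_ip_strong_sq (T : Type) (F : set_system T) (FF : Filter F) (f : T -> X) u :
  (forall n, D (f n)) -> D u ->
  <<f n - u, f n - u>> @[n --> F] --> (0 : R) -> <<f n, f n>> @[n --> F] --> <<u, u>>.
Proof.
move=> df du h; have h1 := cvg_ip_strong FF df du du h.
rewrite (_ : (fun n => _) = (fun n => <<f n - u, f n - u>> + (2 * <<f n, u>> - <<u, u>>))).
  rewrite [X in _ --> X](_ : _ = 0 + (2 * <<u, u>> - <<u, u>>)); last by ring.
  apply: cvgD => //; apply: cvgB; last exact: cvg_cst.
  by apply: cvgM => //; exact: cvg_cst.
by apply/funext => n; rewrite ip_sqrB//; ring.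
Qed.

(** Riesz representation, by minimising the quadratic functional
    [<<u, u>> - 2 l u]: the parallelogram identity makes minimising sequences
    Cauchy, and the Euler equation at the limit is the representation. *)
Lemma riesz (l : X -> R) (K : R) :
  (forall c u v, D u -> D v -> l (c *: u + v) = c * l u + l v) ->
  (forall u, D u -> (l u) ^+ 2 <= K * <<u, u>>) ->
  exists2 w, D w & forall v, D v -> <<w, v>> = l v.
Proof.
move=> lZD lK.
have lDZ t u v : D u -> D v -> l (u + t *: v) = l u + t * l v.
  by move=> du dv; rewrite addrC lZD// addrC.
pose J u := <<u, u>> - 2 * l u.
have JE t u v : D u -> D v ->
    J (u + t *: v) = J u + 2 * t * (<<u, v>> - l v) + t ^+ 2 * <<v, v>>.
  by move=> du dv; rewrite /J ip_sqrDZ// lDZ//; ring.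
pose S := [set r | exists2 u, D u & r = J u].
have infS : has_inf S.
  split; first by exists (J 0), 0 => //; exact: dom0.
  exists (- (1 + `|K|)) => _ [u du ->].
  have u0 := ip_ge0 du; have := lK u du; rewrite /J.
  have : K <= `|K| := ler_norm K.
  set a := <<u, u>> in u0 *; set b := l u; set k := `|K|.
  move=> Kk lK'; have : 0 <= (b - (1 + k)) ^+ 2 := sqr_ge0 _.
  have k0 : 0 <= k := normr_ge0 _.
  have bka : b ^+ 2 <= k * a by apply: le_trans lK' _; exact: ler_wpM2r.
  move=> _; suff : 2 * b <= a + (1 + k) by lra.
  have h0 : 0 <= a + (1 + k) by lra.
  apply: le_trans (ler_norm _) _; rewrite -ler_sqr ?nnegrE// real_normK ?num_real//.
  by have := sqr_ge0 (a - (1 + k)); nra.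
set m := inf S.
have mJ u : D u -> m <= J u by move=> du; apply: ge_inf; [case: infS|exists u].
have ex n : exists u, D u /\ J u < m + 4^-1 ^+ n.
  have e0 : (0 : R) < 4^-1 ^+ n by rewrite exprn_gt0.
  by have [_ [u du ->] h] := inf_adherent e0 infS; exists u.
have [f hf] := choice ex.
have df n : D (f n) by case: (hf n).
(* Parallelogram identity: the midpoint of two almost minimisers is not better
   than the infimum. *)
have [n|w dw fw] := @ip_complete _ _ H f 4 df.
  have [_ h1] := hf n; have [_] := hf n.+1; rewrite exprS => h2.
  have dd : D (f n.+1 - f n) by dm.
  have := mJ (f n + 2^-1 *: (f n.+1 - f n)) ltac:(dm); rewrite JE//.
  have := JE 1 (f n) (f n.+1 - f n) (df n) dd; rewrite scale1r addrC subrK.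
  have e0 : (0 : R) < 4^-1 ^+ n by rewrite exprn_gt0.
  by lra.
exists w => // v dv; apply/eqP; rewrite -subr_eq0; apply/eqP.
have lim t : 0 <= 0 + 2 * t * (<<w, v>> - l v) + t ^+ 2 * <<v, v>>.
  have hh : 2 * t * (<<f n, v>> - l v) + t ^+ 2 * <<v, v>> + 4^-1 ^+ n @[n --> \oo] -->
      2 * t * (<<w, v>> - l v) + t ^+ 2 * <<v, v>> + 0.
    apply: cvgD; last by apply: cvg_expr; rewrite ger0_norm ?invr_ge0// invf_lt1// ltr1n.
    apply: cvgD; last exact: cvg_cst.
    apply: cvgM; first exact: cvg_cst.
    by apply: cvgB; [exact: cvg_ip_strong|exact: cvg_cst].
  rewrite add0r -[leRHS]addr0; apply: cvgr_to_ge hh _.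
  near=> n; have [_ h1] := hf n.
  have := mJ (f n + t *: v) ltac:(dm); rewrite JE//; lra.
have := quadratic_ge0_discr (ip_ge0 dv) lim.
by rewrite mulr0 => h; apply/eqP; rewrite -sqrf_eq0 eq_le h sqr_ge0.
Unshelve. all: by end_near. Qed.

(** * Uniform boundedness, orthogonal complements and weak limits *)

Lemma ip_le1 u v : D u -> D v -> <<u, u>> = 1 -> <<v, v>> = 1 -> `|<<u, v>>| <= 1.
Proof.
move=> du dv u1 v1; have := cauchy_schwarz du dv; rewrite u1 v1 mulr1.
by rewrite -real_normK ?num_real// expr_le1.
Qed.

Lemma sum_expr3 (n m : nat) : (n <= m)%N ->
  \sum_(n.+1 <= j < m.+1) 3^-1 ^+ j <= 2^-1 * 3^-1 ^+ n :> R.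
Proof.
move=> nm; suff -> : \sum_(n.+1 <= j < m.+1) 3^-1 ^+ j
    = 2^-1 * 3^-1 ^+ n - 2^-1 * 3^-1 ^+ m :> R.
  by rewrite lerBlDr lerDl mulr_ge0// exprn_ge0.
elim: m nm => [|m IH]; first by rewrite leqn0 => /eqP ->; rewrite big_geq// subrr.
rewrite leq_eqVlt => /predU1P[->|nm]; first by rewrite big_geq// subrr.
rewrite big_nat_recr//= IH// exprS; lra.
Qed.

(** Uniform boundedness: unit vectors cannot tend to 0 exponentially fast
    against every vector.  Otherwise the vector [x], obtained by adding
    [+- 3 ^- n *: v n] with the sign that makes the pairing with [v n] grow,
    pairs with [v n] to at least [3 ^- n / 2]. *)
Lemma unit_not_fast_weak_null (v : nat -> X) :
  (forall n, D (v n)) -> (forall n, <<v n, v n>> = 1) ->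
  (forall g, D g -> exists C, forall n, `|<<g, v n>>| <= C * 4^-1 ^+ n) -> False.
Proof.
move=> dv v1 hv.
(* The sign for which adding a multiple of [v n] increases the modulus of the
   pairing with [v n]; later terms change it by at most half as much. *)
pose s (x : X) n : R := if 0 <= <<x, v n>> then 1 else -1.
pose fix x n := if n is m.+1 then x m + (s (x m) m * 3^-1 ^+ m) *: v m else 0.
have dx n : D (x n) by elim: n => [|n IH] /=; dm.
have s1 y n : `|s y n| = 1 by rewrite /s; case: ifP; rewrite ?normrN normr1.
have xv n : 3^-1 ^+ n <= `|<<x n.+1, v n>>|.
  have p0 : 0 <= 3^-1 ^+ n :> R by rewrite exprn_ge0.
  rewrite /= ipDl ?ipZl//; try dm; rewrite v1 mulr1 /s; case: ifPn => h.
    by rewrite mul1r ger0_norm ?addr_ge0// lerDr.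
  rewrite -ltNge in h; rewrite ler0_norm; last lra.
  by rewrite opprD mulN1r opprK lerDr oppr_ge0 ltW.
have xxv n m : (n <= m)%N ->
    `|<<x m.+1, v n>> - <<x n.+1, v n>>| <= \sum_(n.+1 <= j < m.+1) 3^-1 ^+ j.
  elim: m => [|m IH]; first by rewrite leqn0 => /eqP ->; rewrite subrr normr0 big_geq.
  rewrite leq_eqVlt => /predU1P[->|nm]; first by rewrite subrr normr0 big_geq.
  rewrite big_nat_recr//= ipDl ?ipZl//; try dm.
  rewrite addrAC; apply: le_trans (ler_normD _ _) _; apply: lerD; first exact: IH.
  rewrite !normrM s1 mul1r ger0_norm ?exprn_ge0// ler_piMr ?exprn_ge0//.
  exact: ip_le1.
have xv2 n m : (n <= m)%N -> 2^-1 * 3^-1 ^+ n <= `|<<x m.+1, v n>>|.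
  move=> nm; have := xxv _ _ nm; have := sum_expr3 nm; have := xv n.
  have := ler_normD (<<x n.+1, v n>> - <<x m.+1, v n>>) <<x m.+1, v n>>.
  rewrite subrK distrC; lra.
have xv3 n m : (n < m)%N -> 2^-1 * 3^-1 ^+ n <= `|<<x m, v n>>|.
  by case: m => [//|m]; rewrite ltnS; exact: xv2.
have [n|y dy xy] := @ip_complete _ _ H x 1 dx.
  rewrite /= addrC addKr ipZl ?ipZr ?v1//; try dm.
  have s2 z k : s z k * s z k = 1 by rewrite /s; case: ifP => _; rewrite ?mulrNN mulr1.
  rewrite mulr1 mulrACA s2 !mul1r -exprMn lerXn2r ?nnegrE ?mulr_ge0 ?invr_ge0//.
  by rewrite -invfM lef_pV2 ?posrE// -natrM ler_nat.
have [C hC] := hv y dy.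
have h n : 2^-1 <= C * (3 / 4) ^+ n.
  have l1 : `|<<x m, v n>>| @[m --> \oo] --> `|<<y, v n>>|.
    by apply: (@cvg_norm _ _ _ _ _ (fun m => <<x m, v n>>)); exact: cvg_ip_strong.
  have : 2^-1 * 3^-1 ^+ n <= `|<<y, v n>>|.
    by apply: cvgr_to_ge l1 _; near=> m; apply: xv3; near: m; exact: nbhs_infty_gt.
  move=> /le_trans /(_ (hC n)) h.
  have p3 : 0 <= 3 ^+ n :> R by rewrite exprn_ge0.
  have e3 : 3 ^+ n * 3^-1 ^+ n = 1 :> R by rewrite -exprMn divff// expr1n.
  have := ler_wpM2l p3 h; rewrite mulrCA e3 mulr1 mulrCA; congr (_ <= _ * _).
  by rewrite -exprMn.
suff : 2^-1 <= C * 0 by rewrite mulr0 leNgt invr_gt0 ltr0n.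
apply: (@cvgr_to_ge _ \oo _ _ (fun n => C * (3 / 4) ^+ n)).
  apply: cvgM; first exact: cvg_cst.
  by apply: cvg_expr; rewrite ger0_norm ?divr_ge0// ltr_pdivrMr// mul1r ltr_nat.
by apply: nearW => n; exact: h.
Unshelve. all: by end_near. Qed.

(** The orthogonal projection, when [F] is orthonormal. *)
Definition orth (F : seq X) v := v - \sum_(f <- F) <<v, f>> *: f.

Definition orthogonal_to (F : seq X) v := forall f, f \in F -> <<v, f>> = 0.

(** Orthonormal families have the second property; it makes [orth] a contraction
    ([ip_orth_le]), and it is easily preserved when a vector is added. *)
Definition orthonormal_like (F : seq X) :=
  (forall f, f \in F -> D f) /\ forall v, D v -> orthogonal_to F (orth F v).

Lemma dom_orth F v : orthonormal_like F -> D v -> D (orth F v).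
Proof.
move=> [dF _] dv; apply: domB => //; rewrite big_seq; apply: dom_sum => f fF.
by apply: domZ; exact: dF.
Qed.

Lemma ip_orthr F v w : orthonormal_like F -> D v -> D w ->
  <<orth F v, w>> = <<v, w>> - \sum_(f <- F) <<v, f>> * <<f, w>>.
Proof.
move=> [dF _] dv dw; have dfs f : f \in F -> D (<<v, f>> *: f).
  by move=> fF; apply: domZ; exact: dF.
rewrite /orth ipBl//; last by rewrite big_seq; apply: dom_sum => f; exact: dfs.
congr (_ - _); rewrite big_seq ip_suml// [RHS]big_seq; apply: eq_bigr => f fF.
by rewrite ipZl//; exact: dF.
Qed.

Lemma ip_orth_le F v : orthonormal_like F -> D v ->
  <<orth F v, orth F v>> <= <<v, v>>.
Proof.
move=> oF dv; have dov := dom_orth oF dv; have [dF h] := oF.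
rewrite (ip_orthr oF dv dov) [X in _ - X]big_seq big1 ?subr0 => [|f fF]; last first.
  by rewrite [<<f, _>>]ipC ?(h _ dv _ fF) ?mulr0//; exact: dF.
rewrite ipC// ip_orthr// gerBl big_seq; apply: sumr_ge0 => f fF.
by rewrite [<<f, v>>]ipC ?sqr_ge0 -?expr2 ?sqr_ge0//; exact: dF.
Qed.

(** A new vector is added after normalising its residue; if the residue has norm
    zero it pairs to zero with everything, by Cauchy-Schwarz, and is dropped. *)
Lemma gram_schmidt (G : seq X) : (forall g, g \in G -> D g) ->
  exists2 F, orthonormal_like F &
    forall g v, g \in G -> D v -> orthogonal_to F v -> <<v, g>> = 0.
Proof.
elim: G => [|g G IH] dG.
  exists [::] => //; split=> //.
have [|F oF FG] := IH; first by move=> h hG; apply: dG; rewrite inE hG orbT.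
have dg : D g by apply: dG; rewrite mem_head.
have [dF hF] := oF; set w := orth F g; have dw : D w by exact: dom_orth.
have Fw v : D v -> orthogonal_to F v -> <<v, g>> = <<v, w>>.
  move=> dv Fv; rewrite [RHS]ipC// ip_orthr// big_seq big1 ?subr0 1?ipC// => f fF.
  by rewrite [<<f, _>>]ipC ?Fv ?mulr0//; exact: dF.
have [w0|w0] := eqVneq <<w, w>> 0.
  exists F => // h v; rewrite inE => /predU1P[->|hG] dv Fv; last exact: FG.
  rewrite Fw//; have := cauchy_schwarz dv dw; rewrite w0 mulr0 => h0.
  by apply/eqP; rewrite -sqrf_eq0 eq_le h0 sqr_ge0.
have wp : 0 < <<w, w>> by rewrite lt_def w0 ip_ge0.
pose c := (Num.sqrt <<w, w>>)^-1; pose e := c *: w.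
have de : D e by dm.
have c0 : c != 0 by rewrite invr_eq0 gt_eqF// sqrtr_gt0.
have c2 : c ^+ 2 * <<w, w>> = 1 by rewrite exprVn sqr_sqrtr ?mulVf// ltW.
have Fe f : f \in F -> <<e, f>> = 0.
  by move=> fF; rewrite ipZl ?hF ?mulr0//; exact: dF.
have ee : <<e, e>> = 1 by rewrite ipZl ?ipZr// mulrA.
have eE : e = c *: w by [].
clearbody e.
exists (e :: F).
  split=> [f|v dv f]; first by rewrite inE => /predU1P[->//|]; exact: dF.
  have -> : orth (e :: F) v = orth F v - <<v, e>> *: e.
    by rewrite /orth big_cons opprD addrCA addrC.
  have dov := dom_orth oF dv.
  rewrite inE => /predU1P[->|fF].
    rewrite ipBl ?ipZl//; last dm.
    rewrite ee mulr1 ip_orthr// big_seq big1 ?subr0 ?subrr// => h hG.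
    by rewrite [<<h, _>>]ipC ?Fe ?mulr0//; exact: dF.
  have df := dF f fF; rewrite ipBl ?ipZl//; last dm.
  by rewrite Fe// mulr0 subr0 hF.
have FF v : orthogonal_to (e :: F) v -> orthogonal_to F v.
  by move=> h f fF; apply: h; rewrite inE fF orbT.
move=> h v; rewrite inE => /predU1P[->|hG] dv oFv; last by apply: FG => //; exact: FF.
rewrite Fw//; last exact: FF.
have := oFv e (mem_head _ _); rewrite eE ipZr// => /eqP; rewrite mulf_eq0 (negbTE c0)/=.
by move=> /eqP.
Qed.

Definition weakly (T : Type) (F : set_system T) (f : T -> X) u :=
  forall w, D w -> <<f n, w>> @[n --> F] --> <<u, w>>.

Lemma ultra_bounded_cvg (T : Type) (F : set_system T) (UF : UltraFilter F) (x : T -> R) (K : R) :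
  (forall n, `|x n| <= K) -> exists l : R, x n @[n --> F] --> l.
Proof.
move=> xK; have := @segment_compact _ (- K) K; rewrite compact_ultra => cK.
have UxF : UltraFilter (x @ F).
  apply: Build_UltraFilter => G PG xFG; apply/seteqP; split=> // A GA.
  have [//|nA] := in_ultra_setVsetC (x @^-1` A) UF.
  have /xFG GnA : (x @ F) (~` A) by [].
  by exfalso; apply: (@filter_not_empty _ G); rewrite -(setICr A); exact: filterI.
have [|l [_ h]] := cK _ UxF; last by exists l.
by apply: nearW => n /=; rewrite in_itv/= -ler_norml.
Qed.

(** Bounded families have weak limits along ultrafilters: the limit of the
    pairings is a bounded functional, represented by [riesz]. *)
Lemma ultra_weak_limit (T : Type) (F : set_system T) (UF : UltraFilter F) (f : T -> X) (K : R) :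
  (forall n, D (f n)) -> (forall n, <<f n, f n>> <= K) ->
  exists2 u, D u & weakly F f u.
Proof.
move=> df fK.
have CS n w : D w -> <<f n, w>> ^+ 2 <= K * <<w, w>>.
  move=> dw; apply: le_trans (cauchy_schwarz (df n) dw) _.
  by apply: ler_wpM2r (fK n); exact: ip_ge0.
have ex w : exists l, D w -> <<f n, w>> @[n --> F] --> (l : R).
  have [dw|ndw] := pselect (D w); last by exists 0.
  have [n|l hl] := @ultra_bounded_cvg _ F UF (fun n => <<f n, w>>) (1 + K * <<w, w>>).
    have := CS n w dw; set a := K * _ => h.
    have := ler_norm (2 * `|<<f n, w>>|); have : 0 <= (`|<<f n, w>>| - 1) ^+ 2 := sqr_ge0 _.
    have := normr_ge0 <<f n, w>>; rewrite sqrrB real_normK ?num_real//; lra.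
  by exists l.
have [l hl] := choice ex.
have FF : ProperFilter F by exact: ultra_proper.
have [c u v du dv|w dw|u du ul] := @riesz l K.
- have h : <<f n, c *: u + v>> @[n --> F] --> c * l u + l v.
    rewrite (_ : (fun n => _) = (fun n => c * <<f n, u>> + <<f n, v>>)).
      by apply: cvgD; [apply: cvgM; [exact: cvg_cst|exact: hl]|exact: hl].
    by apply/funext => n; rewrite ipDr ?ipZr//; dm.
  by apply: (norm_cvg_unique _ h); apply: hl; dm.
- have h : <<f n, w>> ^+ 2 @[n --> F] --> l w ^+ 2.
    by apply: cvgM; exact: hl.
  by apply: cvgr_to_le h _; apply: nearW => n; exact: CS.
by exists u => // w dw; rewrite ul//; exact: hl.
Qed.

End hilbert_theory.

(** * Bottom of the essential spectrum of a form *)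

Section form_spectrum.
Context {R : realType} {X : lmodType R} (G L : semihilbert X).
Hypothesis GL : forall u, dom G u -> dom L u.
Hypothesis ip_le : forall u, dom G u -> ip L u u <= ip G u u.

(** [L] is the ambient space and [G] the domain of a form, with the graph inner
    product form + [ip L].  Hence [shifted_form s] is the form of the associated
    operator minus [s]. *)
Definition shifted_form s u v := ip G u v - (1 + s) * ip L u v.

Local Notation Q := shifted_form.
Local Notation D := (dom G).
Local Notation "<< u , v >>" := (ip G u v) (at level 0, format "<< u ,  v >>").
Local Notation ipL := (ip L).
Implicit Types u v w : X.

Lemma formDl s u v w : D u -> D v -> D w -> Q s (u + v) w = Q s u w + Q s v w.
Proof. by move=> du dv dw; rewrite /shifted_form !ipDl//; try exact: GL; ring. Qed.

Lemma formZl s c u w : D u -> D w -> Q s (c *: u) w = c * Q s u w.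
Proof. by move=> du dw; rewrite /shifted_form !ipZl//; try exact: GL; ring. Qed.

Lemma form0l s w : D w -> Q s 0 w = 0.
Proof. by move=> dw; rewrite /shifted_form !ip0l ?mulr0 ?subrr//; exact: GL. Qed.

Lemma formC s u v : D u -> D v -> Q s u v = Q s v u.
Proof. by move=> du dv; rewrite /shifted_form ipC// [ipL u v]ipC//; exact: GL. Qed.

Lemma formBl s u v w : D u -> D v -> D w -> Q s (u - v) w = Q s u w - Q s v w.
Proof.
by move=> du dv dw; rewrite formDl//; [rewrite -scaleN1r formZl// mulN1r|exact: domN].
Qed.

Lemma form_suml I (r : seq I) (P : pred I) (F : I -> X) s w :
  (forall i, P i -> D (F i)) -> D w ->
  Q s (\sum_(i <- r | P i) F i) w = \sum_(i <- r | P i) Q s (F i) w.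
Proof.
move=> dF dw; rewrite /shifted_form !ip_suml//; last 2 first.
- by move=> i Pi; exact/GL/dF.
- exact: GL.
by rewrite mulr_sumr -sumrB.
Qed.

Lemma form_sqrDZ s t u v : D u -> D v ->
  Q s (u + t *: v) (u + t *: v) = Q s u u + 2 * t * Q s u v + t ^+ 2 * Q s v v.
Proof. by move=> du dv; rewrite /shifted_form !ip_sqrDZ//; try exact: GL; ring. Qed.

(** The functional [ip L w] is continuous for the graph norm, so that [riesz]
    applies in [G]. *)
Lemma ipL_repr w : dom L w -> exists2 b, D b & forall v, D v -> <<b, v>> = ipL w v.
Proof.
move=> dw; apply: (@riesz _ _ G (fun v => (ipL w v)) (ipL w w)).
  by move=> c u v du dv; rewrite ipDr ?ipZr//; try (apply: domZ); exact: GL.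
move=> u du; apply: le_trans (cauchy_schwarz dw (GL du)) _.
by rewrite ler_wpM2l ?ip_ge0//; exact: ip_le.
Qed.

(** Read spectrally: below [s] there are only finitely many eigenvalues, counted
    with multiplicity, and nothing else. *)
Definition almost_nonneg s := exists2 S : seq X, (forall v, v \in S -> D v) &
  forall v, D v -> orthogonal_to G S v -> 0 <= Q s v v.

Lemma almost_nonneg_le s t : s <= t -> almost_nonneg t -> almost_nonneg s.
Proof.
move=> st [S dS h]; exists S => // v dv Sv; apply: le_trans (h v dv Sv) _.
by rewrite /shifted_form lerD2l lerN2 ler_wpM2r ?lerD2l//; apply: ip_ge0; exact: GL.
Qed.

Lemma almost_nonneg0 : almost_nonneg 0.
Proof.
by exists [::] => // v dv _; rewrite /shifted_form addr0 mul1r subr_ge0 ip_le.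
Qed.

Lemma almost_nonneg_form s : almost_nonneg s -> exists2 F, orthonormal_like G F &
  forall v, D v -> orthogonal_to G F v -> 0 <= Q s v v.
Proof.
move=> [S dS h]; have [F oF hF] := gram_schmidt dS; exists F => // v dv Fv.
by apply: h => // g gS; exact: hF.
Qed.

Lemma weakly_ipL (T : Type) (F : set_system T) (f : T -> X) u w :
  (forall n, D (f n)) -> D u -> weakly G F f u -> dom L w ->
  (ipL w (f n)) @[n --> F] --> (ipL w u).
Proof.
move=> df du fu dw; have [b db bE] := ipL_repr dw; rewrite -bE// ipC//.
rewrite (_ : (fun n => _) = (fun n => <<f n, b>>)); first exact: fu.
by apply/funext => n; rewrite -bE// ipC.
Qed.

Lemma weakly_form (T : Type) (F : set_system T) (FF : Filter F) (f : T -> X) s u w :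
  (forall n, D (f n)) -> D u -> weakly G F f u -> D w ->
  Q s (f n) w @[n --> F] --> Q s u w.
Proof.
move=> df du fu dw; apply: cvgB; first exact: fu.
apply: cvgM; first exact: cvg_cst.
rewrite ipC; try exact: GL.
rewrite (_ : (fun n => _) = (fun n => (ipL w (f n)))).
  by apply: weakly_ipL => //; exact: GL.
by apply/funext => n; rewrite ipC//; exact: GL.
Qed.

(** An almost nonnegative form is weakly lower semicontinuous: only a finite
    dimensional part, on which weak and strong convergence agree, can be
    negative. *)
Lemma almost_nonneg_lsc (T : Type) (F : set_system T) (FF : ProperFilter F)
    (f : T -> X) s u l :
  almost_nonneg s -> (forall n, D (f n)) -> D u -> weakly G F f u ->
  Q s (f n) (f n) @[n --> F] --> l -> Q s u u <= l.
Proof.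
move=> /almost_nonneg_form[S oS hS] df du fu fl; have [dS _] := oS.
pose v n := f n - u; have dv n : D (v n) by dm.
have v0 : weakly G F v 0.
  move=> w dw; rewrite ip0l//.
  rewrite (_ : (fun n => _) = (fun n => <<f n, w>> - <<u, w>>)); last first.
    by apply/funext => n; rewrite ipBl.
  by rewrite -(subrr <<u, w>>); apply: cvgB; [exact: fu|exact: cvg_cst].
pose g n := orth G S (v n); have dg n : D (g n) by exact: dom_orth.
have g0 w : D w -> Q s (g n) w @[n --> F] --> 0.
  move=> dw; have -> : 0 = Q s 0 w - \sum_(e <- S | e \in S) <<0, e>> * Q s e w.
    rewrite big1 => [|e /dS de]; last by rewrite ip0l// mul0r.
    by rewrite form0l ?subrr.
  rewrite (_ : (fun n => _) = (fun n => Q s (v n) w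
      - \sum_(e <- S | e \in S) <<v n, e>> * Q s e w)).
    apply: cvgB; first exact: (weakly_form _ dv (dom0 G)).
    apply: cvg_sum => e eS; apply: cvgM; last exact: cvg_cst.
    by apply: v0; exact: dS.
  apply/funext => n; have dZ e : e \in S -> D (<<v n, e>> *: e) by move=> eS; apply/domZ/dS.
  rewrite /g /orth big_seq formBl//; last by apply: dom_sum.
  by rewrite form_suml//; congr (_ - _); apply: eq_bigr => e eS; rewrite formZl//; exact: dS.
have vg n : Q s (v n) (v n) = Q s (g n) (g n)
    + \sum_(e <- S | e \in S) <<v n, e>> * (Q s (v n) e + Q s (g n) e).
  have dZ e : e \in S -> D (<<v n, e>> *: e) by move=> eS; apply/domZ/dS.
  have E w : D w -> Q s (v n) w = Q s (g n) w
      + \sum_(e <- S | e \in S) <<v n, e>> * Q s e w.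
    move=> dw; rewrite /g /orth big_seq formBl//; last by apply: dom_sum.
    rewrite form_suml// [X in _ - X + _](eq_bigr (fun e => <<v n, e>> * Q s e w)) ?subrK//.
    by move=> e eS; rewrite formZl//; exact: dS.
  rewrite E// formC// E// -addrA -big_split/=; congr (_ + _); apply: eq_bigr => e eS.
  by rewrite -mulrDr formC// ?[Q s e _]formC 1?addrC//; exact: dS.
have lim : Q s (f n) (f n) - 2 * Q s u (v n)
    - \sum_(e <- S | e \in S) <<v n, e>> * (Q s (v n) e + Q s (g n) e) - Q s u u
    @[n --> F] --> l - 2 * 0 - \sum_(e <- S | e \in S) 0 * (0 + 0) - Q s u u.
  apply: cvgB; last exact: cvg_cst.
  have f0 w : D w -> Q s (v n) w @[n --> F] --> 0.
    by move=> dw; rewrite -(form0l s dw); exact: (weakly_form _ dv (dom0 G)).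
  apply: cvgB; last first.
    apply: cvg_sum => e /dS de; apply: cvgM.
      by have := v0 _ de; rewrite ip0l.
    by apply: cvgD; [exact: f0|exact: g0].
  apply: cvgB => //; apply: cvgM; first exact: cvg_cst.
  rewrite (_ : (fun n => _) = (fun n => Q s (v n) u)); first exact: f0.
  by apply/funext => n; rewrite formC.
rewrite -subr_ge0; have -> : l - Q s u u
    = l - 2 * 0 - \sum_(e <- S | e \in S) 0 * (0 + 0) - Q s u u.
  by rewrite big1 => [|e _]; rewrite ?mul0r// mulr0 !subr0.
apply: cvgr_to_ge lim _; apply: nearW => n.
have -> : f n = u + 1 *: v n by rewrite scale1r addrC subrK.
rewrite form_sqrDZ//.
have := hS (g n) (dg n) (oS.2 _ (dv n)); have := vg n.
set x := Q s (v n) (v n); set y := Q s (g n) (g n); set z := \sum_(_ <- _ | _) _.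
move=> -> y0; rewrite (_ : _ - _ = y) //; ring.
Qed.

(** Weyl's criterion at the threshold [s] of almost nonnegativity: the range of
    the operator minus [s] has infinite codimension.  If it were complemented by
    [W], unit vectors [v n] almost minimising the form in ever smaller
    subspaces would tend to 0 against every vector. *)
Lemma threshold_infinite_codim s (W : seq X) : 0 <= s ->
  (forall e, 0 < e -> almost_nonneg (s - e)) ->
  (forall e, 0 < e -> ~ almost_nonneg (s + e)) ->
  (forall w, w \in W -> dom L w) ->
  ~ (forall g, dom L g -> exists2 h, D h & forall v, D v ->
      (forall w, w \in W -> ipL w v = 0) -> Q s h v = (ipL g v)).
Proof.
move=> s0 below above dW codim.
have e0 n : 0 < 16^-1 ^+ n :> R by rewrite exprn_gt0.
have repr : forall w, exists b, dom L w -> D b /\ forall v, D v -> <<b, v>> = ipL w v.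
  move=> w; have [dw|] := pselect (dom L w); last by exists 0.
  by have [b db bE] := ipL_repr dw; exists b.
have [B hB] := choice repr.
(* Off a finite dimensional space the form minus [s - 16 ^- n] is nonnegative, and
   it is at most [2 * 16 ^- n] at some unit vector [v] orthogonal to that space;
   Cauchy-Schwarz for this form bounds its pairings with [v]. *)
have seqv n : exists v, [/\ D v, ipL v v = 1, (forall w, w \in W -> (ipL w v) = 0) &
    forall h, D h -> Q s h v ^+ 2 <= 9 * (4^-1 ^+ n) ^+ 2 * <<h, h>>].
  have [F oF hF] := almost_nonneg_form (below _ (e0 n)); have [dF oF2] := oF.
  have [v dv [vS vneg]] : exists2 v, D v & orthogonal_to G (F ++ map B F ++ map B W) v /\
      Q (s + 16^-1 ^+ n) v v < 0.
    apply: contrapT => nex; apply: (above _ (e0 n)).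
    exists (F ++ map B F ++ map B W).
      move=> v; rewrite !mem_cat => /or3P[/dF//|/mapP[x xF ->]|/mapP[x xW ->]].
        by have [] := hB x (GL (dF x xF)).
      by have [] := hB x (dW x xW).
    move=> v dv vS; rewrite leNgt; apply/negP => neg; apply: nex; exists v => //.
  have vF : orthogonal_to G F v by move=> f fF; apply: vS; rewrite mem_cat fF.
  have vBF f : f \in F -> ipL f v = 0.
    move=> fF; have [db <-//] := hB f (GL (dF f fF)).
    by rewrite ipC//; apply: vS; rewrite !mem_cat map_f ?orbT.
  have vBW w : w \in W -> ipL w v = 0.
    move=> wW; have [db <-//] := hB w (dW w wW).
    by rewrite ipC//; apply: vS; rewrite !mem_cat (map_f B wW) !orbT.
  have v0 : 0 < (ipL v v).
    rewrite lt_def ip_ge0 ?andbT; last exact: GL.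
    apply/eqP => vz; move: vneg; rewrite /shifted_form vz mulr0 subr0 ltNge.
    by rewrite ip_ge0.
  pose c := (Num.sqrt (ipL v v))^-1; pose z := c *: v.
  have c2 : c ^+ 2 * ipL v v = 1 by rewrite exprVn sqr_sqrtr ?mulVf ?gt_eqF// ltW.
  have dz : D z by dm.
  have zz : ipL z z = 1 by rewrite ipZl ?ipZr ?mulrA//; exact: GL.
  have zneg : Q (s + 16^-1 ^+ n) z z < 0.
    rewrite formZl// formC// formZl// mulrA -expr2 pmulr_rlt0//.
    by rewrite exprn_gt0// invr_gt0 sqrtr_gt0.
  have zF : orthogonal_to G F z by move=> f fF; rewrite ipZl ?vF ?mulr0//; exact: dF.
  have zLF f : f \in F -> ipL f z = 0.
    by move=> fF; rewrite ipZr ?vBF ?mulr0//; apply: GL => //; exact: dF.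
  have zW w : w \in W -> ipL w z = 0.
    by move=> wW; rewrite ipZr ?vBW ?mulr0//; [exact: GL|exact: dW].
  clearbody z; exists z; split=> // h dh.
  set e := 16^-1 ^+ n in zneg hF *.
  have e0n : 0 < e := e0 n.
  pose k := orth G F h; have dk : D k by exact: dom_orth.
  have hk : Q s h z = Q s k z.
    rewrite /k /orth big_seq formBl//; last by apply: dom_sum => f fF; apply/domZ/dF.
    rewrite form_suml//; last by move=> f fF; apply/domZ/dF.
    rewrite big1 ?subr0// => f fF; have df := dF f fF.
    by rewrite formZl// /shifted_form [<<f, z>>]ipC// zF// zLF// mulr0 subrr mulr0.
  have CS : Q (s - e) k z ^+ 2 <= Q (s - e) z z * Q (s - e) k k.
    apply: quadratic_ge0_discr.
      by apply: hF => //.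
    move=> t; rewrite -form_sqrDZ//; apply: hF; first by dm.
    move=> f fF; rewrite ipDl ?ipZl ?zF ?mulr0 ?addr0//; try dm; try exact: dF.
    exact: (oF2 _ dh).
  have kk : <<k, k>> <= <<h, h>> by exact: ip_orth_le.
  have Lkk := ip_le dk; have Lk0 := ip_ge0 (GL dk); have k0 := ip_ge0 dk.
  have CL : (ipL k z) ^+ 2 <= (ipL k k) * 1.
    by rewrite -zz; apply: cauchy_schwarz; exact: GL.
  have e1 : e <= 1 by rewrite exprn_ile1 ?invr_ge0// invf_le1// ler1n.
  have -> : (4^-1 ^+ n) ^+ 2 = e by rewrite -exprM mulnC exprM; congr (_ ^+ n); lra.
  rewrite hk; move: CS zneg; rewrite /shifted_form zz.
  set a := <<k, k>> in kk Lkk k0 *; set b := (ipL k k) in Lkk Lk0 CL *.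
  set p := <<k, z>>; set q := (ipL k z) in CL *; set r := <<z, z>>.
  move=> CS zneg; set x := p - (1 + s) * q.
  have xE : p - (1 + (s - e)) * q = x + e * q by rewrite /x; ring.
  rewrite xE in CS.
  have c1 : r - (1 + (s - e)) * 1 <= 2 * e by lra.
  have c3 : a - (1 + (s - e)) * b <= 2 * a by nra.
  have c4 : (x + e * q) ^+ 2 <= 4 * e * a.
    have [c3n|c3p] := leP (a - (1 + (s - e)) * b) 0.
      apply: le_trans (_ : 0 <= _); last by rewrite !mulr_ge0// ltW.
      apply: le_trans CS _; apply: mulr_ge0_le0 => //.
      by have := hF z dz zF; rewrite /shifted_form zz.
    apply: le_trans CS _; apply: le_trans (ler_wpM2r (ltW c3p) c1) _.
    have := ler_wpM2l (ltW e0n) c3; lra.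
  have c5 : (e * q) ^+ 2 <= e * a.
    rewrite exprMn expr2 -mulrA; apply: ler_wpM2l; first exact: ltW.
    by have := ler_wpM2r (sqr_ge0 q) e1; lra.
  have c6 : 0 <= (x + e * q + 2 * (e * q)) ^+ 2 := sqr_ge0 _.
  have c7 : x ^+ 2 <= 3 * 2^-1 * (x + e * q) ^+ 2 + 3 * (e * q) ^+ 2.
    by move: c6; set y := e * q => c6; nra.
  apply: le_trans c7 _; have := ler_wpM2l (ltW e0n) kk; lra.
have [v hv] := choice seqv.
apply: (@unit_not_fast_weak_null _ _ L v).
- by move=> n; have [dv _ _ _] := hv n; exact: GL.
- by move=> n; have [] := hv n.
move=> g dg; have [h dh hg] := codim g dg.
exists (3 * Num.sqrt <<h, h>>) => n; have [dv _ vW hh] := hv n.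
have p0 : 0 <= 3 * Num.sqrt <<h, h>> * 4^-1 ^+ n :> R.
  by rewrite !mulr_ge0// ?sqrtr_ge0// exprn_ge0.
rewrite -hg// -(@ler_pXn2r _ 2) ?nnegrE ?normr_ge0// real_normK ?num_real//.
apply: le_trans (hh h dh) _; rewrite !exprMn sqr_sqrtr ?ip_ge0//.
by rewrite (_ : 3 ^+ 2 = 9) 1?mulrAC//; ring.
Qed.

End form_spectrum.

(** * The space of square integrable functions *)

(** Cauchy-Schwarz against the summable weights [2 ^- k].  For a rapidly Cauchy
    sequence in L2 the weighted sum of squares is integrable, hence finite almost
    everywhere, which gives a pointwise limit together with a rate. *)
Lemma sqr_increment_le (R : realFieldType) (a : nat -> R) (n m : nat) : (n <= m)%N ->
  (a m - a n) ^+ 2 <= (2 * 2^-1 ^+ n - 2 * 2^-1 ^+ m) *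
    \sum_(n <= k < m) 2 ^+ k * (a k.+1 - a k) ^+ 2.
Proof.
elim: m => [|m IH]; first by rewrite leqn0 => /eqP ->; rewrite !subrr expr0n mul0r.
rewrite leq_eqVlt => /predU1P[->|]; first by rewrite !subrr expr0n mul0r.
rewrite ltnS => nm; move: (IH nm); rewrite big_nat_recr//= [2^-1 ^+ m.+1]exprS.
set T := \sum_(_ <= _ < _) _; set x := a m - a n; set dd := a m.+1 - a m.
have -> : a m.+1 - a n = x + dd by rewrite /x /dd; ring.
have T0 : 0 <= T by apply: sumr_ge0 => k _; rewrite mulr_ge0 ?sqr_ge0 ?exprn_ge0//.
have pm : 0 < 2 ^+ m :> R by rewrite exprn_gt0.
have A0 : 0 <= 2 * 2^-1 ^+ n - 2 * 2^-1 ^+ m :> R.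
  by rewrite subr_ge0 ler_wpM2l// ler_wiXn2l ?invr_ge0// invf_le1// ler1n.
have -> : 2 * 2^-1 ^+ n - 2 * (2^-1 * 2^-1 ^+ m) = (2 * 2^-1 ^+ n - 2 * 2^-1 ^+ m) + (2 ^+ m)^-1 :> R.
  by rewrite -exprVn; lra.
move: A0; set A := 2 * _ - _ => A0 xA.
set p := 2 ^+ m in pm *.
have -> : (A + p^-1) * (T + p * dd ^+ 2) = A * T + A * p * dd ^+ 2 + p^-1 * T + dd ^+ 2.
  by field; rewrite gt_eqF.
suff h : 2 * `|x * dd| <= A * p * dd ^+ 2 + p^-1 * T.
  have := ler_norm (x * dd); rewrite sqrrD; lra.
have B0 : 0 <= A * p * dd ^+ 2 
  by apply: mulr_ge0; [apply: mulr_ge0 => //; exact: ltW|exact: sqr_ge0].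
have C0 : 0 <= p^-1 * T by rewrite mulr_ge0// invr_ge0 ltW.
rewrite -(@ler_pXn2r _ 2) ?nnegrE ?mulr_ge0 ?addr_ge0//.
rewrite exprMn real_normK ?num_real// exprMn.
have BC : (A * p * dd ^+ 2) * (p^-1 * T) = A * T * dd ^+ 2 by field; rewrite gt_eqF.
have : x ^+ 2 * dd ^+ 2 <= A * T * dd ^+ 2 by rewrite ler_wpM2r ?sqr_ge0.
rewrite -BC; set B := A * p * _; set C := p^-1 * T => h.
have := sqr_ge0 (B - C); nra.
Qed.

Lemma limn_esup_between {R : realType} (u : nat -> \bar R) (a b : \bar R) (N : nat) :
  (forall m, (N <= m)%N -> (a <= u m)%E) -> (forall m, (N <= m)%N -> (u m <= b)%E) ->
  (a <= limn_esup u)%E /\ (limn_esup u <= b)%E.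
Proof.
move=> ha hb; rewrite limn_esup_lim; split.
  apply: lime_ge; first exact: is_cvg_esups.
  near=> n; apply: (le_trans (ha n _)); first by near: n; exact: nbhs_infty_ge.
  by apply: ereal_sup_ubound; exists n => /=.
apply: lime_le; first exact: is_cvg_esups.
near=> n; apply: ub_ereal_sup => _ [k /= nk <-]; apply: hb.
by apply: leq_trans nk; near: n; exact: nbhs_infty_ge.
Unshelve. all: by end_near. Qed.

Lemma Rintegral_sum {dd : measure_display} {T : measurableType dd} {R : realType}
    (mu : {measure set T -> \bar R}) (D : set T) (J : Type) (r : seq J) (h : J -> T -> R) :
  measurable D -> (forall i, mu.-integrable D (EFin \o h i)) ->
  mu.-integrable D (EFin \o (fun x => \sum_(i <- r) h i x)) /\
  \int[mu]_(x in D) (\sum_(i <- r) h i x) = \sum_(i <- r) \int[mu]_(x in D) h i x.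
Proof.
move=> mD ih; elim: r => [|j r [i1 e1]].
  have e : (fun x => \sum_(i <- [::]) h i x) = cst 0 by apply/funext => x; rewrite big_nil.
  by rewrite e big_nil Rintegral_cst// mul0r; split=> //; exact: integrable0.
have e : (fun x => \sum_(i <- j :: r) h i x) = (fun x => h j x + \sum_(i <- r) h i x).
  by apply/funext => x; rewrite big_cons.
rewrite e (RintegralD mD (ih j) i1) e1 [RHS]big_cons; split=> //.
by have := integrableD mD (ih j) i1.
Qed.

(** Sealed, so that conversion never unfolds the integral. *)
HB.lock Definition L2ip (R : realType) (d : nat) (Omega : set 'rV[R]_d)
  (u v : 'rV[R]_d -> R) : R := \int[@lebesgue_rV R d]_(x in Omega) (u x * v x).

Section L2.
Context {R : realType} {d : nat}.
Local Notation E := 'rV[R]_d.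
Local Notation mu := (@lebesgue_rV R d).
Variable Omega : set E.
Hypothesis mO : measurable Omega.
Implicit Types u v w : E -> R.

Lemma L2_integrable u v : L2 Omega u -> L2 Omega v ->
  mu.-integrable Omega (EFin \o (fun x => u x * v x)).
Proof.
move=> [mfu fu] [mfv fv].
have mu2 : measurable_fun Omega (fun x => (u x ^+ 2 + v x ^+ 2)%R).
  by apply: measurable_funD; apply: measurable_funX.
apply: (@le_integrable _ _ _ _ _ mO _ (EFin \o (fun x => u x ^+ 2 + v x ^+ 2))).
- by apply/measurable_EFinP; exact: measurable_funM.
- move=> x _ /=; rewrite lee_fin [leRHS]ger0_norm ?addr_ge0 ?sqr_ge0//.
  rewrite normrM -(real_normK (num_real (u x))) -(real_normK (num_real (v x))).
  have := sqr_ge0 (`|u x| - `|v x|); have := normr_ge0 (u x); have := normr_ge0 (v x); nra.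
apply/integrableP; split; first exact/measurable_EFinP.
rewrite (eq_integral (fun x => ((u x ^+ 2)%:E + (v x ^+ 2)%:E)%E)); last first.
  by move=> x _; rewrite /= ger0_norm// addr_ge0 ?sqr_ge0.
rewrite ge0_integralD//.
- exact: lte_add_pinfty.
- by move=> x _; rewrite lee_fin sqr_ge0.
- by apply/measurable_EFinP; apply: measurable_funX.
- by move=> x _; rewrite lee_fin sqr_ge0.
- by apply/measurable_EFinP; apply: measurable_funX.
Qed.

Lemma L2_intro u : measurable_fun Omega u ->
  mu.-integrable Omega (EFin \o (fun x => u x ^+ 2)) -> L2 Omega u.
Proof.
move=> mfu /integrableP[_ h]; split=> //; rewrite /sq_norm.
rewrite (eq_integral (fun x => `|(u x ^+ 2)%:E|%E))// => x _.
by rewrite /= ger0_norm ?sqr_ge0.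
Qed.

Lemma L2_integrable_sqr u : L2 Omega u -> mu.-integrable Omega (EFin \o (fun x => u x ^+ 2)).
Proof. by move=> uL; have := L2_integrable uL uL; apply: eq_integrable. Qed.

Lemma L2_le u v : measurable_fun Omega u -> L2 Omega v ->
  (forall x, Omega x -> `|u x| <= `|v x|) -> L2 Omega u.
Proof.
move=> mfu vL uv; apply: L2_intro => //.
apply: le_integrable (L2_integrable_sqr vL) => //.
  by apply/measurable_EFinP; apply: measurable_funX.
move=> x Ox /=; rewrite lee_fin !normrX; apply: lerXn2r; rewrite ?nnegrE//; exact: uv.
Qed.

Local Notation L2ip := (L2ip Omega).

Lemma L2ipE u v : L2ip u v = \int[mu]_(x in Omega) (u x * v x).
Proof. by rewrite L2ip.unlock. Qed.

Lemma L2_0 : L2 Omega (0 : E -> R^o).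
Proof.
split; first exact: measurable_cst.
by rewrite /sq_norm; under eq_integral do rewrite expr0n /=; rewrite integral0.
Qed.

Lemma L2_ZD c u v : L2 Omega u -> L2 Omega v -> L2 Omega (c *: (u : E -> R^o) + v).
Proof.
move=> uL vL; have [mfu _] := uL; have [mfv _] := vL.
have mf : measurable_fun Omega (fun x => c * u x + v x).
  by apply: measurable_funD => //; exact: measurable_funM.
apply: L2_intro; first exact: mf.
have h1 := integrableZl mO (2 * c ^+ 2) (L2_integrable_sqr uL).
have h2 := integrableZl mO 2 (L2_integrable_sqr vL).
apply: le_integrable (integrableD mO h1 h2) => //.
  by apply/measurable_EFinP; apply: measurable_funX; exact: mf.
move=> x Ox; change (`|((c * u x + v x) ^+ 2)%:E| <=
  `|(2 * c ^+ 2 * u x ^+ 2 + 2 * v x ^+ 2)%:E|)%E.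
rewrite lee_fin !ger0_norm ?sqr_ge0//; last first.
  by have := sqr_ge0 (c * u x); have := sqr_ge0 (v x); lra.
have := sqr_ge0 (c * u x - v x); lra.
Qed.

Lemma L2ipC u v : L2 Omega u -> L2 Omega v -> L2ip u v = L2ip v u.
Proof. by move=> _ _; rewrite !L2ipE; apply: eq_Rintegral => x _; rewrite mulrC. Qed.

Lemma L2ip_ZDl c u v w : L2 Omega u -> L2 Omega v -> L2 Omega w ->
  L2ip (c *: (u : E -> R^o) + v) w = c * L2ip u w + L2ip v w.
Proof.
move=> uL vL wL; rewrite !L2ipE -RintegralZl//; last exact: L2_integrable.
rewrite -RintegralD//; last exact: L2_integrable; last first.
  exact: integrableZl (L2_integrable uL wL).
apply: eq_Rintegral => x _.
have -> : (c *: (u : E -> R^o) + v) x = c * u x + v x by [].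
by rewrite mulrDl mulrA.
Qed.

Lemma L2ip_ge0 u : L2 Omega u -> 0 <= L2ip u u.
Proof. by move=> _; rewrite L2ipE; apply: Rintegral_ge0 => x _; rewrite -expr2 sqr_ge0. Qed.

Lemma sq_normE u : L2 Omega u -> sq_norm Omega u = (L2ip u u)%:E.
Proof.
move=> uL; rewrite L2ipE /Rintegral fineK; last exact: integrable_fin_num (L2_integrable uL uL).
by apply: eq_integral => x _; rewrite expr2.
Qed.

(** Riesz-Fischer.  Convergence almost everywhere is kept in the conclusion, to
    identify the limits of two sequences that determine each other pointwise. *)
Lemma L2_complete_ae (f : nat -> E -> R) K : (forall n, L2 Omega (f n)) ->
  (forall n, L2ip (f n.+1 \- f n) (f n.+1 \- f n) <= K * 4^-1 ^+ n) ->
  exists u : E -> R, [/\ L2 Omega u, L2ip (f n \- u) (f n \- u) @[n --> \oo] --> (0 : R) &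
    {ae mu, forall x, Omega x -> f n x @[n --> \oo] --> u x}].
Proof.
move=> fL fK.
have dL n : L2 Omega (f n.+1 \- f n).
  by have := @L2_ZD (-1) _ _ (fL n) (fL n.+1); rewrite addrC scaleN1r.
have mf n : measurable_fun Omega (f n) by have [] := fL n.
pose h n x := (2 ^+ n * (f n.+1 x - f n x) ^+ 2)%:E.
have h0 n x : (0 <= h n x)%E by rewrite lee_fin mulr_ge0 ?sqr_ge0 ?exprn_ge0//.
have mh n : measurable_fun Omega (h n).
  apply/measurable_EFinP; apply: measurable_funM => //; apply: measurable_funX.
  exact: measurable_funB.
pose S x := (\sum_(0 <= n <oo) h n x)%E.
have S0 x : (0 <= S x)%E by apply: nneseries_ge0.
have mS : measurable_fun Omega S.
  by apply: (@ge0_emeasurable_sum _ _ _ _ h predT) => //.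
have iS : mu.-integrable Omega S.
  apply/integrableP; split=> //.
  rewrite (eq_integral S); last by move=> x _; rewrite gee0_abs.
  rewrite integral_nneseries//.
  apply: (@le_lt_trans _ _ (2 * K)%:E); last by rewrite ltry.
  apply: lime_le; first by apply: is_cvg_nneseries => n _ _; exact: integral_ge0.
  near=> n; apply: (@le_trans _ _ (\sum_(0 <= k < n) (K * 2^-1 ^+ k)%:E)%E).
    apply: lee_sum => k _.
    rewrite /h; under eq_integral do rewrite EFinM.
    have mk : measurable_fun Omega (fun x => ((f k.+1 x - f k x) ^+ 2)%:E).
      by apply/measurable_EFinP; apply: measurable_funX; exact: measurable_funB.
    have k0 x : Omega x -> (0 <= ((f k.+1 x - f k x) ^+ 2)%:E)%E.
      by move=> _; rewrite lee_fin sqr_ge0.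
    have p0 : (0 <= (2 ^+ k : R)%:E)%E by rewrite lee_fin exprn_ge0.
    rewrite (ge0_integralZl mu mO mk k0 p0).
    have -> : (\int[mu]_(x in Omega) ((f k.+1 x - f k x) ^+ 2)%:E)%E
        = (L2ip (f k.+1 \- f k) (f k.+1 \- f k))%:E by rewrite -sq_normE.
    rewrite -EFinM lee_fin; apply: le_trans (ler_wpM2l _ (fK k)) _; first by rewrite exprn_ge0.
    rewrite mulrCA ler_wpM2l ?ler_wpM2l//; last first.
      by rewrite -exprMn (_ : 2 / 4 = 2^-1)//; lra.
    by have := le_trans (L2ip_ge0 (dL 0%N)) (fK 0%N); rewrite expr0 mulr1.
  have K0 : 0 <= K by have := le_trans (L2ip_ge0 (dL 0%N)) (fK 0%N); rewrite expr0 mulr1.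
  rewrite sumEFin lee_fin -mulr_sumr mulrC ler_wpM2r//.
  suff -> : \sum_(0 <= k < n) 2^-1 ^+ k = 2 - 2 * 2^-1 ^+ n :> R.
    by rewrite gerBl mulr_ge0 ?exprn_ge0.
  elim: (n) => [|k IH]; first by rewrite big_geq// expr0 mulr1 subrr.
  by rewrite big_nat_recr//= IH exprS; lra.
(* The limsup is a measurable function that is defined everywhere. *)
pose u x := fine (limn_esup (fun n => (f n x)%:E)).
have mu_ : measurable_fun Omega u.
  apply: (measurableT_comp (fine_measurable measurableT)).
  by apply: measurable_fun_limn_esup => n; exact/measurable_EFinP.
have key n x : S x \is a fin_num -> (f n x - u x) ^+ 2 <= 2 * 2^-1 ^+ n * fine (S x).
  move=> Sfin.
  have part m : (n <= m)%N -> \sum_(n <= k < m) 2 ^+ k * (f k.+1 x - f k x) ^+ 2 <= fine (S x).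
    move=> nm; rewrite -lee_fin fineK// -sumEFin.
    apply: le_trans (_ : (\sum_(0 <= k < m) h k x <= _)%E).
      rewrite [leRHS](big_cat_nat (leq0n n) nm)/=; apply: leeDr; exact: sume_ge0.
    exact: nneseries_lim_ge.
  set e := Num.sqrt (2 * 2^-1 ^+ n * fine (S x)).
  have Sx0 : 0 <= fine (S x) by exact: fine_ge0.
  have e2 : e ^+ 2 = 2 * 2^-1 ^+ n * fine (S x).
    by rewrite sqr_sqrtr// !mulr_ge0// exprn_ge0.
  have fe m : (n <= m)%N -> `|f m x - f n x| <= e.
    move=> nm; rewrite -(@ler_pXn2r _ 2) ?nnegrE ?sqrtr_ge0// real_normK ?num_real// e2.
    apply: le_trans (sqr_increment_le (fun k => f k x) nm) _.
    apply: ler_pM; rewrite ?subr_ge0.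
    - by rewrite ler_wpM2l// ler_wiXn2l ?invr_ge0// invf_le1// ler1n.
    - by apply: sumr_ge0 => k _; rewrite mulr_ge0 ?sqr_ge0 ?exprn_ge0//.
    - by rewrite gerBl mulr_ge0// exprn_ge0.
    - exact: part.
  have [||l1 l2] := @limn_esup_between _ (fun m => (f m x)%:E) (f n x - e)%:E (f n x + e)%:E n.
  - by move=> m /fe; rewrite lee_fin ler_distl => /andP[].
  - by move=> m /fe; rewrite lee_fin ler_distl => /andP[].
  have ufin : limn_esup (fun m => (f m x)%:E) \is a fin_num.
    rewrite fin_numE; apply/andP; split; apply/eqP => ll; rewrite ll in l1 l2.
      by rewrite leeNy_eq in l1.
    by rewrite leye_eq in l2.
  have : `|f n x - u x| <= e.
    by rewrite distrC ler_distl -!lee_fin /u fineK// l1 l2.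
  rewrite -(@ler_pXn2r _ 2) ?nnegrE ?sqrtr_ge0// real_normK ?num_real// e2//.
have iSf : mu.-integrable Omega (EFin \o (fine \o S)).
  apply: le_integrable iS => //.
    apply/measurable_EFinP.
    exact: (measurableT_comp (fine_measurable measurableT) mS).
  by move=> x _ /=; case: (S x) => [r| |]//=; rewrite normr0 leey.
have mfu n : measurable_fun Omega (fun x => (f n x - u x) ^+ 2).
  by apply: measurable_funX; exact: measurable_funB.
have bound n : (\int[mu]_(x in Omega) ((f n x - u x) ^+ 2)%:E <=
    (2 * 2^-1 ^+ n * (\int[mu]_(x in Omega) (fine (S x))))%:E)%E.
  rewrite EFinM /Rintegral fineK; last exact: integrable_fin_num iSf.
  have mSf : measurable_fun Omega (fun x => (fine (S x))%:E) by have /integrableP[] := iSf.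
  have Sf0 x : Omega x -> (0 <= (fine (S x))%:E)%E by rewrite lee_fin fine_ge0.
  have c0 : (0 <= (2 * 2^-1 ^+ n : R)%:E)%E by rewrite lee_fin mulr_ge0// exprn_ge0.
  rewrite -(ge0_integralZl mu mO mSf Sf0 c0).
  apply: ae_ge0_le_integral => //.
  - by move=> x _; rewrite lee_fin sqr_ge0.
  - exact/measurable_EFinP.
  - by move=> x _; rewrite -EFinM lee_fin !mulr_ge0 ?exprn_ge0 ?fine_ge0.
  - exact: measurable_funeM.
  have := integrable_ae mO iS; apply: filterS => x hx Ox.
  by rewrite -EFinM lee_fin; apply: key; exact: hx.
have fuL n : L2 Omega (f n \- u).
  split; first exact: measurable_funB.
  by apply: le_lt_trans (bound n) _; rewrite ltry.
have uL : L2 Omega u.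
  have := @L2_ZD (-1) _ _ (fuL 0%N) (fL 0%N).
  by rewrite scaleN1r opprB subrK.
have geo (c : R) : 2 * 2^-1 ^+ n * c @[n --> \oo] --> (0 : R).
  rewrite -[X in _ --> X](mul0r c); apply: cvgM; last exact: cvg_cst.
  rewrite -[X in _ --> X](mulr0 2); apply: cvgM; first exact: cvg_cst.
  by apply: cvg_expr; rewrite ger0_norm ?invr_ge0// invf_lt1// ltr1n.
have up n : L2ip (f n \- u) (f n \- u) <=
    2 * 2^-1 ^+ n * (\int[mu]_(x in Omega) (fine (S x))).
  by rewrite -lee_fin -sq_normE//; exact: bound.
have lo n := L2ip_ge0 (fuL n).
exists u; split=> //.
  apply: (cvg0_squeeze _ _ (geo (\int[mu]_(x in Omega) (fine (S x))))) => n.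
  by rewrite lo up.
have := integrable_ae mO iS; apply: filterS => x /[apply] Sfin.
have sq : (f n x - u x) ^+ 2 @[n --> \oo] --> (0 : R).
  apply: (cvg0_squeeze _ _ (geo (fine (S x)))) => n.
  by rewrite sqr_ge0 key.
apply/cvgrPdist_lt => e e0; have e20 : 0 < e ^+ 2 by rewrite exprn_gt0.
move/cvgr0Pnorm_lt : sq => /(_ _ e20); apply: filterS => n.
rewrite normrX distrC ltr_pXn2r ?nnegrE//; exact: ltW.
Unshelve. all: by end_near. Qed.

Lemma L2_complete (f : nat -> E -> R) K : (forall n, L2 Omega (f n)) ->
  (forall n, L2ip (f n.+1 \- f n) (f n.+1 \- f n) <= K * 4^-1 ^+ n) ->
  exists2 u : E -> R, L2 Omega u & L2ip (f n \- u) (f n \- u) @[n --> \oo] --> (0 : R).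
Proof. by move=> fL /(L2_complete_ae fL)[u [uL fu _]]; exists u. Qed.

Definition L2_semihilbert : semihilbert (E -> R^o) :=
  @SemiHilbert R (E -> R^o) (L2 Omega) L2ip L2_0 L2_ZD L2ipC L2ip_ZDl L2ip_ge0 L2_complete.

End L2.

(** * Borel sets and test functions *)

Section borel_rV.
Context {R : realType} {d : nat}.
Local Notation E := 'rV[R]_d.
Local Notation mu := (@lebesgue_rV R d).

Definition open_box (a b : E) : set E :=
  [set x | forall i, a ord0 i < x ord0 i < b ord0 i].

Lemma nbhs_boxP (x : E) (A : set E) : nbhs x A -> exists a b : E,
  open_box a b x /\ [set y : E | forall i, a ord0 i <= y ord0 i <= b ord0 i] `<=` A.
Proof.
move=> /nbhs_ballP[e /= e0 eA].
exists (x - const_mx (e / 2)), (x + const_mx (e / 2)); split=> [i|y yb].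
  by rewrite !mxE ltrDl divr_gt0// gtrDl oppr_lt0 divr_gt0.
apply: eA; split=> // i j; rewrite (ord1 i) /ball /= distrC.
have := yb j; rewrite !mxE => /andP[h1 h2]; rewrite ltr_distlC.
by apply/andP; split; lra.
Qed.

Lemma nbhs_rat_box (x : E) (A : set E) : nbhs x A -> exists q r : 'rV[rat]_d,
  open_box (map_mx ratr q) (map_mx ratr r) x /\
  [set y : E | forall i, ratr (q ord0 i) <= y ord0 i <= ratr (r ord0 i)] `<=` A.
Proof.
move=> /nbhs_boxP[a [b [xab abA]]].
have exq i : exists q : rat, a ord0 i < ratr q < x ord0 i.
  have /andP[h _] := xab i; have [q] := rat_in_itvoo h.
  by rewrite in_itv /= => ?; exists q.
have exr i : exists q : rat, x ord0 i < ratr q < b ord0 i.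
  have /andP[_ h] := xab i; have [q] := rat_in_itvoo h.
  by rewrite in_itv /= => ?; exists q.
have [q hq] := choice exq; have [r hr] := choice exr.
exists (\row_i q i), (\row_i r i); split=> [i|y hy].
  by rewrite !mxE; have /andP[_ ->] := hq i; have /andP[-> _] := hr i.
apply: abA => i; have := hy i; rewrite !mxE => /andP[h1 h2].
have /andP[h3 _] := hq i; have /andP[_ h4] := hr i.
by rewrite (le_trans (ltW h3) h1) (le_trans h2 (ltW h4)).
Qed.

(** The rational open boxes with closure in [A], enumerated along [nat] with junk
    value [set0].  They cover an open [A], which makes open sets measurable and
    reduces statements almost everywhere in [A] to boxes. *)
Definition rat_box (A : set E) (n : nat) : set E :=
  if (unpickle n : option ('rV[rat]_d * 'rV[rat]_d)) is Some (q, r) then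
    if `[< [set y : E | forall i, ratr (q ord0 i) <= y ord0 i <= ratr (r ord0 i)] `<=` A >]
    then open_box (map_mx ratr q) (map_mx ratr r) else set0
  else set0.

Lemma rat_boxP A n : rat_box A n = set0 \/ exists a b : E,
  rat_box A n = open_box a b /\
  [set y : E | forall i, a ord0 i <= y ord0 i <= b ord0 i] `<=` A.
Proof.
rewrite /rat_box; case: unpickle => [[q r]|]; last by left.
case: asboolP => h; [right|by left].
exists (map_mx ratr q), (map_mx ratr r); split=> // y hy; apply: h => i.
by have := hy i; rewrite !mxE.
Qed.

Lemma open_bigcup_rat_box A : open A -> A = \bigcup_n rat_box A n.
Proof.
rewrite openE => oA; apply/seteqP; split=> [x /oA /nbhs_rat_box[q [r [xqr qrA]]]|x [n _]].
  exists (pickle (q, r)) => //; rewrite /rat_box pickleK.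
  by case: asboolP.
have [->//|[a [b [-> abA]]]] := rat_boxP A n.
by move=> xab; apply: abA => i; have /andP[/ltW -> /ltW ->] := xab i.
Qed.

Lemma measurable_rV_box (A : 'I_d -> set R) : (forall i, measurable (A i)) ->
  measurable [set x : E | forall i, A i (x ord0 i)].
Proof.
move=> mA; have -> : [set x : E | forall i, A i (x ord0 i)] =
    \big[setI/setT]_(i < d) ((fun x : E => x ord0 i) @^-1` A i).
  apply/seteqP; split=> x; rewrite -bigcap_seq /=.
    by move=> xA i _; exact: xA.
  by move=> h i; have := h i (mem_index_enum i).
apply: bigsetI_measurable => i _.
by rewrite -[X in measurable X]setTI; exact: measurable_coord_rV.
Qed.

Lemma rV_box_finite (A : 'I_d -> set R) : (forall i, measurable (A i)) ->
  (forall i, lebesgue_measure (A i) < +oo)%E ->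
  (mu [set x : E | forall i, A i (x ord0 i)] < +oo)%E.
Proof.
move=> mA fA; rewrite (lebesgue_rV_box mA).
have : ((\prod_(i < d) lebesgue_measure (A i)) < +oo /\
    0 <= \prod_(i < d) lebesgue_measure (A i))%E.
  apply: (big_ind (fun x : \bar R => x < +oo /\ 0 <= x)%E) => [|x y [x1 x0] [y1 y0]|i _].
  - by rewrite ltry lee01.
  - by split; [apply: lte_mul_pinfty => //; rewrite ge0_fin_numE|exact: mule_ge0].
  - by split; [exact: fA|exact: measure_ge0].
by case.
Qed.

Lemma open_boxE (a b : E) :
  open_box a b = [set x : E | forall i, `]a ord0 i, b ord0 i[%classic (x ord0 i)].
Proof. by apply/seteqP; split=> x /= h i; have := h i; rewrite /= in_itv. Qed.

Lemma measurable_open_box (a b : E) : measurable (open_box a b).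
Proof. by rewrite open_boxE; apply: (@measurable_rV_box (fun i => `]a ord0 i, b ord0 i[%classic)) => i; exact: measurable_itv. Qed.

Lemma open_box_finite (a b : E) : (mu (open_box a b) < +oo)%E.
Proof.
rewrite open_boxE; apply: (@rV_box_finite (fun i => `]a ord0 i, b ord0 i[%classic)) => i; first exact: measurable_itv.
by rewrite lebesgue_measure_itv /=; case: ifP => _; rewrite ?ltry.
Qed.

Lemma open_measurable_rV (A : set E) : open A -> measurable A.
Proof.
move=> /open_bigcup_rat_box ->; apply: bigcupT_measurable => n.
have [->|[a [b [-> _]]]] := rat_boxP A n; first exact: measurable0.
exact: measurable_open_box.
Qed.

Lemma continuous_measurable_rV (f : E -> R) : continuous f -> measurable_fun setT f.
Proof.
move=> /continuousP cf; apply: (measurability _ (RGenOInfty.measurableE R)).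
move=> _ [_ [a ->] <-]; rewrite setTI; apply: open_measurable_rV.
by apply: cf; exact: interval_open.
Qed.

(** A pi-system generating the sigma-algebra, for Dynkin's theorem. *)
Definition open_boxes : set (set E) := [set B | exists a b : E, B = open_box a b].

Lemma measurable_open_boxes : (0 < d)%N -> measurable = <<s open_boxes >>.
Proof.
move=> d0; apply/seteqP; split; last first.
  apply: smallest_sub; first exact: sigma_algebra_measurable.
  by move=> _ [a [b ->]]; exact: measurable_open_box.
have open_gen (A : set E) : open A -> <<s open_boxes >> A.
  move=> /open_bigcup_rat_box ->; apply: sigma_algebra_bigcup => n.
  have [->|[a [b [-> _]]]] := rat_boxP A n; first exact: sigma_algebra0.
  by apply: sub_sigma_algebra; exists a, b.
apply: smallest_sub; first exact: smallest_sigma_algebra.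
move=> A; rewrite /= -bigcup_seq => -[i _ [B mB <-]]; rewrite setTI.
have mc : measurable_fun setT ((fun x => x ord0 i) : g_sigma_algebraType open_boxes -> R).
  apply: (measurability _ (RGenOInfty.measurableE R)).
  move=> _ [_ [a ->] <-]; rewrite setTI; apply: open_gen.
  have /continuousP := @coord_continuous R 1 d ord0 i; apply.
  exact: interval_open.
by have := mc measurableT B mB; rewrite setTI.
Qed.

Lemma open_boxI (a b a' b' : E) : open_box a b `&` open_box a' b' =
  open_box (\row_i Num.max (a ord0 i) (a' ord0 i)) (\row_i Num.min (b ord0 i) (b' ord0 i)).
Proof.
apply/seteqP; split=> x /=.
  move=> [h1 h2] i; rewrite !mxE gt_max lt_min.
  by have /andP[-> ->] := h1 i; have /andP[-> ->] := h2 i.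
move=> h; split=> i; have := h i; rewrite !mxE gt_max lt_min.
  by move=> /andP[/andP[-> _] /andP[-> _]].
by move=> /andP[/andP[_ ->] /andP[_ ->]].
Qed.

Lemma setI_closed_open_boxes : setI_closed open_boxes.
Proof.
move=> _ _ [a [b ->]] [a' [b' ->]]; rewrite open_boxI.
by exists (\row_i Num.max (a ord0 i) (a' ord0 i)), (\row_i Num.min (b ord0 i) (b' ord0 i)).
Qed.

Definition cbox (M : R) : set E := [set x | forall i, `[- M, M]%classic (x ord0 i)].

Lemma measurable_cbox M : measurable (cbox M).
Proof. by apply: (@measurable_rV_box (fun=> `[- M, M]%classic)) => i; exact: measurable_itv. Qed.

Lemma cbox_finite M : (mu (cbox M) < +oo)%E.
Proof.
apply: (@rV_box_finite (fun=> `[- M, M]%classic)) => i; first exact: measurable_itv.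
by rewrite lebesgue_measure_itv /=; case: ifP => _; rewrite ?ltry.
Qed.

End borel_rV.

Section test_functions.
Context {R : realType} {d : nat}.
Local Notation E := 'rV[R]_d.
Local Notation mu := (@lebesgue_rV R d).
Implicit Types (Omega : set E) (f g phi psi : E -> R).

Lemma smooth_partial i phi : smooth phi -> smooth (partial i phi).
Proof.
move=> sphi s; have [c h] := sphi (rcons s i).
by rewrite foldr_rcons in c h.
Qed.

Lemma smooth_continuous phi : smooth phi -> continuous phi.
Proof. by move=> /(_ [::])[]. Qed.

Lemma smooth_derivable phi i x : smooth phi -> derivable phi x (delta_mx 0 i).
Proof. by move=> /(_ [::])[_]; exact. Qed.

Lemma foldr_partialZD c phi psi s : smooth phi -> smooth psi ->
  foldr (@partial R d) (c *: (phi : E -> R^o) + psi) s =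
  c *: (foldr (@partial R d) phi s : E -> R^o) + foldr (@partial R d) psi s.
Proof.
move=> sphi spsi; elim: s => [//|i s IH]; rewrite [LHS]/= IH /partial; apply/funext => x.
have [_ h1] := sphi s; have [_ h2] := spsi s.
rewrite deriveD//; last by apply: derivableZ; exact: h1.
by rewrite deriveZ.
Qed.

Lemma smoothZD c phi psi : smooth phi -> smooth psi ->
  smooth (c *: (phi : E -> R^o) + psi).
Proof.
move=> sphi spsi s; rewrite foldr_partialZD//.
have [c1 h1] := sphi s; have [c2 h2] := spsi s; split.
  move=> x; apply: continuousD; last exact: c2.
  change {for x, continuous (fun y => c * foldr (@partial R d) phi s y)}.
  by apply: continuousM; [exact: cst_continuous|exact: c1].
by move=> i x; apply: derivableD => //; apply: derivableZ; exact: h1.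
Qed.

Lemma smooth0 : smooth (0 : E -> R^o).
Proof.
move=> s; have -> : foldr (@partial R d) (0 : E -> R^o) s = (0 : E -> R^o).
  elim: s => [//|i s /= ->]; apply/funext => x; exact: derive_cst.
by split=> [x|i x]; [exact: cst_continuous|exact: derivable_cst].
Qed.

Lemma test_function0 Omega : test_function Omega (0 : E -> R^o).
Proof.
have -> : test_function Omega (0 : E -> R^o) =
    [/\ smooth (0 : E -> R^o), compact (closure (set0 : set E)) & closure (set0 : set E) `<=` Omega].
  rewrite /test_function (_ : [set x | _] = set0)//.
  by apply/seteqP; split=> x //=; rewrite eqxx.
by rewrite closure0; split; [exact: smooth0|exact: compact0|].
Qed.

Lemma test_functionZD Omega c phi psi : test_function Omega phi -> test_function Omega psi ->
  test_function Omega (c *: (phi : E -> R^o) + psi).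
Proof.
move=> [s1 c1 o1] [s2 c2 o2].
have sub : closure [set x | (c *: (phi : E -> R^o) + psi) x != 0] `<=`
    closure [set x | phi x != 0] `|` closure [set x | psi x != 0].
  rewrite -closureU; apply: closureS => x /=; apply: contraNP => /not_orP[/negP + /negP].
  rewrite !negbK => /eqP h1 /eqP h2.
  change (c * phi x + psi x == 0); by rewrite h1 h2 mulr0 addr0.
split; first exact: smoothZD.
  by apply: subclosed_compact (compactU c1 c2) sub; exact: closed_closure.
by apply: subset_trans sub _; rewrite subUset.
Qed.

Lemma support_partial i phi :
  closure [set x | partial i phi x != 0] `<=` closure [set x | phi x != 0].
Proof.
have cl := @closed_closure _ [set x | phi x != 0].
rewrite [X in _ `<=` X](iffLR (closure_id _) cl).
apply: closureS => x; apply: contraPP => nx.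
have : open (~` closure [set x | phi x != 0]) by rewrite openC; exact: closed_closure.
rewrite openE => /(_ x nx) nbx /=; apply/negP; rewrite negbK /partial; apply/eqP.
transitivity ('D_(delta_mx 0 i) (cst (0 : R)) x); last by rewrite derive_cst.
apply: near_eq_derive; move: nbx; rewrite /interior; apply: filterS => y ny.
apply/eqP; apply: contrapT => h; apply: ny; apply: subset_closure; exact/negP.
Qed.

Lemma test_function_partial Omega i phi :
  test_function Omega phi -> test_function Omega (partial i phi).
Proof.
move=> [s1 c1 o1]; have sub := @support_partial i phi; split.
- exact: smooth_partial.
- by apply: subclosed_compact c1 sub; exact: closed_closure.
- exact: subset_trans sub o1.
Qed.

Lemma test_function_bound Omega phi : test_function Omega phi ->
  exists2 M : R, (forall x, `|phi x| <= M) & forall x, phi x != 0 -> cbox M x.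
Proof.
move=> [s1 c1 o1].
have [M1 [_ hM1]] : bounded_set (phi @` closure [set x | phi x != 0]).
  apply: compact_bounded; apply: continuous_compact c1.
  by apply: continuous_subspaceT; exact: smooth_continuous.
have [M2 [_ hM2]] := compact_bounded c1.
exists (`|M1| + 1 + (`|M2| + 1)) => x.
  have [->|px] := eqVneq (phi x) 0; first by rewrite normr0.
  have /hM1 h : M1 < `|M1| + 1 by rewrite ltr_pwDr// ler_norm.
  apply: le_trans (h (phi x) _) _; first by exists x => //; exact: subset_closure.
  by rewrite lerDl.
move=> px i; have /hM2 h : M2 < `|M2| + 1 by rewrite ltr_pwDr// ler_norm.
have := h x (@subset_closure _ [set x | phi x != 0] x px); rewrite /Num.norm/= mx_normrE.
have := le_bigmax (0 : R) (fun j : 'I_1 * 'I_d => `|x j.1 j.2|) (ord0, i).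
move=> /le_trans /[apply] /= xi; rewrite /= in_itv/= -ler_norml; apply: le_trans xi _.
by change (`|M2| + 1 <= `|M1| + 1 + (`|M2| + 1)); rewrite lerDr addr_ge0.
Qed.

Lemma bounded_L2 Omega f M : measurable Omega -> measurable_fun setT f ->
  (forall x, `|f x| <= M) -> (forall x, f x != 0 -> cbox M x) -> L2 Omega f.
Proof.
move=> mO mf fM fsupp.
have mf' : measurable_fun Omega f by apply: measurable_funS mf.
split=> //; rewrite /sq_norm.
apply: (@le_lt_trans _ _ (\int[mu]_(x in cbox M) (M ^+ 2)%:E)%E); last first.
  by rewrite integral_cst ?lte_mul_pinfty ?lee_fin ?sqr_ge0 ?cbox_finite//; exact: measurable_cbox.
rewrite integral_mkcond [leRHS]integral_mkcond; apply: ge0_le_integral => //.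
- by move=> x _; rewrite /patch; case: ifP => // _; rewrite lee_fin sqr_ge0.
- apply/(measurable_restrict _ mO measurableT).
  by rewrite setTI; apply/measurable_EFinP; apply: measurable_funX.
- by apply/(measurable_restrict _ (measurable_cbox M) measurableT); rewrite setTI.
move=> x _; rewrite /patch; have [f0|fn0] := eqVneq (f x) 0.
  by rewrite f0 expr0n /=; case: ifP; case: ifP => // _ _; rewrite lee_fin sqr_ge0.
rewrite [X in (_ <= if X then _ else _)%E]mem_set; last exact: fsupp.
case: ifP => _; rewrite lee_fin ?sqr_ge0//.
by rewrite -(real_normK (num_real (f x))); apply: lerXn2r; rewrite ?nnegrE// (le_trans _ (fM x)).
Qed.

Lemma test_function_L2 Omega Omega' phi : measurable Omega' -> test_function Omega phi ->
  L2 Omega' phi.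
Proof.
move=> mO tphi; have [M] := test_function_bound tphi; apply: bounded_L2 => //.
by have [/smooth_continuous/continuous_measurable_rV] := tphi.
Qed.

End test_functions.

(** * Bump functions and the uniqueness of weak gradients *)

Section flat_functions.
Context {R : realType}.

(** The functions [p (1/t) exp (-1/t)] on [t > 0], extended by 0: a family
    stable under derivation. *)
Definition flat (p : {poly R}) (t : R) : R :=
  if 0 < t then p.[t^-1] * expR (- t^-1) else 0.

Definition flat_derive (p : {poly R}) : {poly R} := 'X^2 * (p - p^`()).

Lemma expR_ge_expn (n : nat) (y : R) : 0 <= y -> y ^+ n <= n%:R ^+ n * expR y.
Proof.
case: n => [|n] y0; first by rewrite !expr0 mul1r -expR0 ler_expR.
have n0 : 0 < n.+1%:R :> R by rewrite ltr0n.
have -> : y ^+ n.+1 = n.+1%:R ^+ n.+1 * (y / n.+1%:R) ^+ n.+1.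
  by rewrite -exprMn mulrC divfK// gt_eqF.
rewrite ler_wpM2l ?exprn_ge0//.
have -> : expR y = expR (y / n.+1%:R) ^+ n.+1.
  by rewrite -expRM_natl mulrC divfK// gt_eqF.
rewrite lerXn2r ?nnegrE ?divr_ge0 ?expR_ge0//.
by apply: le_trans (expR_ge1Dx _); rewrite lerDr.
Qed.

Lemma expR_ge_poly (p : {poly R}) : exists2 C : R, 0 <= C &
  forall y, 0 <= y -> `|p.[y]| <= C * expR y.
Proof.
exists (\sum_(i < size p) `|p`_i| * i%:R ^+ i).
  by apply: sumr_ge0 => i _; rewrite mulr_ge0// exprn_ge0.
move=> y y0; rewrite horner_coef mulr_suml; apply: le_trans (ler_norm_sum _ _ _) _.
apply: ler_sum => i _; rewrite normrM -mulrA ler_wpM2l//.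
by rewrite ger0_norm ?exprn_ge0// expR_ge_expn.
Qed.

(** A quadratic bound, so that [flat p] is differentiable at 0 with derivative 0. *)
Lemma flat_le (p : {poly R}) : exists2 C : R, 0 <= C & forall t, `|flat p t| <= C * t ^+ 2.
Proof.
have [C C0 hC] := expR_ge_poly ('X^2 * p); exists C => // t; rewrite /flat.
case: ifPn => [t0|_]; last by rewrite normr0 mulr_ge0// sqr_ge0.
have ti : 0 < t^-1 by rewrite invr_gt0.
have := hC _ (ltW ti); rewrite hornerM hornerXn => h.
have e0 := expR_gt0 t^-1.
rewrite expRN normrM (ger0_norm (_ : 0 <= (expR t^-1)^-1)) ?invr_ge0 ?expR_ge0//.
rewrite ler_pdivrMr//; move: h; rewrite normrM (ger0_norm (sqr_ge0 _)) => h.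
have t2 : 0 < t ^+ 2 by rewrite exprn_gt0.
have tt : t ^+ 2 * t^-1 ^+ 2 = 1 by rewrite -exprMn divff ?gt_eqF// expr1n.
by have := ler_wpM2l (ltW t2) h; rewrite mulrA tt mul1r mulrA [t ^+ 2 * C]mulrC.
Qed.

Lemma flat_le0 (p : {poly R}) t : t <= 0 -> flat p t = 0.
Proof. by rewrite /flat ltNge => ->. Qed.

Lemma is_derive_horner (p : {poly R}) (x : R) : is_derive x 1 (horner p) p^`().[x].
Proof.
elim/poly_ind: p => [|p c IH].
  rewrite deriv0 horner0 (_ : horner 0 = cst 0); first exact: is_derive_cst.
  by apply/funext => y; rewrite horner0.
have -> : horner (p * 'X + c%:P) = (horner p * id) + cst c.
  by apply/funext => y; rewrite !hornerE.
apply: (is_derive_eq (is_deriveD (is_deriveM IH (is_derive_id _ _)) (is_derive_cst _ _ _))).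
by rewrite derivD derivM derivX derivC !hornerE /GRing.scale/=; ring.
Qed.

Lemma flat_is_derive (p : {poly R}) (t : R) : is_derive t 1 (flat p) (flat (flat_derive p) t).
Proof.
have [t0|t0|->] := ltgtP t 0.
- rewrite (flat_le0 _ (ltW t0)).
  apply: (@near_eq_is_derive _ _ _ (cst 0)) => //.
  near=> y; rewrite /= flat_le0// ltW//; near: y; exact: lt_nbhsl.
- pose g (y : R) := p.[y^-1] * expR (- y^-1).
  apply: (@near_eq_is_derive _ _ _ g).
  + by near=> y; rewrite /flat /g ifT//; near: y; exact: lt_nbhsr.
  have di : is_derive t 1 (fun y : R => y^-1) (- t ^- 2).
    have := @is_deriveV R id t 1 1 (lt0r_neq0 t0) (is_derive_id _ _).
    by rewrite /GRing.scale/= mulr1.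
  have d1 : is_derive t 1 (fun y : R => p.[y^-1]) (p^`().[t^-1] * (- t ^- 2)).
    exact: (@is_derive1_comp _ (horner p) (fun y : R => y^-1) _ _ _ (is_derive_horner p _) di).
  have d2 : is_derive t 1 (fun y : R => expR (- y^-1)) (expR (- t^-1) * (t ^- 2)).
    have dn : is_derive t 1 (fun y : R => - y^-1) (- - t ^- 2) := is_deriveN di.
    by have := @is_derive1_comp _ expR _ _ _ _ (is_derive_expR _) dn; rewrite opprK.
  have := is_deriveM d1 d2; rewrite /GRing.scale/=.
  move=> h; apply: (is_derive_eq h).
  rewrite /flat t0 /flat_derive hornerM hornerXn hornerD hornerN.
  by field; rewrite gt_eqF.
rewrite (flat_le0 _ (lexx 0)).
have [C C0 hC] := flat_le p.
have lim : h^-1 *: (flat p (h *: 1 + 0) - flat p 0) @[h --> (0 : R)^'] --> (0 : R).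
  rewrite (flat_le0 _ (lexx 0)); apply/norm_cvg0P.
  apply: (@cvg0_squeeze _ _ _ _ _ (fun h => C * `|h|)) => [h|].
    rewrite normr_ge0 /= subr0 addr0 /GRing.scale/= mulr1 normrM normfV.
    have [->|h0] := eqVneq h 0; first by rewrite normr0 invr0 mul0r mulr0.
    rewrite mulrC ler_pdivrMr ?normr_gt0//; apply: le_trans (hC h) _.
    by rewrite -mulrA -expr2 real_normK ?num_real.
  rewrite -[X in _ --> X](mulr0 C); apply: cvgM; first exact: cvg_cst.
  rewrite -[X in _ --> X](@normr0 _ R); apply: (@cvg_norm _ _ _ _ _ id).
  exact: nbhs_dnbhs.
by apply: DeriveDef; [apply/cvg_ex; exists 0|exact: cvg_lim lim].
Unshelve. all: by end_near. Qed.

End flat_functions.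

Section smooth_class.
Context {R : realType}.
Implicit Types f g : R -> R.

Lemma flatZ c (p : {poly R}) t : flat (c *: p) t = c * flat p t.
Proof. by rewrite /flat; case: ifP; rewrite ?mulr0// hornerZ mulrA. Qed.

(** Smoothness on the line, in the form of a set of functions containing [f] and
    stable under derivation. *)
Definition smooth1 f := exists2 S : set (R -> R), S f &
  forall g, S g -> exists2 g', S g' & forall t : R, is_derive t 1 g (g' t).

Lemma smooth1_flat p m c : smooth1 (fun t => flat p (m * t + c)).
Proof.
exists [set f | exists q, f = fun t => flat q (m * t + c)]; first by exists p.
move=> _ [q ->]; exists (fun t => flat (m *: flat_derive q) (m * t + c)).
  by exists (m *: flat_derive q).
move=> t; rewrite flatZ mulrC.
apply: (@is_derive1_comp _ (flat q) (fun t => m * t + c)); first exact: flat_is_derive.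
have h : is_derive t (1 : R) (m \*: (@id R) + cst c) (m *: 1 + 0) by exact: is_deriveD.
by move: h; rewrite /GRing.scale/= mulr1 addr0.
Qed.

(** Finite sums of products, such as the derivatives of a product. *)
Inductive sum_prod (S T : set (R -> R)) : (R -> R) -> Prop :=
| SumProd1 f g : S f -> T g -> sum_prod S T (f * g)
| SumProdD f g : sum_prod S T f -> sum_prod S T g -> sum_prod S T (f + g).

Lemma smooth1M f g : smooth1 f -> smooth1 g -> smooth1 (f * g).
Proof.
move=> [S Sf hS] [T Tg hT]; exists (sum_prod S T); first exact: SumProd1.
move=> h; elim => {Sf Tg h}f {}g.
  move=> /[dup] Sf' /hS[f' Sf'' df] /[dup] Tg' /hT[g' Tg'' dg].
  exists (f' * g + f * g'); first by apply: SumProdD; exact: SumProd1.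
  move=> t; apply: (is_derive_eq (is_deriveM (df t) (dg t))).
  by rewrite fctE/= /GRing.scale/= addrC [g t * _]mulrC.
move=> _ [f' h1 df] _ [g' h2 dg]; exists (f' + g'); first exact: SumProdD.
by move=> t; exact: is_deriveD.
Qed.

Lemma is_derive1_continuous f (x df : R) : is_derive x 1 f df -> {for x, continuous f}.
Proof. by move=> [h _]; apply: differentiable_continuous; exact/derivable1_diffP. Qed.

End smooth_class.

Section product_functions.
Context {R : realType} {d : nat}.
Local Notation E := 'rV[R]_d.

Definition prodf (f : 'I_d -> R -> R) : E -> R := fun x => \prod_i f i (x ord0 i).

Lemma prodf_continuous f : (forall i, continuous (f i)) -> continuous (prodf f).
Proof.
move=> cf; rewrite /prodf; elim: (index_enum _) => [|i r IH].
  by under eq_fun do rewrite big_nil; exact: cst_continuous.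
under eq_fun do rewrite big_cons; move=> x; apply: continuousM; last exact: IH.
by apply: (@continuous_comp _ _ _ (fun y : E => y ord0 i)); [exact: coord_continuous|exact: cf].
Qed.

(** In the direction of one coordinate the other factors are constant. *)
Lemma prodf_derive f g (x : E) j : is_derive (x ord0 j) 1 (f j) g ->
  is_derive x (delta_mx 0 j) (prodf f) (g * \prod_(i | i != j) f i (x ord0 i)).
Proof.
move=> dfg; pose K := \prod_(i | i != j) f i (x ord0 i).
have E1 : (fun h : R => h^-1 *: (prodf f (h *: delta_mx 0 j + x) - prodf f x)) =
    (fun h : R => h^-1 *: (f j (h *: 1 + x ord0 j) - f j (x ord0 j)) * K).
  apply/funext => h; rewrite /prodf (bigD1 j)//= [in X in _ - X](bigD1 j)//=.
  rewrite [X in _ * X - _](eq_bigr (fun i => f i (x ord0 i))) => [|i ij].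
    by rewrite -mulrBl !mxE !eqxx mulr1 /GRing.scale/= mulr1 mulrA.
  by rewrite !mxE (negbTE ij) andbF mulr0 add0r.
have lim : h^-1 *: (prodf f (h *: delta_mx 0 j + x) - prodf f x) @[h --> (0 : R)^'] --> g * K.
  rewrite E1; apply: cvgM; last exact: cvg_cst.
  have [df <-] := dfg; move/cvg_ex : df => [l hl].
  by rewrite /derive (cvg_lim _ hl).
apply: DeriveDef; first by apply/cvg_ex; exists (g * K).
exact: cvg_lim lim.
Qed.

Lemma smooth_prodf f : (forall i, smooth1 (f i)) -> smooth (prodf f).
Proof.
move=> sf; have /choice[S hS] : forall i, exists S : set (R -> R), S (f i) /\
    forall g, S g -> exists2 g', S g' & forall t : R, is_derive t 1 g (g' t).
  by move=> i; have [S Sf hS] := sf i; exists S.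
have key s : exists2 g, (forall i, S i (g i)) & foldr (@partial R d) (prodf f) s = prodf g.
  elim: s => [|j s [g Sg /= ->]]; first by exists f => // i; have [] := hS i.
  have [g' Sg' dg] := (hS j).2 _ (Sg j).
  exists (fun i => if i == j then g' else g i) => [i|]; first by case: eqP => [->|].
  apply/funext => x; rewrite /partial.
  have [_ ->] := prodf_derive (dg (x ord0 j)).
  rewrite /prodf [RHS](bigD1 j)//= eqxx; congr (_ * _).
  by apply: eq_bigr => i ij; rewrite (negbTE ij).
move=> s; have [g Sg ->] := key s; split.
  apply: prodf_continuous => i t; have [g' _ dg] := (hS i).2 _ (Sg i).
  exact: is_derive1_continuous (dg t).
move=> i x; have [g' _ dg] := (hS i).2 _ (Sg i).
by have [] := prodf_derive (dg (x ord0 i)).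
Qed.

(** Smooth functions supported in a closed box, increasing to the indicator of
    its interior as [m] grows. *)
Definition bump (a b : E) (m : nat) : E -> R := prodf (fun i t =>
  flat 1 (m.+1%:R * t - m.+1%:R * a ord0 i) * flat 1 (- m.+1%:R * t + m.+1%:R * b ord0 i)).

Lemma bump_support a b m x : bump a b m x != 0 -> open_box a b x.
Proof.
move=> h i; apply: contraNT h => nx; rewrite /bump /prodf (bigD1 i)//= mulf_eq0.
apply/orP; left; rewrite mulf_eq0; have m0 : 0 < m.+1%:R :> R by rewrite ltr0n.
move: nx; rewrite negb_and -!leNgt => /orP[h|h]; apply/orP; [left|right].
  by rewrite flat_le0// subr_le0 ler_pM2l.
by rewrite flat_le0// mulNr addrC subr_le0 ler_pM2l.
Qed.

Lemma flat1_01 (t : R) : 0 <= flat 1 t <= 1.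
Proof.
rewrite /flat; case: ifPn => [t0|_]; last by rewrite lexx ler01.
by rewrite hornerC mul1r expR_ge0 -expR0 ler_expR oppr_le0 invr_ge0 ltW.
Qed.

Lemma bump_01 a b m x : 0 <= bump a b m x <= 1.
Proof.
rewrite /bump /prodf; apply: (big_ind (fun y : R => 0 <= y <= 1)).
- by rewrite ler01 lexx.
- by move=> y z /andP[y0 y1] /andP[z0 z1]; rewrite mulr_ge0//= mulr_ile1.
move=> i _; have /andP[y0 y1] := flat1_01 (m.+1%:R * x ord0 i - m.+1%:R * a ord0 i).
have /andP[z0 z1] := flat1_01 (- m.+1%:R * x ord0 i + m.+1%:R * b ord0 i).
by rewrite mulr_ge0//= mulr_ile1.
Qed.

Lemma bump_test (Omega : set E) (a b : E) m :
  [set y : E | forall i, a ord0 i <= y ord0 i <= b ord0 i] `<=` Omega ->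
  test_function Omega (bump a b m).
Proof.
move=> abO; pose B := [set y : E | forall i, `[a ord0 i, b ord0 i]%classic (y ord0 i)].
have cB : compact B.
  apply: (@rV_compact _ _ (fun i => `[a ord0 i, b ord0 i]%classic)) => i.
  exact: segment_compact.
have clB : closed B by apply: compact_closed cB; exact: norm_hausdorff.
have sub : closure [set x | bump a b m x != 0] `<=` B.
  rewrite [X in _ `<=` X](iffLR (closure_id _) clB).
  apply: closureS => x /= /bump_support xab i /=; rewrite in_itv/=.
  by have /andP[/ltW -> /ltW ->] := xab i.
split.
- by apply: smooth_prodf => i; apply: smooth1M; exact: smooth1_flat.
- by apply: subclosed_compact cB sub; exact: closed_closure.
- by move=> x /sub xB; apply: abO => i; have := xB i; rewrite /= in_itv.
Qed.

Lemma flat1_cvg (c : R) : 0 < c -> flat 1 (m.+1%:R * c) @[m --> \oo] --> (1 : R).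
Proof.
move=> c0.
have -> : (fun m => flat 1 (m.+1%:R * c)) = (fun m : nat => expR (- (c^-1 * m.+1%:R^-1))).
  apply/funext => m; rewrite /flat mulr_gt0 ?ltr0n// hornerC mul1r invfM mulrC//.
rewrite -[X in _ --> X](expR0 R); apply: continuous_cvg; first exact: continuous_expR.
rewrite -oppr0 -[X in - X](mulr0 c^-1); apply: cvgN; apply: cvgM; first exact: cvg_cst.
exact: cvg_harmonic.
Qed.

Lemma bump_cvg a b x : open_box a b x -> bump a b m x @[m --> \oo] --> (1 : R).
Proof.
move=> xab; rewrite /bump /prodf.
pose F i (m : nat) : R := flat 1 (m.+1%:R * x ord0 i - m.+1%:R * a ord0 i) *
  flat 1 (- m.+1%:R * x ord0 i + m.+1%:R * b ord0 i).
have F1 i : F i m @[m --> \oo] --> (1 : R).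
  have /andP[h1 h2] := xab i.
  have h3 : 0 < x ord0 i - a ord0 i by rewrite subr_gt0.
  have h4 : 0 < b ord0 i - x ord0 i by rewrite subr_gt0.
  have -> : F i = (fun m : nat => flat 1 (m.+1%:R * (x ord0 i - a ord0 i)) *
      flat 1 (m.+1%:R * (b ord0 i - x ord0 i))).
    by apply/funext => m; rewrite /F !mulrBr mulNr [- _ + _]addrC.
  by rewrite -[X in _ --> X](mulr1 1); apply: cvgM; exact: flat1_cvg.
change ((fun m => \prod_(i <- index_enum 'I_d) F i m) m @[m --> \oo] --> (1 : R)).
elim: (index_enum _) => [|i r IH].
  have -> : (fun m => \prod_(i <- [::]) F i m) = cst 1 by apply/funext => m; rewrite big_nil.
  exact: cvg_cst.
have -> : (fun m => \prod_(j <- i :: r) F j m) = (fun m => F i m * \prod_(j <- r) F j m).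
  by apply/funext => m; rewrite big_cons.
by rewrite -[X in _ --> X](mulr1 1); apply: cvgM.
Qed.

End product_functions.

Section weak_gradient_uniqueness.
Context {R : realType} {d : nat}.
Local Notation E := 'rV[R]_d.
Local Notation mu := (@lebesgue_rV R d).
Variable Omega : set E.
Hypothesis oO : open Omega.
Hypothesis d0 : (0 < d)%N.
Implicit Types u v w : E -> R.

Let mO : measurable Omega. Proof. exact: open_measurable_rV. Qed.

Lemma L2S (A B : set E) u : measurable A -> measurable B -> A `<=` B -> L2 B u -> L2 A u.
Proof.
move=> mA mB AB [mf uL]; split; first exact: measurable_funS mf.
apply: le_lt_trans uL; apply: ge0_subset_integral => //.
  by apply/measurable_EFinP; apply: measurable_funX.
by move=> x _; rewrite lee_fin sqr_ge0.
Qed.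

Lemma L2_open_box_integrable a b u : L2 (open_box a b) u ->
  mu.-integrable (open_box a b) (EFin \o u).
Proof.
move=> uL; have mB := measurable_open_box a b.
have L1 : L2 (open_box a b) (cst 1 : E -> R).
  split; first exact: measurable_cst.
  rewrite /sq_norm; under eq_integral do rewrite /= expr1n.
  by rewrite integral_cst// mul1e open_box_finite.
by have := L2_integrable mB uL L1; apply: eq_integrable => // x _ /=; rewrite mulr1.
Qed.

(** Bump functions increase to the indicator of the box, and dominated
    convergence applies. *)
Lemma test_orthogonal_open_box u (a b : E) : L2 Omega u ->
  (forall phi, test_function Omega phi -> L2ip Omega u phi = 0) ->
  [set y : E | forall i, a ord0 i <= y ord0 i <= b ord0 i] `<=` Omega ->
  \int[mu]_(x in open_box a b) u x = 0.
Proof.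
move=> uL uorth abO; pose B := open_box a b; have mB : measurable B := measurable_open_box a b.
have BO : B `<=` Omega.
  by move=> x xB; apply: abO => i; have /andP[/ltW -> /ltW ->] := xB i.
have uB : L2 B u by apply: L2S uL.
have iu := L2_open_box_integrable uB.
pose f m : E -> \bar R := EFin \o (fun x => u x * bump a b m x).
have mbump m : measurable_fun B (bump a b m).
  have [/smooth_continuous/continuous_measurable_rV h _ _] := bump_test m abO.
  exact: measurable_funS h.
have intf m : (\int[mu]_(x in B) f m x = 0)%E.
  have tb := bump_test m abO.
  have := uorth _ tb; rewrite L2ipE /Rintegral => h.
  have fin : (\int[mu]_(x in Omega) (u x * bump a b m x)%:E)%E \is a fin_num.
    apply: integrable_fin_num => //.
    by apply: (L2_integrable mO uL); exact: test_function_L2 tb.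
  have : (\int[mu]_(x in Omega) (u x * bump a b m x)%:E = 0)%E by rewrite -(fineK fin) h.
  rewrite (_ : Omega = Omega `|` B); last by apply/esym/setUidPl.
  move=> <-; rewrite [RHS]integral_mkcond [LHS]integral_mkcond; apply: eq_integral => x _.
  rewrite /patch; case: (boolP (x \in B)) => [xB|xB].
    by rewrite mem_set//; right; exact/set_mem.
  case: ifP => // _; have [->|nz] := eqVneq (bump a b m x) 0; first by rewrite mulr0.
  by exfalso; move/negP: xB; apply; apply/mem_set; exact: bump_support nz.
have [|||||_ _ lim] := @dominated_convergence _ _ _ mu B mB f (EFin \o u) (EFin \o (fun x => `|u x|)).
- move=> m; apply/measurable_EFinP; apply: measurable_funM => //.
  by have [] := uB.
- by apply/measurable_EFinP; have [] := uB.
- apply: aeW => x xB; apply: cvg_EFin; first exact: nearW.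
  rewrite /= -[X in _ --> X]mulr1; apply: cvgM; first exact: cvg_cst.
  exact: bump_cvg.
- exact: integrable_norm iu.
- apply: aeW => x m xB; rewrite /f /= lee_fin normrM ler_piMr//.
  by have /andP[h1 h2] := bump_01 a b m x; rewrite ger0_norm.
have lim0 : (\int[mu]_(x in B) f n x)%E @[n --> \oo] --> (0 : \bar R).
  by under eq_fun do rewrite intf; exact: cvg_cst.
by rewrite /Rintegral (cvg_unique _ lim lim0).
Qed.

(** The fundamental lemma of the calculus of variations: by Dynkin's theorem the
    integral over every Borel subset of a box vanishes. *)
Lemma test_orthogonal_ae0 u : L2 Omega u ->
  (forall phi, test_function Omega phi -> L2ip Omega u phi = 0) -> ae_zero Omega u.
Proof.
move=> uL uorth.
have box_null (a b : E) : [set y : E | forall i, a ord0 i <= y ord0 i <= b ord0 i] `<=` Omega ->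
    ae_zero (open_box a b) u.
  move=> abO; pose B := open_box a b; have mB : measurable B := measurable_open_box a b.
  have BO : B `<=` Omega.
    by move=> x xB; apply: abO => i; have /andP[/ltW -> /ltW ->] := xB i.
  have uB : L2 B u by apply: L2S uL.
  have iu : mu.-integrable B (EFin \o u) by exact: L2_open_box_integrable.
  have iuS S : measurable S -> mu.-integrable (B `&` S) (EFin \o u).
    by move=> mS; apply: integrableS iu => //; exact: measurableI.
  have fin S : measurable S -> (\int[mu]_(x in B `&` S) (u x)%:E)%E \is a fin_num.
    by move=> mS; apply: integrable_fin_num; [exact: measurableI|exact: iuS].
  have null S : measurable S -> (\int[mu]_(x in B `&` S) (u x)%:E = 0)%E.
    move=> mS; have mg := @measurable_open_boxes R _ d0.
    have gS : <<s @open_boxes R d >> S by rewrite -mg.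
    apply: (@dynkin_induction _ _ _ (fun S => (\int[mu]_(x in B `&` S) (u x)%:E = 0)%E)
      mg (@setI_closed_open_boxes R d) _ _ _ _ S gS).
    - rewrite setIT; have := test_orthogonal_open_box uL uorth abO.
      by rewrite -[B]setIT /Rintegral => h; rewrite -(fineK (fin _ measurableT)) setIT h.
    - move=> _ [a' [b' ->]] /=; have mB' := measurable_open_box a' b'.
      rewrite -(fineK (fin _ mB')); congr EFin; rewrite /B open_boxI.
      apply: test_orthogonal_open_box => // y hy; apply: abO => i.
      by have := hy i; rewrite !mxE ge_max le_min => /andP[/andP[-> _] /andP[-> _]].
    - move=> A mA /= A0.
      have := @integral_setU_EFin _ _ _ mu (B `&` A) (B `&` ~` A) u.
      rewrite -setIUr setUv setIT A0 add0e => <-.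
      + have := test_orthogonal_open_box uL uorth abO.
        by rewrite -[B]setIT /Rintegral => h; rewrite -(fineK (fin _ measurableT)) setIT h.
      + exact: measurableI.
      + by apply: measurableI => //; exact: measurableC.
      + by have [] := uB.
      + by apply/disj_setPS => x [[_ Ax] [_]].
    - move=> F mF tF F0 /=; rewrite setI_bigcupr integral_bigcup.
      + by rewrite eseries0// => i _ _; exact: F0.
      + apply/trivIsetP => i j _ _ ij; rewrite setIACA.
        by move/trivIsetP : tF => /(_ i j I I ij) ->; rewrite setI0.
      + by move=> k; apply: measurableI.
      + by rewrite -setI_bigcupr; apply: iuS; exact: bigcupT_measurable.
  have := @integral_ae_eq _ _ _ mu B mB (cst 0%E) (EFin \o u) iu (measurable_cst _).
  move=> /(_ _)/wrap[A AB mA|].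
    have := null A mA; rewrite (_ : B `&` A = A); last exact/setIidPr.
    by move=> ->; rewrite integral0.
  by apply: filterS => x h Bx; have := h Bx => /= -[].
have /ae_foralln : forall n, \forall x \ae mu, rat_box Omega n x -> u x = 0.
  move=> n; have [->|[a [b [-> abO]]]] := rat_boxP Omega n; first exact: aeW.
  exact: box_null.
apply: filterS => x h Ox.
by have [n _ /h] : (\bigcup_n rat_box Omega n) x by rewrite -open_bigcup_rat_box.
Qed.

End weak_gradient_uniqueness.

(** * The form domain as a Hilbert space *)

Section gradients.
Context {R : realType} {d : nat}.
Local Notation E := 'rV[R]_d.
Local Notation mu := (@lebesgue_rV R d).
Variable Omega : set E.
Hypothesis oO : open Omega.
Hypothesis d0 : (0 < d)%N.
Implicit Types (u v w phi : E -> R) (G : 'I_d -> E -> R).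

Let mO : measurable Omega. Proof. exact: open_measurable_rV. Qed.

Definition L2_space : semihilbert (E -> R^o) := L2_semihilbert mO.

Local Notation L := L2_space.

Definition normsq u := L2ip Omega u u.

Local Notation L2 := (L2 Omega).
Local Notation L2ip := (L2ip Omega).
Lemma L2ipBl u v w : L2 u -> L2 v -> L2 w ->
  L2ip (u \- v) w = L2ip u w - L2ip v w.
Proof. exact: (@ipBl _ _ L). Qed.

Lemma L2ip0l w : L2 w -> L2ip (0 : E -> R^o) w = 0.
Proof. exact: (@ip0l _ _ L). Qed.

Lemma normsqZ c u : L2 u -> normsq (c *: (u : E -> R^o)) = c ^+ 2 * normsq u.
Proof.
move=> uL; have cL : dom L (c *: (u : E -> R^o)) by exact: domZ.
have -> : normsq (c *: (u : E -> R^o)) = ip L (c *: (u : E -> R^o)) (c *: (u : E -> R^o)) by [].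
by rewrite ipZl// ipZr// mulrA.
Qed.

Lemma L2D u v : L2 u -> L2 v -> L2 (u \+ v).
Proof. exact: (@domD _ _ L). Qed.

Lemma L2B u v : L2 u -> L2 v -> L2 (u \- v).
Proof. exact: (@domB _ _ L). Qed.

Lemma normsq_ge0 u : L2 u -> 0 <= normsq u.
Proof. exact: L2ip_ge0. Qed.

Lemma normsqD_le u v : L2 u -> L2 v -> normsq (u \+ v) <= 2 * normsq u + 2 * normsq v.
Proof.
move=> uL vL; have := @ip_sqrDZ _ _ L 1 u v uL vL; rewrite scale1r.
have := @ip_sqrB _ _ L u v uL vL; have : 0 <= ip L (u - v : E -> R^o) (u - v : E -> R^o).
  by apply: ip_ge0; exact: domB.
have -> : normsq (u \+ v) = ip L (u + v : E -> R^o) (u + v : E -> R^o) by [].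
have -> : normsq u = ip L u u by []; have -> : normsq v = ip L v v by [].
move=> h1 h2 ->; lra.
Qed.

Lemma normsqB_le u v w : L2 u -> L2 v -> L2 w ->
  normsq (u \- w) <= 2 * normsq (u \- v) + 2 * normsq (v \- w).
Proof.
move=> uL vL wL; have -> : u \- w = (u \- v) \+ (v \- w).
  by apply/funext => x /=; rewrite addrA subrK.
by apply: normsqD_le; exact: L2B.
Qed.

Local Notation H1 := (H1 Omega).
Local Notation H10 := (H10 Omega).
Local Notation weak_gradient := (weak_gradient Omega).
Local Notation ae_zero := (ae_zero Omega).
Local Notation test_function := (test_function Omega).
Lemma ae_zero_normsq u : L2 u -> normsq u = 0 -> ae_zero u.
Proof.
move=> uL u0; have [mf _] := uL.
have /ae_eq_integral_abs : measurable_fun Omega (EFin \o (fun x => u x ^+ 2)).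
  by apply/measurable_EFinP; apply: measurable_funX.
have h0 : (\int[mu]_(x in Omega) `|(EFin \o (fun x => (u x ^+ 2)%R)) x| = 0)%E.
  rewrite (eq_integral (fun x => ((u x) ^+ 2)%:E)) => [|x _]; last first.
    by rewrite /= ger0_norm ?sqr_ge0.
  by have := sq_normE mO uL; rewrite /sq_norm => ->; rewrite -/(normsq u) u0.
move=> /(_ mu mO)[+ _] => /(_ h0); apply: filterS => x h Ox.
by have := h Ox => -[] /eqP; rewrite sqrf_eq0 => /eqP.
Qed.

Lemma ae_zero_L2ip u v : measurable_fun Omega u -> measurable_fun Omega v ->
  ae_zero u -> L2ip u v = 0.
Proof.
move=> mfu mfv u0; rewrite L2ipE /Rintegral.
rewrite (@ae_eq_integral _ _ _ mu Omega (cst 0%E)) ?integral0//.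
- by apply/measurable_EFinP; exact: measurable_funM.
- by move: u0; apply: filterS => x h Ox; rewrite h// mul0r.
Qed.

Lemma ae_zero_normsq0 u : measurable_fun Omega u -> ae_zero u -> normsq u = 0.
Proof. by move=> mf /(ae_zero_L2ip mf mf). Qed.

Lemma eq_L2ip u u' v : L2 u -> L2 u' -> L2 v ->
  ae_zero (u \- u') -> L2ip u v = L2ip u' v.
Proof.
move=> uL uL' vL h; have [mf _] := L2B uL uL'; have [mv _] := vL.
apply/eqP; rewrite -subr_eq0; apply/eqP.
by have := ae_zero_L2ip mf mv h; rewrite L2ipBl.
Qed.

Lemma eq_L2ip2 u u' v v' : L2 u -> L2 u' -> L2 v -> L2 v' ->
  ae_zero (u \- u') -> ae_zero (v \- v') ->
  L2ip u v = L2ip u' v'.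
Proof.
move=> uL uL' vL vL' h h'; rewrite (eq_L2ip uL uL' vL h).
by rewrite (L2ipC uL' vL) (L2ipC uL' vL'); exact: eq_L2ip.
Qed.

Lemma ae_zeroZD c u v : ae_zero u -> ae_zero v ->
  ae_zero (fun x => c * u x + v x).
Proof.
move=> u0 v0; apply: filterS2 u0 v0 => x h1 h2 Ox.
by rewrite h1// h2// mulr0 addr0.
Qed.

Lemma eq_ae_zero u v : u =1 v -> ae_zero u -> ae_zero v.
Proof. by move=> uv; apply: filterS => x; rewrite uv. Qed.

Lemma ae_zero0 : ae_zero (fun=> 0).
Proof. exact: aeW. Qed.

Lemma weak_gradientP u G : weak_gradient u G <->
  (forall i, L2 (G i)) /\ forall i phi, test_function phi ->
    L2ip u (partial i phi) = - L2ip (G i) phi.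
Proof.
split=> [h|[h1 h2] i]; first split=> [i|i phi tphi]; first by have [] := h i.
  by rewrite !L2ipE; have [_ ->] := h i.
by split=> [|phi tphi]; [exact: h1|rewrite -!L2ipE; exact: h2].
Qed.

Lemma weak_gradient_unique u G G' i : weak_gradient u G -> weak_gradient u G' ->
  ae_zero (G i \- G' i).
Proof.
move=> /weak_gradientP[GL hG] /weak_gradientP[GL' hG'].
apply: (test_orthogonal_ae0 oO d0); first exact: L2B.
move=> phi tphi; have pL := test_function_L2 mO tphi.
rewrite L2ipBl//; apply/eqP.
by rewrite subr_eq0 -eqr_opp -hG// hG'.
Qed.

Local Notation grad := (grad Omega).
Lemma gradP u : H1 u -> weak_gradient u (grad u).
Proof. by move=> [_ [G hG]]; rewrite /grad; case: xgetP => [G' -> //|/(_ G)]. Qed.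

Lemma grad_L2 u i : H1 u -> L2 (grad u i).
Proof. by move=> /gradP/weak_gradientP[]. Qed.

Lemma weak_gradientZD c u v G G' : L2 u -> L2 v ->
  weak_gradient u G -> weak_gradient v G' ->
  weak_gradient (c *: (u : E -> R^o) + v) (fun i => c *: (G i : E -> R^o) + G' i).
Proof.
move=> uL vL /weak_gradientP[GL hG] /weak_gradientP[GL' hG'].
apply/weak_gradientP; split=> [i|i phi tphi]; first exact: L2_ZD.
have pL := test_function_L2 mO tphi.
have dpL := test_function_L2 mO (test_function_partial i tphi).
by rewrite !(L2ip_ZDl mO)// hG// hG'//; ring.
Qed.

Lemma L2_limit_ip (u_ : nat -> E -> R) u w : (forall n, L2 (u_ n)) -> L2 u ->
  L2 w -> normsq (u_ n \- u) @[n --> \oo] --> (0 : R) ->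
  L2ip (u_ n) w @[n --> \oo] --> L2ip u w.
Proof. by move=> h1 h2 h3; exact: (@cvg_ip_strong _ _ L). Qed.

(** Both sides of the integration by parts formula are continuous in L2. *)
Lemma weak_gradient_limit (u_ : nat -> E -> R) (G_ : nat -> 'I_d -> E -> R) u G :
  (forall n, L2 (u_ n)) -> L2 u -> (forall i, L2 (G i)) ->
  (forall n, weak_gradient (u_ n) (G_ n)) ->
  normsq (u_ n \- u) @[n --> \oo] --> (0 : R) ->
  (forall i, normsq (G_ n i \- G i) @[n --> \oo] --> (0 : R)) ->
  weak_gradient u G.
Proof.
move=> uL_ uL GL wg ulim Glim; apply/weak_gradientP; split=> // i phi tphi.
have pL := test_function_L2 mO tphi.
have dpL := test_function_L2 mO (test_function_partial i tphi).
have h1 := L2_limit_ip uL_ uL dpL ulim.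
have GL_ n : L2 (G_ n i) by have /weak_gradientP[] := wg n.
have h2 : - L2ip (G_ n i) phi @[n --> \oo] --> - L2ip (G i) phi.
  by apply: cvgN; exact: L2_limit_ip.
have fE : (fun n => L2ip (u_ n) (partial i phi)) = fun n => - L2ip (G_ n i) phi.
  by apply/funext => n; have /weak_gradientP[_ ->] := wg n.
by move: h1; rewrite fE => h1; exact: norm_cvg_unique h1 h2.
Qed.

(** Density of the test functions, for an arbitrary representative [G] of the weak
    gradient. *)
Definition test_limit u G := forall e : R, 0 < e -> exists2 phi, test_function phi &
  normsq (u \- phi) + \sum_(i < d) normsq (G i \- partial i phi) < e.

Lemma H10_test_limit u : H10 u <-> H1 u /\ test_limit u (grad u).
Proof.
have E1 phi : H1 u -> test_function phi ->
    (sq_norm Omega (u \- phi)%R + \sum_(i < d) sq_norm Omega (grad u i \- partial i phi)%R)%E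
    = (normsq (u \- phi) + \sum_(i < d) normsq (grad u i \- partial i phi))%:E.
  move=> hu tphi; have pL := test_function_L2 mO tphi; have [uL _] := hu.
  rewrite sq_normE//; last exact: L2B.
  rewrite EFinD -sumEFin; congr (_ + _)%E; apply: eq_bigr => i _; rewrite sq_normE//.
  by apply: L2B; [exact: grad_L2|exact: test_function_L2 (test_function_partial i tphi)].
split=> -[hu h]; split=> // e e0.
  have se : 0 < Num.sqrt e by rewrite sqrtr_gt0.
  have [phi tphi] := h _ se; rewrite E1// lte_fin sqr_sqrtr ?ltW// => hphi.
  by exists phi.
have e20 : 0 < e ^+ 2 by rewrite exprn_gt0.
have [phi tphi hphi] := h _ e20; exists phi => //.
by rewrite E1// lte_fin.
Qed.

(** Weak gradients agree almost everywhere with the one chosen by [grad]. *)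
Lemma H10_intro u G : L2 u -> weak_gradient u G -> test_limit u G -> H10 u.
Proof.
move=> uL wG h; have hu : H1 u by split=> //; exists G.
apply/H10_test_limit; split=> // e e0; have [phi tphi hphi] := h e e0.
exists phi => //; move: hphi; congr (_ + _ < _); apply: eq_bigr => i _.
have /weak_gradientP[GL _] := wG.
have dpL := test_function_L2 mO (test_function_partial i tphi).
have gL := grad_L2 i hu.
have z : ae_zero ((G i \- partial i phi) \- (grad u i \- partial i phi)).
  apply: eq_ae_zero (weak_gradient_unique i wG (gradP hu)) => x /=.
  by rewrite opprB addrA subrK.
by apply: eq_L2ip2 => //; exact: L2B.
Qed.

Lemma gradZD c u v i : H1 u -> H1 v ->
  H1 (c *: (u : E -> R^o) + v) /\
  ae_zero (grad (c *: (u : E -> R^o) + v) i \-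
    (c *: (grad u i : E -> R^o) + grad v i)).
Proof.
move=> hu hv; have [uL _] := hu; have [vL _] := hv.
have w := weak_gradientZD c uL vL (gradP hu) (gradP hv).
have h : H1 (c *: (u : E -> R^o) + v).
  by split; [exact: L2_ZD|eexists; exact: w].
split=> //; exact: weak_gradient_unique i (gradP h) w.
Qed.

Lemma partialZD c phi psi i : smooth phi -> smooth psi ->
  partial i (c *: (phi : E -> R^o) + psi) = c *: (partial i phi : E -> R^o) + partial i psi.
Proof. by move=> s1 s2; exact: (foldr_partialZD c [:: i] s1 s2). Qed.

Lemma normsqZD_le c u v u' v' : L2 u -> L2 v -> L2 u' -> L2 v' ->
  normsq ((c *: (u : E -> R^o) + v) \- (c *: (u' : E -> R^o) + v')) <=
  2 * c ^+ 2 * normsq (u \- u') + 2 * normsq (v \- v').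
Proof.
move=> uL vL uL' vL'.
have -> : (c *: (u : E -> R^o) + v) \- (c *: (u' : E -> R^o) + v') =
    (c *: (u \- u' : E -> R^o)) \+ (v \- v').
  apply/funext => x; change (c * u x + v x - (c * u' x + v' x) = c * (u x - u' x) + (v x - v' x)).
  ring.
apply: le_trans (normsqD_le _ _) _; [exact: (@domZ _ _ L) (L2B uL uL')|exact: L2B|].
by rewrite lerD2r normsqZ ?mulrA//; exact: L2B.
Qed.

Lemma H10ZD c u v : H10 u -> H10 v -> H10 (c *: (u : E -> R^o) + v).
Proof.
move=> /H10_test_limit[hu tu] /H10_test_limit[hv tv].
have [uL _] := hu; have [vL _] := hv.
apply: (@H10_intro _ (fun i => c *: (grad u i : E -> R^o) + grad v i)).
- exact: L2_ZD.
- exact: weak_gradientZD (gradP hu) (gradP hv).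
move=> e e0; pose k := 2 * c ^+ 2 + 2.
have k0 : 0 < k by rewrite ltr_wpDl// mulr_ge0// sqr_ge0.
have ek : 0 < e / k by rewrite divr_gt0.
have [phi tphi hphi] := tu _ ek; have [psi tpsi hpsi] := tv _ ek.
exists (c *: (phi : E -> R^o) + psi); first exact: test_functionZD.
have pL := test_function_L2 mO tphi; have qL := test_function_L2 mO tpsi.
have [sphi _ _] := tphi; have [spsi _ _] := tpsi.
apply: (@le_lt_trans _ _ (2 * c ^+ 2 * (normsq (u \- phi) + \sum_(i < d) normsq (grad u i \- partial i phi))
   + 2 * (normsq (v \- psi) + \sum_(i < d) normsq (grad v i \- partial i psi)))).
  rewrite !mulrDr addrACA; apply: lerD; first exact: normsqZD_le.
  rewrite !mulr_sumr -big_split; apply: ler_sum => i _; rewrite partialZD//.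
  have dpL := test_function_L2 mO (test_function_partial i tphi).
  have dqL := test_function_L2 mO (test_function_partial i tpsi).
  by apply: normsqZD_le => //; exact: grad_L2.
move: hphi hpsi; set a := normsq _ + _; set b := normsq _ + _ => ha hb.
have -> : e = 2 * c ^+ 2 * (e / k) + 2 * (e / k) by rewrite -mulrDl mulrCA divff ?mulr1 ?gt_eqF.
have c2 : 0 <= 2 * c ^+ 2 by rewrite mulr_ge0// sqr_ge0.
have := ler_wpM2l c2 (ltW ha); lra.
Qed.

Lemma weak_gradient0 : weak_gradient (0 : E -> R^o) (fun=> (0 : E -> R^o)).
Proof.
apply/weak_gradientP; split=> [i|i phi tphi]; first exact: L2_0.
have pL := test_function_L2 mO tphi.
have dpL := test_function_L2 mO (test_function_partial i tphi).
by rewrite !L2ip0l// oppr0.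
Qed.

Lemma H10_0 : H10 (0 : E -> R^o).
Proof.
apply: (H10_intro (L2_0 Omega) weak_gradient0) => e e0.
exists (0 : E -> R^o); first exact: test_function0.
have n0 : normsq ((0 : E -> R^o) \- (0 : E -> R^o)) = 0.
  have -> : (0 : E -> R^o) \- (0 : E -> R^o) = (0 : E -> R^o).
    by apply/funext => x; exact: subrr.
  by rewrite /normsq L2ip0l//; exact: L2_0.
rewrite n0 add0r big1// => i _; rewrite -[RHS]n0; congr (normsq (_ \- _)).
by apply/funext => x; exact: derive_cst.
Qed.

(** Test functions close to [u_ n] for a large [n] are close to the limit. *)
Lemma H10_limit (u_ : nat -> E -> R) u G :
  (forall n, H10 (u_ n)) -> L2 u -> (forall i, L2 (G i)) ->
  normsq (u_ n \- u) @[n --> \oo] --> (0 : R) ->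
  (forall i, normsq (grad (u_ n) i \- G i) @[n --> \oo] --> (0 : R)) ->
  weak_gradient u G /\ H10 u.
Proof.
move=> hu_ uL GL ulim Glim.
have H1_ n : H1 (u_ n) by have [] := hu_ n.
have uL_ n : L2 (u_ n) by have [] := H1_ n.
have wG := weak_gradient_limit uL_ uL GL (fun n => gradP (H1_ n)) ulim Glim.
split=> //; apply: (H10_intro uL wG) => e e0.
have lim : normsq (u_ n \- u) + \sum_(i < d) normsq (grad (u_ n) i \- G i) @[n --> \oo] -->
    0 + \sum_(i < d) (0 : R).
  by apply: cvgD => //; apply: cvg_sum => i _; exact: Glim.
rewrite big1// addr0 in lim.
have e4 : 0 < e / 4 by rewrite divr_gt0.
move/cvgr0Pnorm_lt : lim => /(_ _ e4)[N _ /(_ N (leqnn N))].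
set a := _ + _ => ha; have [_ /(_ _ e4)[phi tphi]] := (H10_test_limit _).1 (hu_ N).
set b := _ + _ => hb; exists phi => //.
have pL := test_function_L2 mO tphi.
have dpL i := test_function_L2 mO (test_function_partial i tphi).
have C x y : normsq (x \- y) = normsq (y \- x).
  rewrite /normsq !L2ipE; apply: eq_Rintegral => z _ /=; ring.
apply: (@le_lt_trans _ _ (2 * a + 2 * b)).
  rewrite /a /b !mulrDr addrACA; apply: lerD.
    by rewrite [normsq (u_ N \- u)]C; exact: normsqB_le.
  rewrite !mulr_sumr -big_split; apply: ler_sum => i _.
  rewrite [normsq (grad (u_ N) i \- _)]C; apply: normsqB_le => //; exact: grad_L2.
by have := ler_norm a; lra.
Qed.

End gradients.

Section form_domain.
Context {R : realType} {d : nat}.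
Local Notation E := 'rV[R]_d.
Local Notation mu := (@lebesgue_rV R d).
Variables (Omega : set E) (V : E -> R).
Hypothesis oO : open Omega.
Hypothesis d0 : (0 < d)%N.
Hypothesis mV : measurable_fun Omega V.
Hypothesis V0 : {ae mu, forall x, Omega x -> 0 <= V x}.
Implicit Types (u v w phi : E -> R).

Let mO : measurable Omega. Proof. exact: open_measurable_rV. Qed.
Local Notation normsq := (normsq Omega).

Local Notation grad := (grad Omega).
Local Notation H10V := (H10V Omega V).
(** Multiplication by the square root of the potential, which turns the
    potential energy into a squared L2 norm. *)
Definition sqrtV u : E -> R := fun x => Num.sqrt (V x) * u x.

Lemma measurable_sqrtV u : measurable_fun Omega u -> measurable_fun Omega (sqrtV u).
Proof.
move=> mf; apply: measurable_funM => //.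
by apply: (measurableT_comp _ mV); apply: continuous_measurable_fun; exact: sqrt_continuous.
Qed.

Lemma sqrtV_mul : {ae mu, forall x, Omega x ->
  forall u v, V x * u x * v x = sqrtV u x * sqrtV v x}.
Proof.
move: V0; apply: filterS => x h Ox u v; rewrite /sqrtV mulrACA -expr2 sqr_sqrtr ?mulrA//.
exact: h.
Qed.

Lemma sqrtVZD c u v : sqrtV (c *: (u : E -> R^o) + v) = c *: (sqrtV u : E -> R^o) + sqrtV v.
Proof.
apply/funext => x.
change (Num.sqrt (V x) * (c * u x + v x) = c * (Num.sqrt (V x) * u x) + Num.sqrt (V x) * v x).
ring.
Qed.

Local Notation H1 := (H1 Omega).
Local Notation H10 := (H10 Omega).
Local Notation ae_zero := (ae_zero Omega).
Lemma H10VP u : H10V u <-> H10 u /\ L2 Omega (sqrtV u).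
Proof.
suff h : H10 u -> ((\int[mu]_(x in Omega) (V x * (u x) ^+ 2)%:E < +oo)%E <-> L2 Omega (sqrtV u)).
  by split=> -[/[dup] /h hu]; split=> //; apply/hu.
move=> [[[mf _] _] _]; have mS := measurable_sqrtV mf.
have -> : (\int[mu]_(x in Omega) (V x * (u x) ^+ 2)%:E = sq_norm Omega (sqrtV u))%E.
  apply: ae_eq_integral => //.
  - by apply/measurable_EFinP; apply: measurable_funM => //; apply: measurable_funX.
  - by apply/measurable_EFinP; apply: measurable_funX.
  by apply: filterS sqrtV_mul => x h Ox; rewrite !expr2 mulrA h.
by split=> [h|[]].
Qed.

Local Notation L2 := (L2 Omega).
Local Notation L2ip := (L2ip Omega).
Lemma H10V_L2 u : H10V u -> L2 u.
Proof. by move=> [[[]]]. Qed.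

Lemma H10V_H1 u : H10V u -> H1 u.
Proof. by move=> [[]]. Qed.

Lemma H10V_sqrtV u : H10V u -> L2 (sqrtV u).
Proof. by move=> /H10VP[]. Qed.

Lemma H10V_0 : H10V (0 : E -> R^o).
Proof.
apply/H10VP; split; first exact: H10_0.
rewrite (_ : sqrtV _ = (0 : E -> R^o)); first exact: L2_0.
by apply/funext => x; rewrite /sqrtV mulr0.
Qed.

Lemma H10V_ZD c u v : H10V u -> H10V v ->
  H10V (c *: (u : E -> R^o) + v).
Proof.
move=> /H10VP[hu su] /H10VP[hv sv]; apply/H10VP; split; first exact: H10ZD.
by rewrite sqrtVZD; exact: L2_ZD.
Qed.

Definition energy u v : R :=
  \sum_(i < d) L2ip (grad u i) (grad v i) + L2ip (sqrtV u) (sqrtV v).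

Lemma energyE u v : H10V u -> H10V v ->
  \int[mu]_(x in Omega)
    ((\sum_(i < d) grad u i x * grad v i x) + V x * u x * v x) = energy u v.
Proof.
move=> hu hv.
have [uL _] := H10V_H1 hu; have [vL _] := H10V_H1 hv.
have [mfu _] := uL; have [mfv _] := vL.
have gu i := grad_L2 i (H10V_H1 hu); have gv i := grad_L2 i (H10V_H1 hv).
have iS i : mu.-integrable Omega (EFin \o (fun x => grad u i x * grad v i x)).
  exact: L2_integrable.
have iV : mu.-integrable Omega (EFin \o (fun x => sqrtV u x * sqrtV v x)).
  by apply: L2_integrable => //; exact: H10V_sqrtV.
have [h1 h2] := Rintegral_sum (index_enum 'I_d) mO iS.
have {}h2 : \int[mu]_(x in Omega) (\sum_(i < d) grad u i x * grad v i x) =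
    \sum_(i < d) L2ip (grad u i) (grad v i).
  by rewrite h2; apply: eq_bigr => i _; rewrite L2ipE.
rewrite /energy -h2 L2ipE -RintegralD// /Rintegral; congr fine; apply: ae_eq_integral => //.
- apply/measurable_EFinP; apply: measurable_funD.
    by have /integrableP[/measurable_EFinP] := h1.
  by apply: measurable_funM => //; exact: measurable_funM.
- apply/measurable_EFinP; apply: measurable_funD.
    by have /integrableP[/measurable_EFinP] := h1.
  by have /integrableP[/measurable_EFinP] := iV.
by apply: filterS sqrtV_mul => x h Ox; rewrite h.
Qed.

Lemma sqrtVB u v : sqrtV (u \- v) = sqrtV u \- sqrtV v.
Proof. by apply/funext => x; rewrite /sqrtV /=; ring. Qed.

Lemma sqrtV_cvg (f : nat -> E -> R) u x :
  f n x @[n --> \oo] --> u x -> sqrtV (f n) x @[n --> \oo] --> sqrtV u x.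
Proof. by move=> h; apply: cvgM => //; exact: cvg_cst. Qed.

Lemma energyC u v : H10V u -> H10V v -> energy u v = energy v u.
Proof.
move=> hu hv.
have h1 := L2ipC (H10V_sqrtV hu) (H10V_sqrtV hv).
have h2 : \sum_(i < d) L2ip (grad u i) (grad v i) =
    \sum_(i < d) L2ip (grad v i) (grad u i).
  by apply: eq_bigr => i _; exact: (L2ipC (grad_L2 i (H10V_H1 hu)) (grad_L2 i (H10V_H1 hv))).
by rewrite /energy h1 h2.
Qed.

Lemma energy_ge0 u : H10V u -> 0 <= energy u u.
Proof.
move=> hu; apply: addr_ge0; last exact: (L2ip_ge0 (H10V_sqrtV hu)).
by apply: sumr_ge0 => i _; apply: L2ip_ge0; exact: (grad_L2 _ (H10V_H1 hu)).
Qed.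

Lemma energy_ZDl c u v w : H10V u -> H10V v -> H10V w ->
  energy (c *: (u : E -> R^o) + v) w = c * energy u w + energy v w.
Proof.
move=> hu hv hw; have h1u := H10V_H1 hu; have h1v := H10V_H1 hv; have h1w := H10V_H1 hw.
rewrite /energy sqrtVZD (L2ip_ZDl mO c (H10V_sqrtV hu) (H10V_sqrtV hv) (H10V_sqrtV hw)).
have gE i : L2ip (grad (c *: (u : E -> R^o) + v) i) (grad w i) =
    c * L2ip (grad u i) (grad w i) + L2ip (grad v i) (grad w i).
  have gu := grad_L2 i h1u; have gv := grad_L2 i h1v; have gw := grad_L2 i h1w.
  have [h1 h2] := gradZD oO d0 c i h1u h1v.
  rewrite -(L2ip_ZDl mO c gu gv gw).
  exact: (eq_L2ip oO (grad_L2 i h1) (L2_ZD mO c gu gv) gw h2).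
have -> : \sum_(i < d) L2ip (grad (c *: (u : E -> R^o) + v) i) (grad w i) =
    c * (\sum_(i < d) L2ip (grad u i) (grad w i)) +
    \sum_(i < d) L2ip (grad v i) (grad w i).
  by rewrite mulr_sumr -big_split; apply: eq_bigr => i _; exact: gE.
set a := \sum_(i < d) _; set b := \sum_(i < d) _; set a' := L2ip _ _; set b' := L2ip _ _.
ring.
Qed.

Variable c : R.
Hypothesis c0 : 0 < c.

(** The weight [c] is kept as a parameter: with [c = 1] this is the space in which
    minimising sequences converge weakly, and with [c = - l] it yields the
    resolvent at a negative number [l]. *)
Definition graph_ip u v : R := energy u v + c * L2ip u v.

Lemma graph_ip_ge u : H10V u ->
  [/\ c * normsq u <= graph_ip u u, (forall i, normsq (grad u i) <= graph_ip u u) &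
      normsq (sqrtV u) <= graph_ip u u].
Proof.
move=> hu; have h1 := H10V_H1 hu.
have e0 := energy_ge0 hu; have n0 : 0 <= c * normsq u.
  by apply: mulr_ge0; [exact: ltW|exact: (L2ip_ge0 (H10V_L2 hu))].
have s0 := L2ip_ge0 (H10V_sqrtV hu).
have g0 i : 0 <= normsq (grad u i) by apply: L2ip_ge0; exact: grad_L2.
have gs0 : 0 <= \sum_(i < d) normsq (grad u i) by exact: sumr_ge0.
split.
- by rewrite /graph_ip lerDr.
- move=> i; rewrite /graph_ip /energy (bigD1 i)//= -!addrA lerDl.
  by apply: addr_ge0; [apply: sumr_ge0 => j _; exact: g0|exact: addr_ge0].
by rewrite /graph_ip /energy -addrA addrCA lerDl; exact: addr_ge0.
Qed.

(** The functions, their gradients and their products with the square root of [V]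
    converge separately in L2.  The second limit is the gradient of the first
    since weak gradients are closed, and the third one is identified through
    convergence almost everywhere. *)
Lemma graph_complete (f : nat -> E -> R) K : (forall n, H10V (f n)) ->
  (forall n, graph_ip (f n.+1 \- f n) (f n.+1 \- f n) <= K * 4^-1 ^+ n) ->
  exists2 u : E -> R, H10V u &
    graph_ip (f n \- u) (f n \- u) @[n --> \oo] --> (0 : R).
Proof.
move=> hf fK; have h1f n := H10V_H1 (hf n); have fL n := H10V_L2 (hf n).
have BE u v : u \- v = (-1) *: (v : E -> R^o) + u.
  by apply/funext => x; change (u x - v x = -1 * v x + u x); ring.
have hB u v : H10V u -> H10V v -> H10V (u \- v).
  by move=> hu hv; rewrite BE; exact: H10V_ZD.
have gB u v i : H10V u -> H10V v ->
    ae_zero (grad (u \- v) i \- (grad u i \- grad v i)).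
  move=> hu hv; rewrite !BE; have [_] := gradZD oO d0 (-1) i (H10V_H1 hv) (H10V_H1 hu).
  by rewrite !BE.
have ngB u v i : H10V u -> H10V v ->
    normsq (grad (u \- v) i) = normsq (grad u i \- grad v i).
  move=> hu hv; have gu := grad_L2 i (H10V_H1 hu); have gv := grad_L2 i (H10V_H1 hv).
  have guv := grad_L2 i (H10V_H1 (hB u v hu hv)); have z := gB u v i hu hv.
  exact: (eq_L2ip2 oO guv (L2B oO gu gv) guv (L2B oO gu gv) z z).
have lo n := graph_ip_ge (hB _ _ (hf n.+1) (hf n)).
have [|u [uL ulim uae]] := @L2_complete_ae _ _ _ mO f (K / c) fL.
  move=> n; have [h _ _] := lo n; rewrite mulrAC ler_pdivlMr// mulrC.
  exact: le_trans h (fK n).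
have /choice[G hG] i : exists G, L2 G /\
    normsq (grad (f n) i \- G) @[n --> \oo] --> (0 : R).
  have [n|n|G GL Glim] := @L2_complete _ _ _ mO (fun n => grad (f n) i) K.
  - exact: grad_L2.
  - have [_ h _] := lo n; rewrite -/(normsq _) -ngB//; exact: le_trans (h i) (fK n).
  by exists G.
have [n|n|g [gL glim gae]] := @L2_complete_ae _ _ _ mO (fun n => sqrtV (f n)) K.
- exact: H10V_sqrtV.
- have [_ _ h] := lo n; rewrite -/(normsq _) -sqrtVB; exact: le_trans h (fK n).
have sug : ae_zero (sqrtV u \- g).
  apply: filterS2 uae gae => x h1 h2 Ox /=; apply/eqP; rewrite subr_eq0; apply/eqP.
  by apply: (norm_cvg_unique _ (h2 Ox)); apply: sqrtV_cvg; exact: h1.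
have msu : measurable_fun Omega (sqrtV u) by apply: measurable_sqrtV; have [] := uL.
have suL : L2 (sqrtV u).
  have z : normsq (sqrtV u \- g) = 0.
    by apply: ae_zero_normsq0 => //; apply: measurable_funB => //; have [] := gL.
  have zL : L2 (sqrtV u \- g).
    split; first by apply: measurable_funB => //; have [] := gL.
    rewrite /sq_norm (@ae_eq_integral _ _ _ mu Omega (cst 0%E)) ?integral0//.
    - apply/measurable_EFinP; apply: measurable_funX; apply: measurable_funB => //.
      by have [] := gL.
    - by apply: filterS sug => x h Ox; rewrite h// expr0n.
  have -> : sqrtV u = (sqrtV u \- g) \+ g by apply/funext => x /=; rewrite subrK.
  exact: L2D.
have GL i : L2 (G i) by have [] := hG i.
have Glim i : normsq (grad (f n) i \- G i) @[n --> \oo] --> (0 : R) by have [] := hG i.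
have [wG hu] := H10_limit oO d0 (fun n => (hf n).1) uL GL ulim Glim.
have hV : H10V u by apply/H10VP.
exists u => //.
have gE n : graph_ip (f n \- u) (f n \- u) =
    \sum_(i < d) normsq (grad (f n) i \- G i) + normsq (sqrtV (f n) \- g) + c * normsq (f n \- u).
  rewrite /graph_ip /energy; congr (_ + _ + _).
    apply: eq_bigr => i _; rewrite -/(normsq _) ngB//.
    have gf := grad_L2 i (h1f n); have gu := grad_L2 i (H10V_H1 hV).
    have z := weak_gradient_unique oO d0 i wG (gradP (H10V_H1 hV)).
    have z2 : ae_zero ((grad (f n) i \- grad u i) \- (grad (f n) i \- G i)).
      by apply: eq_ae_zero z => x /=; ring.
    exact: (eq_L2ip2 oO (L2B oO gf gu) (L2B oO gf (GL i)) (L2B oO gf gu) (L2B oO gf (GL i)) z2 z2).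
  rewrite sqrtVB; have sf := H10V_sqrtV (hf n).
  have z2 : ae_zero ((sqrtV (f n) \- sqrtV u) \- (sqrtV (f n) \- g)).
    have := ae_zeroZD (-1) sug (ae_zero0 Omega).
    by apply: eq_ae_zero => x /=; ring.
  exact: (eq_L2ip2 oO (L2B oO sf suL) (L2B oO sf gL) (L2B oO sf suL) (L2B oO sf gL) z2 z2).
rewrite (_ : (fun n => _) = (fun n => \sum_(i < d) normsq (grad (f n) i \- G i) +
    normsq (sqrtV (f n) \- g) + c * normsq (f n \- u))); last exact/funext.
suff : \sum_(i < d) normsq (grad (f n) i \- G i) + normsq (sqrtV (f n) \- g) +
    c * normsq (f n \- u) @[n --> \oo] --> \sum_(i < d) (0 : R) + 0 + c * 0.
  by rewrite big1// mulr0 !addr0.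
apply: cvgD; last by apply: cvgM => //; exact: cvg_cst.
by apply: cvgD => //; apply: cvg_sum => i _; exact: Glim.
Qed.

Lemma graph_ipC u v : H10V u -> H10V v -> graph_ip u v = graph_ip v u.
Proof. by move=> hu hv; rewrite /graph_ip energyC// L2ipC//; exact: H10V_L2. Qed.

Lemma graph_ipZDl a u v w : H10V u -> H10V v -> H10V w ->
  graph_ip (a *: (u : E -> R^o) + v) w = a * graph_ip u w + graph_ip v w.
Proof.
move=> hu hv hw; rewrite /graph_ip energy_ZDl// L2ip_ZDl//; try exact: H10V_L2.
ring.
Qed.

Lemma graph_ip_ge0 u : H10V u -> 0 <= graph_ip u u.
Proof.
move=> hu; apply: addr_ge0; first exact: energy_ge0.
by apply: mulr_ge0; [exact: ltW|exact: (L2ip_ge0 (H10V_L2 hu))].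
Qed.

Definition form_domain : semihilbert (E -> R^o) :=
  @SemiHilbert R (E -> R^o) (H10V) graph_ip H10V_0 H10V_ZD graph_ipC graph_ipZDl
    graph_ip_ge0 graph_complete.

End form_domain.

(** * The essential spectrum of the Schroedinger operator *)

Section essential_spectrum.
Context {R : realType} {d : nat}.
Local Notation E := 'rV[R]_d.
Local Notation mu := (@lebesgue_rV R d).
Variables (Omega : set E) (V : E -> R).
Hypothesis oO : open Omega.
Hypothesis d0 : (0 < d)%N.
Hypothesis mV : measurable_fun Omega V.
Hypothesis V0 : {ae mu, forall x, Omega x -> 0 <= V x}.
Implicit Types (u v w phi : E -> R).

Let mO : measurable Omega. Proof. exact: open_measurable_rV. Qed.
Local Notation normsq := (normsq Omega).
Local Notation L2ip := (L2ip Omega).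
Local Notation energy := (energy Omega V).

Local Notation H10V := (H10V Omega V).
Definition energy_space : semihilbert (E -> R^o) := form_domain oO d0 mV V0 ltr01.

Local Notation G := energy_space.

Lemma energy_space_L2 u : dom G u -> dom (L2_space oO) u.
Proof. exact: H10V_L2. Qed.

Lemma ipG u v : ip G u v = energy u v + L2ip u v.
Proof. by rewrite /= /graph_ip mul1r. Qed.

Lemma L2ip_le_energy_space u : dom G u -> ip (L2_space oO) u u <= ip G u u.
Proof. by move=> hu; rewrite ipG lerDr; exact: energy_ge0. Qed.

Lemma formE s u v : shifted_form G (L2_space oO) s u v = energy u v - s * L2ip u v.
Proof. by rewrite /shifted_form ipG mulrDl mul1r opprD addrA addrK. Qed.

Lemma dirichlet_schrodingerP u f : dirichlet_schrodinger Omega V u f <->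
  [/\ H10V u, L2 Omega f & forall v, H10V v -> energy u v = L2ip f v].
Proof.
split=> -[hu fL h]; split=> // v hv.
  by rewrite -energyE// L2ipE; exact: h.
by rewrite energyE// h// L2ipE.
Qed.

(** Finite codimension of the range in weak form: modulo the span of [W], every
    [g] is in the range of the operator minus [s]. *)
Lemma fredholm_codim s : fredholm_at Omega V s -> exists2 W : seq (E -> R^o),
  (forall w, w \in W -> dom (L2_space oO) w) & forall g, dom (L2_space oO) g -> exists2 h, dom G h &
    forall v, dom G v -> (forall w, w \in W -> ip (L2_space oO) w v = 0) ->
      shifted_form G (L2_space oO) s h v = ip (L2_space oO) g v.
Proof.
move=> [_ _ [n [w [wL hw]]]].
exists [seq (w i : E -> R^o) | i <- enum 'I_n]; first by move=> _ /mapP[i _ ->]; exact: wL.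
move=> g gL; have [c [fL [h /dirichlet_schrodingerP[hh _ hE]]]] := hw g gL.
exists h => // v hv vW; have vL := H10V_L2 hv; have hL := H10V_L2 hh.
have wv i : L2ip (w i) v = 0 by apply: vW; apply: map_f; rewrite mem_enum.
have sumL : L2 Omega (\sum_(j < n) c j *: (w j : E -> R^o)).
  by apply: (@dom_sum _ _ (L2_space oO)) => j _; apply: domZ; exact: wL.
have sum0 : L2ip (\sum_(j < n) c j *: (w j : E -> R^o)) v = 0.
  apply: etrans (@ip_suml _ _ (L2_space oO) _ _ _ _ v _ vL) _.
    by move=> j _; apply: domZ; exact: wL.
  rewrite big1// => j _; apply: etrans (@ipZl _ _ (L2_space oO) (c j) (w j) v (wL j) vL) _.
  by rewrite [ip _ _ _]wv mulr0.
have fE : (fun x => s * h x + (g x - \sum_(j < n) c j * w j x)) =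
    s *: (h : E -> R^o) + (g \- \sum_(j < n) c j *: (w j : E -> R^o)).
  apply/funext => x; change (s * h x + (g x - \sum_(j < n) c j * w j x) =
    s * h x + (g x - (\sum_(j < n) c j *: (w j : E -> R^o)) x)).
  by rewrite fct_sumE.
rewrite formE hE// fE (L2ip_ZDl mO)//; last exact: L2B.
rewrite (L2ipBl oO)// sum0 subr0; change (s * L2ip h v + L2ip g v - s * L2ip h v = L2ip g v); ring.
Qed.

(** The supremum of the numbers at which the form is almost nonnegative cannot be
    a Fredholm point, by [threshold_infinite_codim]; so it is at least [Sigma]. *)
Lemma Sigma_almost_nonneg (lambda : R) : (lambda%:E < Sigma Omega V)%E ->
  almost_nonneg G (L2_space oO) lambda.
Proof.
move=> lS; apply: contrapT => nl.
have GL := @energy_space_L2; have ile := @L2ip_le_energy_space.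
pose S := [set s : R | almost_nonneg G (L2_space oO) s].
have S0 : S 0 by exact: almost_nonneg0.
have ubS : ubound S lambda.
  move=> s Ss; rewrite leNgt; apply/negP => ls; apply: nl.
  exact: (almost_nonneg_le GL (ltW ls) Ss).
have hS : has_sup S by split; [exists 0|exists lambda].
pose s := sup S.
have s0 : 0 <= s by exact: (ub_le_sup (proj2 hS) S0).
have below e : 0 < e -> almost_nonneg G (L2_space oO) (s - e).
  move=> e0; have [t St lt] := sup_adherent e0 hS.
  exact: (almost_nonneg_le GL (ltW lt) St).
have above e : 0 < e -> ~ almost_nonneg G (L2_space oO) (s + e).
  move=> e0 h; have := ub_le_sup (proj2 hS) (h : S (s + e)).
  by rewrite -/s gerDl leNgt e0.
have : essential_spectrum Omega V s.
  move=> /fredholm_codim[W dW codim].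
  exact: (threshold_infinite_codim GL ile s0 below above dW codim).
move=> es; have : (Sigma Omega V <= s%:E)%E by apply: ereal_inf_lbound; exists s.
apply/negP; rewrite -ltNge; apply: le_lt_trans lS; rewrite lee_fin.
by apply: ge_sup => //; exists 0.
Qed.

(** Negative numbers are in the resolvent set, by [riesz]. *)
Lemma Sigma_ge0 : (0 <= Sigma Omega V)%E.
Proof.
apply/ereal_infP => _ [l nfred <-]; rewrite lee_fin leNgt; apply/negP => l0.
have c0 : 0 < - l by rewrite oppr_gt0.
pose H := form_domain oO d0 mV V0 c0.
have range g : L2 Omega g -> shifted_range Omega V l g.
  move=> gL; split=> //.
  have [a u v du dv|u du|h hh hE] := @riesz _ _ H (fun v => L2ip g v) (normsq g / (- l)).
  - have uL := H10V_L2 du; have vL := H10V_L2 dv.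
    apply: etrans (@ipDr _ _ (L2_space oO) _ _ _ (@domZ _ _ (L2_space oO) a u uL) vL gL) _.
    by rewrite (@ipZr _ _ (L2_space oO) a u g uL gL).
  - have uL := H10V_L2 du; apply: le_trans (@cauchy_schwarz _ _ (L2_space oO) g u gL uL) _.
    rewrite -mulrA; apply: ler_wpM2l; first exact: (L2ip_ge0 gL).
    rewrite mulrC ler_pdivlMr// mulrC.
    by have [] := graph_ip_ge oO mV V0 c0 du.
  exists h; apply/dirichlet_schrodingerP; split=> //.
    exact: (L2_ZD mO l (H10V_L2 hh) gL).
  move=> v hv; have hL := H10V_L2 hh; have vL := H10V_L2 hv.
  have -> : L2ip (fun x => l * h x + g x) v = l * L2ip h v + L2ip g v.
    exact: (L2ip_ZDl mO l hL gL vL).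
  by have := hE v hv; rewrite /= /graph_ip => <-; ring.
apply: nfred; split.
- exists 0%N, (fun=> 0) => u /dirichlet_schrodingerP[hu _ hE]; exists (fun=> 0).
  have uL := H10V_L2 hu; suff : ae_zero Omega u by apply: eq_ae_zero => x; rewrite big_ord0 subr0.
  apply: (ae_zero_normsq oO) => //; have := hE u hu; have := energy_ge0 oO mV V0 hu.
  have -> : L2ip (fun x => l * u x) u = l * normsq u by exact: (@ipZl _ _ (L2_space oO) l u u uL uL).
  by move=> e0 eE; apply/eqP; rewrite eq_le (normsq_ge0 uL) andbT -(nmulr_rge0 _ l0) -eE.
- by move=> f g _ gL _; exact: range.
exists 0%N, (fun=> 0); split=> [[]//|f fL]; exists (fun=> 0); apply: range.
by rewrite (_ : (fun x => _) = f)//; apply/funext => x; rewrite big_ord0 subr0.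
Qed.

End essential_spectrum.

(** * Poincare inequality on cubes *)

Section slices.
Context {R : realType} (n : nat).
Local Notation E := 'rV[R]_n.
Local Notation E1 := 'rV[R]_n.+1.
Local Notation lam := (@lebesgue_measure R).
Local Notation mu := (@lebesgue_rV R n).
Local Notation mu1 := (@lebesgue_rV R n.+1).
Variables (I : set R) (C : set E).
Hypotheses (mI : measurable I) (mC : measurable C).

Let mcons : measurable_fun [set: measurableTypeR R * E] (@cons_rV R n) :=
  @measurable_cons_rV R n.

(** Lebesgue measure in dimension [n.+1] is by definition the image of a product
    measure under [cons_rV]; this is the corresponding product of sets. *)
Definition cons_set : set E1 := [set y : E1 | I (y ord0 ord0) /\ C (uncons_rV y).2].

Lemma cons_setE t x : cons_set (cons_rV (t, x)) <-> I t /\ C x.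
Proof.
change (I (cons_rV (t, x) ord0 ord0) /\ C (uncons_rV (cons_rV (t, x))).2 <-> I t /\ C x).
by rewrite cons_rVK cons_rV0.
Qed.

Lemma measurable_cons_set : measurable cons_set.
Proof.
rewrite (_ : cons_set = (@uncons_rV R n) @^-1` (I `*` C)); last by [].
rewrite -[X in measurable X]setTI; apply: measurable_uncons_rV => //.
exact: measurableX.
Qed.

Local Open Scope ereal_scope.

Let slice (f : E1 -> \bar R) : R * E -> \bar R := fun z => (f \_ cons_set) (cons_rV z).

Let sliceE f t x : slice f (t, x) = if (t \in I) && (x \in C) then f (cons_rV (t, x)) else 0.
Proof.
rewrite /slice /patch; case: ifPn => [/set_mem/cons_setE[It Cx]|h].
  by rewrite !mem_set.
case: ifPn => // /andP[/set_mem It /set_mem Cx].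
by move/negP: h; case; apply/mem_set/cons_setE.
Qed.

Let slice_meas f : measurable_fun setT f -> measurable_fun [set: measurableTypeR R * E] (slice f).
Proof.
move=> mf; apply: (measurableT_comp _ mcons).
apply/(measurable_restrict _ measurable_cons_set measurableT); rewrite setTI.
exact: measurable_funS mf.
Qed.

Let slice_integral f t : \int[mu]_x slice f (t, x) =
  ((fun t => \int[mu]_(x in C) f (cons_rV (t, x))) \_ I) t.
Proof.
rewrite /patch; case: ifPn => tI; last first.
  by apply: integral0_eq => x _; rewrite sliceE (negbTE tI).
by rewrite [RHS]integral_mkcond; apply: eq_integral => x _; rewrite sliceE tI /patch.
Qed.

Let slice_integral_swap f x : \int[lam]_t slice f (t, x) =
  ((fun x => \int[lam]_(t in I) f (cons_rV (t, x))) \_ C) x.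
Proof.
rewrite /patch; case: ifPn => xC; last first.
  by apply: integral0_eq => t _; rewrite sliceE (negbTE xC) andbF.
rewrite [RHS]integral_mkcond; apply: eq_integral => t _; rewrite sliceE xC andbT.
by rewrite /patch.
Qed.

Variable f : E1 -> R.
Hypotheses (mf : measurable_fun setT f) (intf : mu1.-integrable cons_set (EFin \o f)).

Let mf' : measurable_fun setT (EFin \o f).
Proof. exact/measurable_EFinP. Qed.

Let mpatch : measurable_fun setT ((EFin \o f) \_ cons_set).
Proof.
apply/(measurable_restrict _ measurable_cons_set measurableT); rewrite setTI.
exact: measurable_funS mf'.
Qed.

Let integrable_slice : (lam \x mu).-integrable setT (slice (EFin \o f)).
Proof.
apply/integrableP; split; first exact: slice_meas.
have -> : \int[lam \x mu]_z `|slice (EFin \o f) z| = \int[mu1]_(y in cons_set) `|(f y)%:E|.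
  rewrite [RHS]integral_mkcond.
  have m2 : measurable_fun setT ((fun y => `|(f y)%:E|) \_ cons_set).
    apply/(measurable_restrict _ measurable_cons_set measurableT); rewrite setTI.
    by apply: measurable_funS (measurableT_comp _ mf').
  have p0 y : 0 <= ((fun y => `|(f y)%:E|) \_ cons_set) y by rewrite /patch; case: ifP.
  have h := ge0_integral_pushforward mcons (lam \x mu) measurableT m2 (fun y _ => p0 y).
  apply/esym; apply: etrans h _; apply: eq_integral => z _ /=.
  by rewrite /slice /patch; case: ifP => //; rewrite abse0.
by have /integrableP[] := intf.
Qed.

Let integral_sliceE : \int[mu1]_(y in cons_set) (f y)%:E = \int[lam \x mu]_z slice (EFin \o f) z.
Proof.
rewrite integral_mkcond.
exact: (integral_pushforward mcons (mu := lam \x mu) mpatch integrable_slice measurableT).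
Qed.

Lemma fubini_cons :
  (forall t, mu.-integrable C (fun x => (f (cons_rV (t, x)))%:E)) ->
  lam.-integrable I (fun t => (\int[mu]_(x in C) f (cons_rV (t, x)))%R%:E) /\
  (\int[mu1]_(y in cons_set) f y)%R = (\int[lam]_(t in I) \int[mu]_(x in C) f (cons_rV (t, x)))%R.
Proof.
move=> hs.
have e t : (\int[mu]_(x in C) f (cons_rV (t, x)))%R%:E = \int[mu]_(x in C) (f (cons_rV (t, x)))%:E.
  by rewrite fineK//; exact: integrable_fin_num.
have := integrable_fubini_F integrable_slice; rewrite /fubini_F => h; split.
  apply/(integrable_mkcond (T := measurableTypeR R) _ mI).
  by apply: eq_integrable h => // t _; rewrite slice_integral /patch; case: ifP => // _; rewrite e.
rewrite [LHS]/Rintegral [RHS]/Rintegral; congr fine.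
rewrite integral_sliceE -integral12_prod_meas1// [RHS]integral_mkcond; apply: eq_integral => t _.
by rewrite /fubini_F slice_integral /patch; case: ifP => // _; rewrite e.
Qed.

Lemma fubini_cons_swap : (forall y, (0 <= f y)%R) ->
  (forall x, lam.-integrable I (fun t => (f (cons_rV (t, x)))%:E)) ->
  mu.-integrable C (fun x => (\int[lam]_(t in I) f (cons_rV (t, x)))%R%:E) /\
  (\int[mu1]_(y in cons_set) f y)%R = (\int[mu]_(x in C) \int[lam]_(t in I) f (cons_rV (t, x)))%R.
Proof.
move=> f0 hs.
have e x : (\int[lam]_(t in I) f (cons_rV (t, x)))%R%:E = \int[lam]_(t in I) (f (cons_rV (t, x)))%:E.
  by rewrite fineK//; exact: integrable_fin_num.
have h : mu.-integrable setT (fun x => \int[lam]_t slice (EFin \o f) (t, x)).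
  apply/integrableP; split; first exact: (measurable_fubini_G integrable_slice).
  have := integrable_lty measurableT integrable_slice; rewrite -integral21_prod_meas1//.
  apply: le_lt_trans; rewrite /fubini_G le_eqVlt; apply/orP; left; apply/eqP.
  apply: eq_integral => x _; rewrite gee0_abs//.
  apply: integral_ge0 => t _; rewrite sliceE; case: ifP => // _.
  by rewrite lee_fin.
split.
  apply/(integrable_mkcond _ mC).
  by apply: eq_integrable h => // x _; rewrite slice_integral_swap /patch; case: ifP => // _; rewrite e.
rewrite [LHS]/Rintegral [RHS]/Rintegral; congr fine.
rewrite integral_sliceE -integral21_prod_meas1// [RHS]integral_mkcond; apply: eq_integral => x _.
by rewrite /fubini_G slice_integral_swap /patch; case: ifP => // _; rewrite e.
Qed.

End slices.

Lemma continuous_sqr {R : realType} {T : topologicalType} (f : T -> R) :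
  continuous f -> continuous (fun x => f x ^+ 2).
Proof. by move=> cf x; apply: (cvgM (cf x) (cf x)). Qed.

Section variance.
Context {dd : measure_display} {T : measurableType dd} {R : realType}
  (mu : {measure set T -> \bar R}) (D : set T) (m : R) (f : T -> R).
Hypotheses (mD : measurable D) (muD : mu D = m%:E) (If : mu.-integrable D (EFin \o f))
  (If2 : mu.-integrable D (EFin \o (fun x => f x ^+ 2))).

Let integrable_const (c : R) : mu.-integrable D (EFin \o (fun _ : T => c)).
Proof.
apply: measurable_bounded_integrable => //; first by rewrite muD ltry.
by exists `|c|; split => // M /ltW cM x _.
Qed.

Let integral_sqr_sub c : mu.-integrable D (EFin \o (fun x => (f x - c) ^+ 2)) /\
  \int[mu]_(x in D) ((f x - c) ^+ 2) =
  \int[mu]_(x in D) (f x ^+ 2) - 2 * c * \int[mu]_(x in D) f x + c ^+ 2 * m.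
Proof.
have e x : (f x - c) ^+ 2 = (f x ^+ 2 - (2 * c) * f x) + c ^+ 2 by ring.
have I1 : mu.-integrable D (EFin \o (fun x => (2 * c) * f x)).
  by have := integrableZl mD (2 * c) If.
have I2 : mu.-integrable D (EFin \o (fun x => f x ^+ 2 - (2 * c) * f x)).
  by have := integrableB mD If2 I1.
have I3 : mu.-integrable D (EFin \o (fun _ : T => c ^+ 2)).
  exact: integrable_const.
split.
  have := integrableD mD I2 I3; apply: eq_integrable => // x _ /=.
  by rewrite e.
rewrite (eq_Rintegral _ (fun x _ => e x)) (RintegralD mD I2 I3) (RintegralB mD If2 I1).
by rewrite (RintegralZl _ mD If) (Rintegral_cst mu mD) muD.
Qed.

Lemma sqr_Rintegral_le : 0 <= m ->
  (\int[mu]_(x in D) f x) ^+ 2 <= m * \int[mu]_(x in D) (f x ^+ 2).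
Proof.
move=> m0; apply: quadratic_ge0_discr => // t.
have [_ h] := integral_sqr_sub (- t).
have : 0 <= \int[mu]_(x in D) ((f x - - t) ^+ 2).
  by apply: Rintegral_ge0 => x _; exact: sqr_ge0.
by rewrite h; lra.
Qed.

(** The mean minimises the quadratic deviation, so it does at least as well as [c]. *)
Lemma integral_sqr_le_mean c M : 0 < m -> (forall x, D x -> (f x - c) ^+ 2 <= M) ->
  \int[mu]_(x in D) (f x ^+ 2) <= m^-1 * (\int[mu]_(x in D) f x) ^+ 2 + m * M.
Proof.
move=> m0 hM; have [I1 h] := integral_sqr_sub c.
have : \int[mu]_(x in D) ((f x - c) ^+ 2) <= \int[mu]_(x in D) M.
  by apply: le_Rintegral => //; exact: integrable_const.
rewrite h (Rintegral_cst mu mD) muD /= mulrC => h1.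
have : 0 <= m^-1 * (\int[mu]_(x in D) f x - c * m) ^+ 2.
  by apply: mulr_ge0; [rewrite invr_ge0 ltW|exact: sqr_ge0].
set F := \int[mu]_(x in D) f x in h1 *.
have -> : m^-1 * (F - c * m) ^+ 2 = m^-1 * F ^+ 2 - 2 * c * F + c ^+ 2 * m.
  by field; rewrite gt_eqF.
by move: h1; rewrite -/F; lra.
Qed.

End variance.

Section increment.
Context {R : realType}.
Local Notation lam := (@lebesgue_measure R).

Lemma continuous_integrable_itv (f : R -> R) (I : interval R) a b : continuous f ->
  [set` I] `<=` `[a, b]%classic -> lam.-integrable [set` I] (EFin \o f).
Proof.
move=> cf ab; apply: (@integrableS _ _ _ lam `[a, b]%classic) => //.
apply: continuous_compact_integrable; first exact: segment_compact.
exact: continuous_subspaceT.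
Qed.

(** Fundamental theorem of calculus and Cauchy-Schwarz. *)
Lemma sqr_increment_itv (F g : R -> R) (a e s t : R) : (forall x : R, is_derive x (1 : R) F (g x)) ->
  continuous g -> s \in `[a, a + e[ -> t \in `[a, a + e[ ->
  (F s - F t) ^+ 2 <= e * \int[lam]_(x in `[a, (a + e)%R[) (g x ^+ 2).
Proof.
move=> dF cg; wlog st : s t / s <= t.
  move=> h hs ht; have [st|/ltW ts] := leP s t; first exact: h.
  by rewrite -sqrrN opprB; exact: h.
rewrite !in_itv /= => /andP[as_ _] /andP[_ tb].
have i0 : 0 <= \int[lam]_(x in `[a, (a + e)%R[) (g x ^+ 2).
  by apply: Rintegral_ge0 => x _; exact: sqr_ge0.
have e0 : 0 <= e by lra.
move: st; rewrite le_eqVlt => /predU1P[->|st].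
  by rewrite subrr expr0n; exact: mulr_ge0.
have cg2 : continuous (fun x => g x ^+ 2).
  exact: continuous_sqr.
have dF' x : derivable F x 1 by have [] := dF x.
have := @continuous_FTC2 R g F s t st (continuous_subspaceT cg).
have cF : continuous F by move=> x; apply/differentiable_continuous/derivable1_diffP.
move=> /(_ (And3 (fun x _ => dF' x) (cvg_at_right_filter (cF s)) (cvg_at_left_filter (cF t)))).
have h : {in `]s, t[, F^`()%classic =1 g} by move=> x _; rewrite derive1E; apply: derive_val.
move=> /(_ h) ftc.
have -> : (F s - F t) ^+ 2 = (\int[lam]_(x in `[s, t]) g x) ^+ 2.
  by rewrite /Rintegral ftc /= -[LHS]sqrrN opprB.
have mlam : lam `[s, t]%classic = (t - s)%:E by rewrite lebesgue_measure_itv /= lte_fin st EFinB.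
have If : lam.-integrable `[s, t]%classic (EFin \o g) by apply: (@continuous_integrable_itv _ _ s t).
have If2 : lam.-integrable `[s, t]%classic (EFin \o (fun x => g x ^+ 2)) by apply: (@continuous_integrable_itv _ _ s t).
have ts0 : 0 <= t - s by lra.
apply: le_trans (sqr_Rintegral_le _ mlam If If2 ts0) _ => //.
have i1 : 0 <= \int[lam]_(x in `[s, t]) (g x ^+ 2).
  by apply: Rintegral_ge0 => x _; exact: sqr_ge0.
apply: ler_pM => //; first lra.
have sub : `[s, t]%classic `<=` `[a, (a + e)%R[%classic.
  by move=> x /=; rewrite !in_itv /= => /andP[h1 h2]; apply/andP; split; lra.
have Ia : lam.-integrable `[a, (a + e)%R[%classic (EFin \o (fun x => g x ^+ 2)).
  apply: (@continuous_integrable_itv _ _ a (a + e)) => // x /=.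
  by rewrite !in_itv /= => /andP[-> /ltW].
rewrite -lee_fin !fineK//; try exact: integrable_fin_num.
apply: ge0_subset_integral => //; first by have /integrableP[] := Ia.
by move=> x _; rewrite lee_fin; exact: sqr_ge0.
Qed.

End increment.

Lemma continuous_diff {R : realType} (T : topologicalType) (f g : T -> R) :
  continuous f -> continuous g -> continuous (fun x => f x - g x).
Proof. by move=> cf cg x; apply: cvgB; [exact: cf|exact: cg]. Qed.

Lemma continuous_comb {R : realType} (T : topologicalType) (W : normedModType R) k
    (c : 'I_k -> T -> R) (v : 'I_k -> W) (w : W) : (forall i, continuous (c i)) ->
  continuous (fun x => \sum_i c i x *: v i + w).
Proof.
move=> cc x; apply: cvgD; last exact: cvg_cst.
by apply: (cvg_big add_continuous) => i _; apply: cvgZr_tmp; exact: cc.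
Qed.

Lemma is_derive_affine {R : realType} (W1 W2 : normedModType R) (a : W1 -> W2) (f : W2 -> R)
    (df : R) (v x : W1) (w : W2) : (forall h : R, a (h *: v + x) = h *: w + a x) ->
  is_derive (a x) w f df -> is_derive x v (fun y => f (a y)) df.
Proof.
move=> aff.
have e : (fun h : R => h^-1 *: ((f \o shift (a x)) (h *: w) - f (a x))) =
    (fun h : R => h^-1 *: (((fun y => f (a y)) \o shift x) (h *: v) - f (a x))).
  by apply/funext => h; rewrite /= aff.
by move=> [d1 d2]; split; rewrite -?d2 /derivable /derive -e.
Qed.

Section cubes.
Context {R : realType}.
Local Notation lam := (@lebesgue_measure R).

Section slice_calculus.
Variable (n : nat).
Local Notation E := 'rV[R]_n.
Local Notation E1 := 'rV[R]_n.+1.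

Lemma cons_rV_addl (h t : R) (x : E) :
  cons_rV (h + t, x) = h *: delta_mx 0 ord0 + cons_rV (t, x) :> E1.
Proof.
apply/rowP => i; rewrite [RHS]mxE [X in _ = X + _]mxE [delta_mx _ _ _ _]mxE /=.
case: (unliftP ord0 i) => [j ->|->].
  by rewrite !cons_rVS /= mulr0 add0r.
by rewrite !cons_rV0 /= mulr1.
Qed.

Lemma cons_rV_addr (h t : R) (x : E) j :
  cons_rV (t, h *: delta_mx 0 j + x) = h *: delta_mx 0 (lift ord0 j) + cons_rV (t, x) :> E1.
Proof.
apply/rowP => i; rewrite [RHS]mxE [X in _ = X + _]mxE [delta_mx _ _ _ _]mxE /=.
case: (unliftP ord0 i) => [k ->|->].
  by rewrite !cons_rVS /= !mxE /= (inj_eq lift_inj).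
by rewrite !cons_rV0 /= mulr0 add0r.
Qed.

Lemma continuous_consl (x : E) : continuous (fun t : R => cons_rV (t, x) : E1).
Proof.
have -> : (fun t : R => cons_rV (t, x) : E1) =
    (fun t => t *: delta_mx 0 ord0 + cons_rV (0, x)).
  by apply/funext => t; rewrite -cons_rV_addl addr0.
by move=> t; apply: cvgD; [apply: cvgZr_tmp; exact: cvg_id|exact: cvg_cst].
Qed.

Lemma continuous_consr (t : R) : continuous (fun x : E => cons_rV (t, x) : E1).
Proof.
have e : (fun x : E => cons_rV (t, x) : E1) =
    (fun x => \sum_i x ord0 i *: delta_mx 0 (lift ord0 i) + cons_rV (t, 0)).
  apply/funext => x; apply/rowP => i; rewrite [RHS]mxE summxE.
  case: (unliftP ord0 i) => [k ->|->].
    rewrite !cons_rVS /= !mxE addr0 (bigD1 k)//= !mxE /= eqxx mulr1 big1 ?addr0//.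
    by move=> j jk; rewrite !mxE /= (inj_eq lift_inj) eq_sym (negbTE jk) mulr0.
  by rewrite !cons_rV0 /= big1 ?add0r// => j _; rewrite !mxE /= mulr0.
rewrite e; apply: continuous_comb => i; exact: coord_continuous.
Qed.

End slice_calculus.

Definition cube n (a : 'rV[R]_n) (e : R) : set 'rV[R]_n :=
  [set x | forall i, `[a ord0 i, a ord0 i + e[%classic (x ord0 i)].

Lemma measurable_cube n (a : 'rV[R]_n) e : measurable (cube a e).
Proof.
by apply: (@measurable_rV_box _ _ (fun i => `[a ord0 i, a ord0 i + e[%classic)) => i; exact: measurable_itv.
Qed.

Lemma cube_measure n (a : 'rV[R]_n) e : 0 <= e -> lebesgue_rV n (cube a e) = (e ^+ n)%:E.
Proof.
move=> e0; rewrite (@lebesgue_rV_box _ _ (fun i => `[a ord0 i, a ord0 i + e[%classic)); last first.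
  by move=> i; exact: measurable_itv.
rewrite (eq_bigr (fun=> e%:E)); last first.
  move=> i _; rewrite lebesgue_measure_itv /= lte_fin ltrDl.
  case: ltP => // e1; first by rewrite EFinN -EFinB addrAC subrr add0r.
  by congr EFin; apply/eqP; rewrite eq_le e0 e1.
by rewrite prodEFin prodr_const card_ord.
Qed.

Lemma cube_cons n (a : 'rV[R]_n.+1) e :
  cube a e = cons_set `[a ord0 ord0, a ord0 ord0 + e[%classic (cube (uncons_rV a).2 e).
Proof.
apply/seteqP; split => y /=.
  move=> h; split; first exact: (h ord0).
  by move=> i; rewrite /= !mxE; exact: (h (lift ord0 i)).
move=> [h0 h] i; case: (unliftP ord0 i) => [j ->|->//].
by have := h j; rewrite /= !mxE.
Qed.

Lemma continuous_integrable_cube n (a : 'rV[R]_n) e (f : 'rV[R]_n -> R) : 0 <= e ->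
  continuous f -> (lebesgue_rV n).-integrable (cube a e) (EFin \o f).
Proof.
move=> e0 cf.
apply: measurable_bounded_integrable; first exact: measurable_cube.
- exact: (eq_ind_r (fun z => z < +oo)%E (ltry _) (cube_measure a e0)).
- by apply: measurable_funS (continuous_measurable_rV cf).
have cK : compact [set x : 'rV[R]_n | forall i, `[a ord0 i, a ord0 i + e]%classic (x ord0 i)].
  apply: (@rV_compact _ _ (fun i => `[a ord0 i, a ord0 i + e]%classic)) => i.
  exact: segment_compact.
have /compact_bounded[M [_ hM]] : compact (f @` [set x : 'rV[R]_n | forall i, `[a ord0 i, a ord0 i + e]%classic (x ord0 i)]).
  by apply: continuous_compact => //; exact: continuous_subspaceT.
exists (M); split; first exact: num_real.
move=> B MB x xc; apply: hM => //; exists x => // i.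
by have := xc i; rewrite /= !in_itv /= => /andP[-> /ltW ->].
Qed.

(** Induction on the dimension.  The induction hypothesis on the slices [t] leaves
    the squares of the slice integrals [Phi t], whose variance in [t] is bounded
    because their increments are: they are integrals of increments of [phi] along
    the first coordinate. *)
Lemma poincare_cube n (a : 'rV[R]_n) e (phi : 'rV[R]_n -> R) (g : 'I_n -> 'rV[R]_n -> R) :
  0 < e -> continuous phi -> (forall i, continuous (g i)) ->
  (forall i x, is_derive x (delta_mx 0 i : 'rV[R]_n) phi (g i x)) ->
  \int[lebesgue_rV n]_(x in cube a e) (phi x ^+ 2) <=
    (e ^+ n)^-1 * (\int[lebesgue_rV n]_(x in cube a e) phi x) ^+ 2 +
    e ^+ 2 * \sum_(i < n) \int[lebesgue_rV n]_(x in cube a e) (g i x ^+ 2).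
Proof.
move=> e0; elim: n a phi g => [|n IH] a phi g cphi cg dphi.
  rewrite big_ord0 expr0 invr1 mul1r mulr0 addr0.
  have c0 : cube a e = setT by apply/seteqP; split=> // x _ [].
  have h (f : 'rV[R]_0 -> R) : continuous f -> \int[lebesgue_rV 0]_(x in cube a e) f x = f 0.
    move=> /continuous_measurable_rV mf; rewrite c0 /Rintegral /= integral_dirac//.
      by rewrite diracT mul1e.
    exact/measurable_EFinP.
  by rewrite (h _ cphi) (h _ (continuous_sqr cphi)).
set I : set (measurableTypeR R) := `[a ord0 ord0, a ord0 ord0 + e[%classic.
set C := cube (uncons_rV a).2 e.
have aC : cube a e = cons_set I C by exact: cube_cons.
have mI : measurable I by exact: measurable_itv.
have mC : measurable C by exact: measurable_cube.
have muC : lebesgue_rV n C = (e ^+ n)%:E by apply: cube_measure; exact: ltW.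
have lamI : lam I = e%:E.
  by rewrite lebesgue_measure_itv /= lte_fin ltrDl e0 EFinN -EFinB addrAC subrr add0r.
have cfr (f : 'rV[R]_n.+1 -> R) t : continuous f -> continuous (fun x => f (cons_rV (t, x))).
  by move=> cf x; apply: (continuous_comp (@continuous_consr n t x)); exact: cf.
have intC (f : 'rV[R]_n.+1 -> R) t : continuous f ->
    (lebesgue_rV n).-integrable C (EFin \o (fun x => f (cons_rV (t, x)))).
  by move=> cf; apply: continuous_integrable_cube; [exact: ltW|exact: cfr].
have cfl (f : 'rV[R]_n.+1 -> R) x : continuous f -> continuous (fun t => f (cons_rV (t, x))).
  by move=> cf t; apply: (continuous_comp (@continuous_consl n x t)); exact: cf.
have intI (f : 'rV[R]_n.+1 -> R) x : continuous f ->
    lam.-integrable I (EFin \o (fun t => f (cons_rV (t, x)))).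
  move=> cf; apply: (@continuous_integrable_itv _ _ _ (a ord0 ord0) (a ord0 ord0 + e)).
    exact: cfl.
  by move=> t /=; rewrite !in_itv /= => /andP[-> /ltW].
have intA (f : 'rV[R]_n.+1 -> R) : continuous f ->
    (lebesgue_rV n.+1).-integrable (cons_set I C) (EFin \o f).
  by move=> cf; rewrite -aC; apply: continuous_integrable_cube => //; exact: ltW.
have fub (f : 'rV[R]_n.+1 -> R) (cf : continuous f) :=
  fubini_cons mI mC (continuous_measurable_rV cf) (intA f cf) (fun t => intC f t cf).
have fub' (f : 'rV[R]_n.+1 -> R) (cf : continuous f) f0 :=
  fubini_cons_swap mI mC (continuous_measurable_rV cf) (intA f cf) f0 (fun x => intI f x cf).
have cp2 := continuous_sqr cphi.
have cg2 i := continuous_sqr (cg i).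
pose Phi (t : measurableTypeR R) := \int[lebesgue_rV n]_(x in C) phi (cons_rV (t, x)).
pose A (t : measurableTypeR R) := \int[lebesgue_rV n]_(x in C) (phi (cons_rV (t, x)) ^+ 2).
pose B i (t : measurableTypeR R) := \int[lebesgue_rV n]_(x in C) (g i (cons_rV (t, x)) ^+ 2).
have [iPhi ePhi] : lam.-integrable I (EFin \o Phi) /\
    \int[lebesgue_rV n.+1]_(y in cons_set I C) phi y = \int[lam]_(t in I) Phi t := fub _ cphi.
have [iA eA] : lam.-integrable I (EFin \o A) /\
    \int[lebesgue_rV n.+1]_(y in cons_set I C) (phi y ^+ 2) = \int[lam]_(t in I) A t := fub _ cp2.
have fubB i : lam.-integrable I (EFin \o B i) /\
    \int[lebesgue_rV n.+1]_(y in cons_set I C) (g i y ^+ 2) = \int[lam]_(t in I) B i t := fub _ (cg2 i).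
have en0 : 0 < e ^+ n by exact: exprn_gt0.
have iPhi2 : lam.-integrable I (EFin \o (fun t => Phi t ^+ 2)).
  have iA' : lam.-integrable I (EFin \o (fun t => e ^+ n * A t)).
    by have := integrableZl mI (e ^+ n) iA.
  apply: (le_integrable mI _ _ iA').
    have /integrableP[/measurable_EFinP mPhi _] := iPhi.
    by apply/measurable_EFinP; exact: measurable_funX.
  move=> t It; rewrite /= lee_fin ger0_norm ?sqr_ge0//.
  rewrite ger0_norm; first by apply: (sqr_Rintegral_le mC muC (intC _ t cphi) (intC _ t cp2)); exact: ltW.
  by apply: mulr_ge0; [exact: ltW|apply: Rintegral_ge0 => x _; exact: sqr_ge0].
pose M := e ^+ n.+1 * \int[lebesgue_rV n.+1]_(y in cons_set I C) (g ord0 y ^+ 2).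
have hM s : I s -> (Phi s - Phi (a ord0 ord0)) ^+ 2 <= M.
  move=> Is; set t := a ord0 ord0.
  have It : I t by rewrite /I /= in_itv /= lexx ltrDl e0.
  have e1 : Phi s - Phi t = \int[lebesgue_rV n]_(x in C) (phi (cons_rV (s, x)) - phi (cons_rV (t, x))).
    by rewrite (RintegralB mC (intC _ s cphi) (intC _ t cphi)).
  have cd : continuous (fun x : 'rV[R]_n => phi (cons_rV (s, x)) - phi (cons_rV (t, x))).
    by apply: continuous_diff; exact: cfr.
  have id1 := continuous_integrable_cube (uncons_rV a).2 (ltW e0) cd.
  have id2 := continuous_integrable_cube (uncons_rV a).2 (ltW e0) (continuous_sqr cd).
  rewrite e1; apply: (le_trans (sqr_Rintegral_le mC muC id1 id2 (ltW en0))).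
  have [i3 e3] := fub' _ (cg2 ord0) (fun y => sqr_ge0 _).
  rewrite /M exprSr -mulrA ler_pM2l// e3.
  rewrite -(RintegralZl e mC i3); apply: le_Rintegral => //.
    by have := integrableZl mC e i3.
  move=> x _; apply: (sqr_increment_itv (F := fun t => phi (cons_rV (t, x)))) => //.
    move=> t'; apply: (is_derive_affine (a := fun t => cons_rV (t, x)) (w := delta_mx 0 ord0) _ (dphi _ _)) => h.
    by rewrite -cons_rV_addl; congr (cons_rV (_ + _, _)); rewrite /GRing.scale /= mulr1.
  exact: cfl.
have hPhi := integral_sqr_le_mean mI lamI iPhi iPhi2 e0 hM.
have [iB eB] := Rintegral_sum (index_enum 'I_n) mI (fun i : 'I_n => (fubB (lift ord0 i)).1).
have hA : \int[lam]_(t in I) A t <= (e ^+ n)^-1 * \int[lam]_(t in I) (Phi t ^+ 2) +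
    e ^+ 2 * \sum_(i < n) \int[lam]_(t in I) B (lift ord0 i) t.
  rewrite -eB -(RintegralZl _ mI iPhi2) -(RintegralZl _ mI iB).
  have i1 : lam.-integrable I (EFin \o (fun t => (e ^+ n)^-1 * Phi t ^+ 2)).
    by have := integrableZl mI (e ^+ n)^-1 iPhi2.
  have i2 : lam.-integrable I (EFin \o (fun t => e ^+ 2 * \sum_(i < n) B (lift ord0 i) t)).
    by have := integrableZl mI (e ^+ 2) iB.
  rewrite -(RintegralD mI i1 i2); apply: le_Rintegral => //.
    by have := integrableD mI i1 i2.
  move=> t _; apply: IH; [exact: cfr|by move=> i; exact: cfr|].
  by move=> i x; apply: (is_derive_affine (w := delta_mx 0 (lift ord0 i)) _ (dphi _ _)) => h;
  exact: cons_rV_addr.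
rewrite aC eA ePhi big_ord_recl.
rewrite (eq_bigr (fun i => \int[lam]_(t in I) B (lift ord0 i) t)); last by move=> i _; exact: (fubB _).2.
apply: (le_trans hA).
have : (e ^+ n)^-1 * \int[lam]_(t in I) (Phi t ^+ 2) <=
   (e ^+ n)^-1 * (e^-1 * (\int[lam]_(t in I) Phi t) ^+ 2 + e * M).
  by rewrite ler_pM2l ?invr_gt0.
rewrite mulrDr [_ * (e * M)](_ : _ = e ^+ 2 * \int[lebesgue_rV n.+1]_(y in cons_set I C) (g ord0 y ^+ 2)); last first.
  by rewrite /M exprS; field; rewrite gt_eqF.
rewrite mulrA -invfM -exprSr mulrDr => h.
by rewrite addrA lerD2r.
Qed.

End cubes.

(** * Compactness on bounded sets *)

Section localisation.
Context {R : realType} {d : nat}.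
Local Notation E := 'rV[R]_d.
Local Notation mu := (@lebesgue_rV R d).
Variable Omega : set E.
Hypothesis oO : open Omega.
Implicit Types (u v w phi : E -> R) (C B : set E).

Let mO : measurable Omega. Proof. exact: open_measurable_rV. Qed.
Local Notation normsq := (normsq Omega).
Local Notation L2 := (L2 Omega).
Local Notation L2ip := (L2ip Omega).

(** Multiplication by the indicator of [C]; the functions are not restricted, so
    that all pairings take place on [Omega]. *)
Definition cut C u : E -> R := fun x => \1_C x * u x.

Lemma cut_L2 C u : measurable C -> L2 u -> L2 (cut C u).
Proof.
move=> mC uL; have [mfu _] := uL; apply: (L2_le mO _ uL).
  by apply: measurable_funM => //; exact: measurable_indic.
move=> x _; rewrite /cut indicE; case: (x \in C); first by rewrite mul1r.
by rewrite mul0r normr0.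
Qed.

Lemma cutB C u v : cut C (u \- v) = cut C u \- cut C v.
Proof. by apply/funext => x; rewrite /cut /= mulrBr. Qed.

Lemma indic_L2 C : measurable C -> (mu C < +oo)%E -> L2 (\1_C : E -> R).
Proof.
move=> mC fC; split; first exact: measurable_indic.
apply: (@le_lt_trans _ _ (\int[mu]_(x in C) 1)%E); last by rewrite integral_cst// mul1e.
rewrite /sq_norm integral_mkcond [leRHS]integral_mkcond; apply: ge0_le_integral => //.
- by move=> x _; rewrite /patch; case: ifP => // _; rewrite lee_fin sqr_ge0.
- apply/(measurable_restrict _ mO measurableT).
  by rewrite setTI; apply/measurable_EFinP; apply: measurable_funX; exact: measurable_indic.
- by apply/(measurable_restrict _ mC measurableT); rewrite setTI.
move=> x _; rewrite /patch indicE; case: (x \in C); rewrite ?expr1n ?expr0n; by case: ifP.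
Qed.

Lemma normsqE u : normsq u = \int[mu]_(x in Omega) u x ^+ 2.
Proof. by rewrite /normsq L2ipE; apply: eq_Rintegral => x _; rewrite expr2. Qed.

Lemma sum_normsqE (J : Type) (r : seq J) (f : J -> E -> R) : (forall j, L2 (f j)) ->
  mu.-integrable Omega (EFin \o (fun x => \sum_(j <- r) f j x ^+ 2)) /\
  \sum_(j <- r) normsq (f j) = \int[mu]_(x in Omega) \sum_(j <- r) f j x ^+ 2.
Proof.
move=> fL; have [i1 ->] := Rintegral_sum r mO (fun j => L2_integrable_sqr mO (fL j)).
by split=> //; apply: eq_bigr => j _; exact: normsqE.
Qed.

Lemma le_normsq_sum (J : Type) (r : seq J) u (f : J -> E -> R) : L2 u -> (forall j, L2 (f j)) ->
  (forall x, u x ^+ 2 <= \sum_(j <- r) f j x ^+ 2) -> normsq u <= \sum_(j <- r) normsq (f j).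
Proof.
move=> uL fL uf; have [i1 ->] := sum_normsqE r fL.
by rewrite normsqE; apply: le_Rintegral => //; exact: L2_integrable_sqr.
Qed.

Lemma sum_normsq_le (J : Type) (r : seq J) u (f : J -> E -> R) : L2 u -> (forall j, L2 (f j)) ->
  (forall x, \sum_(j <- r) f j x ^+ 2 <= u x ^+ 2) -> \sum_(j <- r) normsq (f j) <= normsq u.
Proof.
move=> uL fL uf; have [i1 ->] := sum_normsqE r fL.
by rewrite normsqE; apply: le_Rintegral => //; exact: L2_integrable_sqr.
Qed.

Lemma cut_sqr C u x : cut C u x ^+ 2 = \1_C x * u x ^+ 2.
Proof. by rewrite /cut indicE; case: (x \in C); rewrite ?mul1r// !mul0r expr0n. Qed.

Lemma normsq_cut_le C u : measurable C -> L2 u -> normsq (cut C u) <= normsq u.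
Proof.
move=> mC uL; have := @sum_normsq_le _ [:: tt] u (fun=> cut C u) uL (fun=> cut_L2 mC uL).
rewrite big_seq1; apply => x; rewrite big_seq1 cut_sqr indicE.
by case: (x \in C); rewrite ?mul1r// mul0r sqr_ge0.
Qed.

Lemma Rintegral_cut C (f : E -> R) : measurable C -> (forall x, ~ Omega x -> f x = 0) ->
  \int[mu]_(x in Omega) (\1_C x * f x) = \int[mu]_(x in C) f x.
Proof.
move=> mC f0; rewrite Rintegral_mkcond [RHS]Rintegral_mkcond; congr (Rintegral _ _ _).
apply/funext => x; rewrite /patch indicE; case: ifPn => xO; case: (x \in C); rewrite ?mul1r ?mul0r//.
by rewrite f0// => Ox; move/negP: xO; apply; rewrite inE.
Qed.

Lemma test_function_out phi x : test_function Omega phi -> ~ Omega x -> phi x = 0.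
Proof.
move=> [_ _ h] nO; apply/eqP; apply: contrapT => /negP p0; apply: nO; apply: h.
by apply: subset_closure.
Qed.

Lemma normsq_cut C phi : measurable C -> test_function Omega phi ->
  normsq (cut C phi) = \int[mu]_(x in C) (phi x ^+ 2).
Proof.
move=> mC tphi; rewrite /normsq L2ipE -(Rintegral_cut mC).
  by apply: eq_Rintegral => x _; rewrite -expr2 cut_sqr.
by move=> x nO; rewrite (test_function_out tphi nO) expr0n.
Qed.

(** Test functions are smooth on the whole space and vanish outside [Omega], so the
    cube may cross the boundary. *)
Lemma poincare_test (a : E) e phi : 0 < e -> test_function Omega phi ->
  normsq (cut (cube a e) phi) <= (e ^+ d)^-1 * (L2ip phi (\1_(cube a e))) ^+ 2 +
    e ^+ 2 * \sum_(i < d) normsq (cut (cube a e) (partial i phi)).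
Proof.
move=> e0 tphi; have mC := measurable_cube a e; have [sphi _ _] := tphi.
rewrite normsq_cut// (eq_bigr (fun i => \int[mu]_(x in cube a e) (partial i phi x ^+ 2))); last first.
  by move=> i _; rewrite normsq_cut//; exact: test_function_partial.
have -> : L2ip phi (\1_(cube a e)) = \int[mu]_(x in cube a e) phi x.
  rewrite L2ipE -(Rintegral_cut mC (fun x => @test_function_out _ x tphi)).
  by apply: eq_Rintegral => x _; rewrite mulrC.
apply: poincare_cube => //; first exact: smooth_continuous.
  by move=> i; apply: smooth_continuous; exact: smooth_partial.
by move=> i x; apply/derivableP; exact: smooth_derivable.
Qed.

Lemma poincare_H10 (a : E) e u : 0 < e -> H10 Omega u ->
  normsq (cut (cube a e) u) <= (e ^+ d)^-1 * (L2ip u (\1_(cube a e))) ^+ 2 +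
    e ^+ 2 * \sum_(i < d) normsq (cut (cube a e) (grad Omega u i)).
Proof.
move=> e0 /(H10_test_limit oO)[hu tu]; set C := cube a e.
have [uL _] := hu; have gL i := grad_L2 i hu.
have mC : measurable C := measurable_cube a e.
have CL : L2 (\1_C : E -> R).
  apply: (indic_L2 mC).
  exact: (eq_ind_r (fun z => z < +oo)%E (ltry _) (cube_measure a (ltW e0))).
have /choice[phi hphi] : forall n, exists phi, test_function Omega phi /\
    normsq (u \- phi) + \sum_(i < d) normsq (grad Omega u i \- partial i phi) < n.+1%:R^-1.
  by move=> n; have [//|phi h1 h2] := tu n.+1%:R^-1 _; exists phi.
have pL n : L2 (phi n) by apply: test_function_L2 (hphi n).1.
have dL i n : L2 (partial i (phi n)).
  by apply: (@test_function_L2 _ _ Omega) => //; exact: test_function_partial (hphi n).1.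
have sym v w : L2 v -> L2 w -> normsq (v \- w) = normsq (w \- v).
  by move=> vL wL; have := @ip_sqrBC _ _ (L2_space oO) v w vL wL.
have c1 : normsq (phi n \- u) @[n --> \oo] --> (0 : R).
  apply: (cvg0_squeeze _ _ (@cvg_harmonic R)) => n; rewrite normsq_ge0/=; last exact: L2B.
  rewrite sym//; apply: le_trans (ltW (hphi n).2); rewrite lerDl sumr_ge0// => i _.
  by apply: normsq_ge0; exact: L2B.
have c2 i : normsq (partial i (phi n) \- grad Omega u i) @[n --> \oo] --> (0 : R).
  apply: (cvg0_squeeze _ _ (@cvg_harmonic R)) => n; rewrite normsq_ge0/=; last exact: L2B.
  rewrite sym//; apply: le_trans (ltW (hphi n).2).
  rewrite (bigD1 i)//= addrCA lerDl addr_ge0//; first by apply: normsq_ge0; exact: L2B.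
  by rewrite sumr_ge0// => j _; apply: normsq_ge0; exact: L2B.
have lim (f : nat -> E -> R) v : (forall n, L2 (f n)) -> L2 v -> normsq (f n \- v) @[n --> \oo] --> (0 : R) ->
    normsq (cut C (f n)) @[n --> \oo] --> normsq (cut C v).
  move=> fL vL fv; apply: (@cvg_ip_strong_sq _ _ (L2_space oO)) => [n||]; try exact: cut_L2.
  apply: (cvg0_squeeze _ _ fv) => n.
  change (0 <= normsq (cut C (f n) \- cut C v) <= normsq (f n \- v)).
  by rewrite -cutB normsq_cut_le ?normsq_ge0//; [exact: cut_L2 mC (L2B oO _ _)|exact: L2B].
have hr : (e ^+ d)^-1 * (L2ip (phi n) (\1_C)) ^+ 2 +
    e ^+ 2 * \sum_(i < d) normsq (cut C (partial i (phi n))) @[n --> \oo] -->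
    (e ^+ d)^-1 * (L2ip u (\1_C)) ^+ 2 +
    e ^+ 2 * \sum_(i < d) normsq (cut C (grad Omega u i)).
  have h := L2_limit_ip oO pL uL CL c1.
  apply: cvgD; apply: cvgM; try exact: cvg_cst; first exact: (cvgM h h).
  by apply: cvg_sum => i _; apply: lim.
apply: (ler_cvg_to (lim _ _ pL uL c1) hr); apply: nearW => n.
exact: (poincare_test a e0 (hphi n).1).
Qed.

End localisation.

Section grid.
Context {R : realType} {d : nat}.
Local Notation E := 'rV[R]_d.
Variables (M : R) (N : nat).
Hypothesis M0 : 0 < M.

(** The cube of side [2 M] centred at the origin is cut into [N.+1 ^ d] half-open
    cells of side [mesh], which are disjoint. *)
Definition big_cube : set E := cube (const_mx (- M)) (2 * M).

Definition mesh : R := 2 * M / N.+1%:R.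

Definition corner (z : {ffun 'I_d -> 'I_N.+1}) : E := \row_i (- M + (z i)%:R * mesh).

Lemma mesh_gt0 : 0 < mesh.
Proof. by rewrite divr_gt0// mulr_gt0. Qed.

Let mem_cell z (x : E) : cube (corner z) mesh x <->
  forall i, (z i)%:R <= (x ord0 i + M) / mesh < (z i).+1%:R.
Proof.
have m0 := mesh_gt0.
suff h i : `[corner z ord0 i, corner z ord0 i + mesh[%classic (x ord0 i) =
    ((z i)%:R <= (x ord0 i + M) / mesh < (z i).+1%:R) :> Prop.
  by split => hx i; have := hx i; rewrite h.
rewrite /= in_itv /= mxE ler_pdivlMr// ltr_pdivrMr// -natr1 mulrDl mul1r.
congr (is_true (_ && _)); first by rewrite -lerBlDr addrC.
by rewrite -[in RHS]ltrBrDr -addrA addrC.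
Qed.

Lemma cells_cover (x : E) : big_cube x -> exists z, cube (corner z) mesh x.
Proof.
move=> Bx; have m0 := mesh_gt0.
have t0 i : 0 <= (x ord0 i + M) / mesh.
  have := Bx i; rewrite /= in_itv /= mxE => /andP[h _].
  by rewrite divr_ge0 ?(ltW m0)//; lra.
have tN i : (x ord0 i + M) / mesh < N.+1%:R.
  have := Bx i; rewrite /= in_itv /= mxE => /andP[_ h].
  rewrite ltr_pdivrMr// /mesh mulrC divfK ?pnatr_eq0//; lra.
exists [ffun i => inord (Num.trunc ((x ord0 i + M) / mesh))]; apply/mem_cell => i.
have h := truncn_itv (t0 i); rewrite ffunE inordK//.
by case/andP: h => h _; rewrite -(ltr_nat R) (le_lt_trans h).
Qed.

Lemma cells_disjoint (x : E) z z' : cube (corner z) mesh x -> cube (corner z') mesh x -> z = z'.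
Proof.
move=> /mem_cell h /mem_cell h'; apply/ffunP => i; apply: val_inj => /=.
by rewrite -(truncn_def (h i)) -(truncn_def (h' i)).
Qed.

Lemma le_sum_cells (x : E) : \1_big_cube x <= \sum_z \1_(cube (corner z) mesh) x :> R.
Proof.
rewrite indicE; case: (boolP (x \in big_cube)) => [/set_mem/cells_cover[z xz]|_].
  by rewrite (bigD1 z)//= indicE mem_set//= lerDl sumr_ge0// => j _; rewrite indicE.
by rewrite sumr_ge0// => z _; rewrite indicE.
Qed.

Lemma sum_cells_le (x : E) : \sum_z \1_(cube (corner z) mesh) x <= 1 :> R.
Proof.
have [[z xz]|h] := pselect (exists z, cube (corner z) mesh x).
  rewrite (bigD1 z)//= indicE mem_set//= gerDl big1// => z' zz'.
  rewrite indicE memNset// => /(cells_disjoint xz) e.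
  by rewrite e eqxx in zz'.
rewrite big1// => z _; rewrite indicE memNset// => xz; apply: h; by exists z.
Qed.

End grid.

Section rellich.
Context {R : realType} {d : nat}.
Local Notation E := 'rV[R]_d.
Local Notation mu := (@lebesgue_rV R d).
Variables (Omega : set E) (V : E -> R).
Hypothesis oO : open Omega.
Hypothesis d0 : (0 < d)%N.
Hypothesis mV : measurable_fun Omega V.
Hypothesis V0 : {ae mu, forall x, Omega x -> 0 <= V x}.

Let mO : measurable Omega. Proof. exact: open_measurable_rV. Qed.
Local Notation normsq := (normsq Omega).
Local Notation L2ip := (L2ip Omega).
Local Notation G := (energy_space oO d0 mV V0).

Local Notation H10V := (H10V Omega V).
Local Notation grad := (grad Omega).
Local Notation L2 := (L2 Omega).
Local Notation index N := {ffun 'I_d -> 'I_N.+1}.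
Local Notation cell M N z := (cube (corner M z) (mesh M N)).

Let cellP (a : E) e : 0 < e -> L2 (\1_(cube a e) : E -> R).
Proof.
move=> e0; apply: (indic_L2 oO (measurable_cube a e)).
exact: (eq_ind_r (fun z => z < +oo)%E (ltry _) (cube_measure a (ltW e0))).
Qed.

(** The Poincare inequality summed over the cells: up to an error [mesh ^ 2] times
    the energy, the norm on a bounded set is controlled by finitely many
    averages. *)
Lemma normsq_big_cube_le M N u : 0 < M -> H10V u ->
  normsq (cut (big_cube M) u) <=
  \sum_(z : index N) (mesh M N ^+ d)^-1 * (L2ip u (\1_(cell M N z))) ^+ 2 +
  mesh M N ^+ 2 * ip G u u.
Proof.
move=> M0 hu; have m0 := mesh_gt0 N M0; have uL := H10V_L2 hu; have h1 := H10V_H1 hu.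
have mC (z : index N) := measurable_cube (corner M z) (mesh M N).
have cL (z : index N) v (vL : L2 v) := cut_L2 oO (mC z) vL.
have h2 : normsq (cut (big_cube M) u) <=
    \sum_(z : index N) normsq (cut (cell M N z) u).
  apply: (le_normsq_sum oO) => [|z|x]; [|exact: cL|].
    by apply: (cut_L2 oO) => //; exact: measurable_cube.
  under eq_bigr do rewrite cut_sqr.
  by rewrite -mulr_suml cut_sqr ler_wpM2r ?sqr_ge0// le_sum_cells.
have h3 i : \sum_(z : index N) normsq (cut (cell M N z) (grad u i)) <=
    normsq (grad u i).
  have gL := grad_L2 i h1.
  apply: (sum_normsq_le oO) => [//|z|x]; first exact: cL.
  under eq_bigr do rewrite cut_sqr.
  by rewrite -mulr_suml -[leRHS]mul1r ler_wpM2r ?sqr_ge0// sum_cells_le.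
apply: (le_trans h2).
have h4 := fun z : index N => poincare_H10 oO (corner M z) m0 hu.1.
apply: (le_trans (ler_sum _ (fun z _ => h4 z))).
rewrite big_split /= lerD2l -mulr_sumr ler_pM2l ?exprn_gt0// exchange_big /=.
apply: (le_trans (ler_sum _ (fun i _ => h3 i))).
rewrite /graph_ip mul1r /energy -addrA lerDl addr_ge0//; last exact: normsq_ge0.
exact: (normsq_ge0 (H10V_sqrtV oO mV V0 hu)).
Qed.

(** Rellich's theorem: the averages in [normsq_big_cube_le] tend to 0 along a weakly
    null family, and the mesh is arbitrary. *)
Lemma rellich (T : Type) (F : set_system T) (FF : ProperFilter F)
    (f : T -> E -> R^o) K M : 0 < M -> (forall n, H10V (f n)) ->
  (forall n, ip G (f n) (f n) <= K) -> weakly G F f 0 ->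
  normsq (cut (big_cube M) (f n)) @[n --> F] --> (0 : R).
Proof.
move=> M0 hf fK f0.
have K0 : 0 <= K by have [n _] := filter_ex (filterT : F setT); exact: (le_trans (@ip_ge0 _ _ G _ (hf n)) (fK n)).
pose S N n := \sum_(z : index N) (mesh M N ^+ d)^-1 *
    (L2ip (f n) (\1_(cell M N z))) ^+ 2.
have hS N : S N n @[n --> F] --> (0 : R).
  suff : S N n @[n --> F] --> \sum_(z : index N) (mesh M N ^+ d)^-1 * (0 * 0).
    by rewrite big1// => z _; rewrite !mulr0.
  apply: (@cvg_sum) => z _; apply: cvgM; first exact: cvg_cst.
  have wL := cellP (corner M z) (mesh_gt0 N M0).
  have h : L2ip (f n) (\1_(cell M N z)) @[n --> F] --> (0 : R).
    have := @weakly_ipL _ _ G (L2_space oO) (@energy_space_L2 _ _ _ _ oO d0 mV V0) (@L2ip_le_energy_space _ _ _ _ oO d0 mV V0)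
      T F f 0 _ hf (dom0 G) f0 wL.
    rewrite ip0r//; apply: cvg_trans; apply: near_eq_cvg; apply: nearW => n.
    by apply: L2ipC => //; exact: H10V_L2.
  exact: (cvgM h h).
apply/cvgrPdist_lt => e e0.
pose N := Num.trunc ((2 * M) ^+ 2 * K * 2 / e).
have hN : mesh M N ^+ 2 * K < e / 2.
  have := truncnS_gt ((2 * M) ^+ 2 * K * 2 / e); rewrite -/N => h.
  rewrite /mesh expr_div_n mulrAC ltr_pdivrMr ?exprn_gt0//.
  move: h; rewrite ltr_pdivrMr// => h.
  have h1 : (1 : R) <= N.+1%:R by rewrite ler1n.
  have : N.+1%:R * e <= N.+1%:R ^+ 2 * e.
    by rewrite ler_pM2r// expr2 ler_peMl.
  move=> h2; have := lt_le_trans h h2.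
  by set x := (2 * M) ^+ 2 * K; set y := N.+1%:R ^+ 2; lra.
have /cvgrPdist_lt/(_ (e / 2)) := hS N.
rewrite divr_gt0// => /(_ isT); apply: filterS => n.
rewrite !sub0r !normrN => h.
have uL := H10V_L2 (hf n).
rewrite ger0_norm; last by apply: normsq_ge0; apply: (cut_L2 oO) => //; exact: measurable_cube.
apply: (le_lt_trans (normsq_big_cube_le N M0 (hf n))).
have h1 := le_lt_trans (ler_norm _) h.
have h2 : mesh M N ^+ 2 * ip G (f n) (f n) <= mesh M N ^+ 2 * K.
  by apply: ler_wpM2l => //; exact: sqr_ge0.
by rewrite [e]splitr; apply: ltrD => //; exact: le_lt_trans h2 hN.
Qed.

Local Definition absf (u : E -> R) : E -> R := fun x => `|u x|.

Let abs_L2 u : L2 u -> L2 (absf u).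
Proof.
move=> uL; have [mfu _] := uL; apply: (L2_le mO _ uL); first exact: measurableT_comp.
by move=> x _; rewrite /absf normr_id.
Qed.

Let normsq_abs u : normsq (absf u) = normsq u.
Proof. by rewrite /normsq !L2ipE; apply: eq_Rintegral => x _; rewrite /absf -normrM ger0_norm// -expr2 sqr_ge0. Qed.

(* If [u' * v' = 0] then [u * v] is the sum of [(u - u') * v] and
   [u' * (v - v')]. *)
Let pairing_le B u v u' v' : measurable B -> L2 u -> L2 v -> L2 u' -> L2 v' ->
  ae_zero Omega (fun x => u' x * v' x) ->
  (L2ip (absf (cut B u)) (absf v)) ^+ 2 <=
    2 * (normsq (cut B (u' \- u)) * normsq v) + 2 * (normsq u' * normsq (cut B (v' \- v))).
Proof.
move=> mB uL vL uL' vL' uv0.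
have c1 : L2 (cut B (u' \- u)) by apply: cut_L2 => //; exact: L2B.
have c2 : L2 (cut B (v' \- v)) by apply: cut_L2 => //; exact: L2B.
have c3 : L2 (cut B u) by exact: cut_L2.
have z0 : L2ip (absf u') (absf v') = 0.
  have [m1 _] := abs_L2 uL'; have [m2 _] := abs_L2 vL'.
  rewrite L2ipE /Rintegral (@ae_eq_integral _ _ _ mu Omega (cst 0%E)) ?integral0//.
    by apply/measurable_EFinP; exact: measurable_funM.
  by apply: filterS uv0 => x h Ox; rewrite /absf /= -normrM h// normr0.
have h : L2ip (absf (cut B u)) (absf v) <= L2ip (absf (cut B (u' \- u))) (absf v) +
    L2ip (absf u') (absf (cut B (v' \- v))).
  rewrite -[leRHS]addr0 -z0 !L2ipE.
  have i1 := L2_integrable mO (abs_L2 c1) (abs_L2 vL).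
  have i2 := L2_integrable mO (abs_L2 uL') (abs_L2 c2).
  have i3 := L2_integrable mO (abs_L2 uL') (abs_L2 vL').
  have i12 : mu.-integrable Omega (EFin \o (fun x => absf (cut B (u' \- u)) x * absf v x +
      absf u' x * absf (cut B (v' \- v)) x)).
    by have := integrableD mO i1 i2.
  rewrite -(RintegralD mO i1 i2) -(RintegralD mO i12 i3); apply: le_Rintegral => //.
  - by apply: L2_integrable => //; exact: abs_L2.
  - by have := integrableD mO i12 i3.
  move=> x _; rewrite /absf /cut /= indicE; case: (x \in B); last first.
    by rewrite !mul0r normr0 !mul0r mulr0 !add0r mulr_ge0.
  rewrite !mul1r -!normrM.
  have -> : u x * v x = - ((u' x - u x) * v x) + - (u' x * (v' x - v x)) + u' x * v' x by ring.
  rewrite (le_trans (ler_normD _ _))// lerD2r (le_trans (ler_normD _ _))// !normrN.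
  by rewrite !normrM.
have a1 := @cauchy_schwarz _ _ (L2_space oO) _ _ (abs_L2 c1) (abs_L2 vL).
have a2 := @cauchy_schwarz _ _ (L2_space oO) _ _ (abs_L2 uL') (abs_L2 c2).
have {}a1 : L2ip (absf (cut B (u' \- u))) (absf v) ^+ 2 <= normsq (cut B (u' \- u)) * normsq v.
  by rewrite -normsq_abs -(normsq_abs v).
have {}a2 : L2ip (absf u') (absf (cut B (v' \- v))) ^+ 2 <= normsq u' * normsq (cut B (v' \- v)).
  by rewrite -normsq_abs -(normsq_abs (cut B (v' \- v))).
have p0 : 0 <= L2ip (absf (cut B u)) (absf v).
  by rewrite L2ipE; apply: Rintegral_ge0 => x _; apply: mulr_ge0; exact: normr_ge0.
move: h p0 a1 a2; set X := L2ip _ _; set A := L2ip _ _; set C := L2ip _ _ => h p0 a1 a2.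
have : X ^+ 2 <= (A + C) ^+ 2 by apply: lerXn2r; rewrite ?nnegrE//; lra.
have := sqr_ge0 (A - C); lra.
Qed.

(** On bounded sets weak convergence is strong by [rellich], so the product of the
    limits vanishes there. *)
Lemma weak_limit_disjoint (T : Type) (F : set_system T) (FF : ProperFilter F)
    (f g : T -> E -> R^o) (u v : E -> R^o) K : (forall n, H10V (f n)) -> (forall n, H10V (g n)) ->
  (forall n, ip G (f n) (f n) <= K) -> (forall n, ip G (g n) (g n) <= K) ->
  H10V u -> H10V v -> weakly G F f u -> weakly G F g v ->
  (forall n, ae_zero Omega (fun x => f n x * g n x)) -> ae_zero Omega (fun x => u x * v x).
Proof.
move=> hf hg fK gK hu hv fu gv fg0.
have shift (h : T -> E -> R^o) (w : E -> R^o) : (forall n, H10V (h n)) -> H10V w ->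
    (forall n, ip G (h n) (h n) <= K) -> weakly G F h w -> forall M, 0 < M ->
    normsq (cut (big_cube M) (h n \- w)) @[n --> F] --> (0 : R).
  move=> hh hw hK hF M M0.
  have hd n : dom G (h n - w) by exact: (@domB _ _ G _ _ (hh n) hw).
  apply: (@rellich T F FF (fun n => h n - w) (2 * K + 2 * ip G w w) M M0 hd).
    move=> n; have := @ip_sqrDZ _ _ G 1 _ _ (hh n) hw; rewrite scale1r.
    have := @ip_sqrB _ _ G _ _ (hh n) hw; have := @ip_ge0 _ _ G _ (@domD _ _ G _ _ (hh n) hw).
    have := hK n; lra.
  move=> z dz; rewrite ip0l//.
  have -> : (fun n => ip G (h n - w) z) = (fun n => ip G (h n) z - ip G w z).
    by apply/funext => n; rewrite ipBl//; exact: hh.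
  rewrite -(subrr (ip G w z)); apply: cvgB; [exact: hF|exact: cvg_cst].
have uL := H10V_L2 hu; have vL := H10V_L2 hv.
have pair0 M : 0 < M -> L2ip (absf (cut (big_cube M) u)) (absf v) = 0.
  move=> M0; apply/eqP; rewrite -sqrf_eq0 eq_le sqr_ge0 andbT.
  have K0 n : normsq (f n) <= K.
    apply: le_trans (fK n); exact: (@L2ip_le_energy_space _ _ _ _ oO d0 mV V0 _ (hf n)).
  have cl : 2 * (normsq (cut (big_cube M) (f n \- u)) * normsq v) +
      2 * (K * normsq (cut (big_cube M) (g n \- v))) @[n --> F] --> 2 * (0 * normsq v) + 2 * (K * 0).
    apply: cvgD; apply: cvgM; try exact: cvg_cst.
      by apply: cvgM; [exact: shift|exact: cvg_cst].
    by apply: cvgM; [exact: cvg_cst|exact: shift].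
  rewrite mul0r !mulr0 addr0 in cl.
  apply: (cvgr_to_ge cl); apply: nearW => n.
  have mB : measurable (big_cube M : set E) by exact: measurable_cube.
  apply: (le_trans (pairing_le mB uL vL (H10V_L2 (hf n)) (H10V_L2 (hg n)) (fg0 n))).
  rewrite lerD2l ler_pM2l// ler_wpM2r//; apply: normsq_ge0.
  by apply: (cut_L2 oO) => //; apply: L2B => //; exact: H10V_L2.
have mB M : measurable (big_cube M : set E) by exact: measurable_cube.
have cell0 n : {ae mu, forall x, Omega x -> cut (big_cube n.+1%:R) u x * v x = 0}.
  set B : set E := big_cube n.+1%:R.
  have cL : L2 (cut B u) by exact: (cut_L2 oO (mB _) uL).
  have [mc _] := cL; have [mv _] := vL.
  have /ae_eq_integral_abs : measurable_fun Omega (EFin \o (fun x => cut B u x * v x)).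
    by apply/measurable_EFinP; exact: measurable_funM.
  move=> /(_ mu mO)[+ _] => H.
  have : ae_eq mu Omega (EFin \o (fun x => cut B u x * v x)) (cst 0%E).
    apply: H; have := pair0 n.+1%:R (ltr0Sn _ _); rewrite L2ipE /Rintegral => h0.
    rewrite (eq_integral (fun x => (absf (cut B u) x * absf v x)%:E)); last first.
      by move=> x _; rewrite /= -[in RHS]normrM.
    by rewrite -[LHS]fineK ?h0//; apply: integrable_fin_num => //; apply: (L2_integrable mO); exact: abs_L2.
  by apply: filterS => x h Ox; have := h Ox => -[].
have := ae_foralln cell0; apply: filterS => x h Ox.
pose n := Num.trunc (\sum_(i < d) `|x ord0 i|).
have := h n Ox; rewrite /cut indicE mem_set ?mul1r// => i.
have hi : `|x ord0 i| < n.+1%:R.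
  apply: le_lt_trans (truncnS_gt _); rewrite (bigD1 i)//= lerDl sumr_ge0// => j _; exact: normr_ge0.
move: hi; rewrite ltr_norml /= in_itv /= mxE => /andP[h1 h2].
by apply/andP; split; lra.
Qed.

End rellich.

(** * The relaxed functional *)

Section power_mean.
Context {R : realType}.

Lemma powR_cvg (T : Type) (F : set_system T) (FF : Filter F) (f : T -> R) (l q : R) : 0 < q ->
  (forall n, 0 <= f n) -> 0 <= l -> f n @[n --> F] --> l -> f n `^ q @[n --> F] --> l `^ q.
Proof.
move=> q0 f0; rewrite le0r => /predU1P[->|l0] fl; last first.
  have c : {for l, continuous (fun x : R => x `^ q)}.
    apply/differentiable_continuous/derivable1_diffP.
    by have [] := @is_derive1_powR R q l l0.
  exact: (cvg_comp _ _ fl c).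
rewrite powR0 ?gt_eqF//; apply/cvgrPdist_lt => e e0.
have := @cvgr_lt _ _ _ FF _ _ fl (e `^ q^-1) (powR_gt0 _ e0).
apply: filterS => n h; rewrite sub0r normrN ger0_norm ?powR_ge0//.
have := gt0_ltr_powR q0 _ _ h; rewrite -powRrM mulVf ?gt_eqF// powRr1 ?(ltW e0)//.
by apply; rewrite nnegrE ?powR_ge0.
Qed.

(** The l^p norm, in which the relaxed functional combines the Rayleigh
    quotients. *)
Definition pnorm (p : \bar R) k (r : 'I_k -> R) : R :=
  if p is q%:E then (\sum_(i < k) r i `^ q) `^ q^-1 else \big[Num.max/0]_(i < k) r i.

Implicit Types (p : \bar R) (q : R).

Let sum_ge0 q k (r : 'I_k -> R) : 0 <= \sum_(i < k) r i `^ q.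
Proof. by apply: sumr_ge0 => i _; exact: powR_ge0. Qed.

Lemma pnorm_ge0 p k (r : 'I_k -> R) : 0 <= pnorm p r.
Proof. by rewrite /pnorm; case: p => [q||]; rewrite ?powR_ge0// bigmax_ge_id. Qed.

Lemma pnorm_ge p k (r : 'I_k -> R) i : (1 <= p)%E -> (forall j, 0 <= r j) -> r i <= pnorm p r.
Proof.
move=> p1 r0; case: p p1 => [q|_|//]; rewrite /pnorm; last by apply: le_bigmax.
rewrite lee_fin => q1; have q0 : 0 < q by lra.
have -> : r i = (r i `^ q) `^ q^-1 by rewrite -powRrM divff ?gt_eqF// powRr1.
apply: ge0_ler_powR; rewrite ?nnegrE ?powR_ge0 ?sum_ge0 ?invr_ge0 ?(ltW q0)//.
by rewrite (bigD1 i)//= lerDl sumr_ge0// => j _; exact: powR_ge0.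
Qed.

Lemma pnorm_le p k (r s : 'I_k -> R) : (1 <= p)%E -> (forall j, 0 <= r j <= s j) ->
  pnorm p r <= pnorm p s.
Proof.
move=> p1 rs; case: p p1 => [q|_|//]; rewrite /pnorm.
  rewrite lee_fin => q1; have q0 : 0 < q by lra.
  apply: ge0_ler_powR; rewrite ?nnegrE ?sum_ge0 ?invr_ge0 ?(ltW q0)//.
  apply: ler_sum => i _; have /andP[r0 ris] := rs i.
  by apply: ge0_ler_powR; rewrite ?nnegrE ?(ltW q0)// (le_trans r0).
by apply: le_bigmax2 => i _; have /andP[] := rs i.
Qed.

Lemma pnorm_cvg (T : Type) (F : set_system T) (FF : Filter F) q k
    (f : T -> 'I_k -> R) (r : 'I_k -> R) : 1 <= q -> (forall n i, 0 <= f n i) ->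
  (forall i, 0 <= r i) -> (forall i, f n i @[n --> F] --> r i) ->
  pnorm q%:E (f n) @[n --> F] --> pnorm q%:E r.
Proof.
move=> q1 f0 r0 fr; have q0 : 0 < q by lra.
apply: powR_cvg; rewrite ?invr_gt0//.
by apply: cvg_sum => i _; exact: powR_cvg.
Qed.

(** For finite [p] the norm is continuous; for [p = +oo] it dominates every
    coordinate, which is enough for this inequality. *)
Lemma pnorm_limit_le (T : Type) (F : set_system T) (FF : ProperFilter F) p k
    (f : T -> 'I_k -> R) (r : 'I_k -> R) (l : R) : (1 <= p)%E -> (forall n i, 0 <= f n i) ->
  (forall i, 0 <= r i) -> (forall i, f n i @[n --> F] --> r i) ->
  pnorm p (f n) @[n --> F] --> l -> pnorm p r <= l.
Proof.
move=> p1 f0 r0 fr fl; case: p p1 fl => [q|p1|//]; first rewrite lee_fin => q1 fl.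
  by rewrite (norm_cvg_unique (pnorm_cvg FF q1 f0 r0 fr) fl).
move=> fl; apply: bigmax_le => [|i _].
  by apply: (cvgr_to_ge fl); apply: nearW => n; exact: pnorm_ge0.
rewrite -subr_ge0; apply: (cvgr_to_ge (cvgB fl (fr i))); apply: nearW => n.
change (0 <= pnorm +oo%E (f n) - f n i).
by rewrite subr_ge0; apply: (pnorm_ge i p1 (f0 n)).
Qed.

(** Isolates one coordinate, in the shape of the threshold value. *)
Lemma pnorm_split q k (r : 'I_k.+1 -> R) i (m s : R) : 1 <= q -> 0 <= m -> 0 <= s ->
  s <= r i -> m <= pnorm q%:E (fun j => r (lift i j)) ->
  (m `^ q + s `^ q) `^ q^-1 <= pnorm q%:E r.
Proof.
move=> q1 m0 s0 sr mr; have q0 : 0 < q by lra.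
apply: ge0_ler_powR; rewrite ?nnegrE ?addr_ge0 ?powR_ge0 ?sum_ge0 ?invr_ge0 ?(ltW q0)//.
rewrite (bigD1_ord i)//= [leRHS]addrC; apply: lerD; last first.
  by apply: ge0_ler_powR; rewrite ?nnegrE ?(ltW q0)// (le_trans s0).
have : (m `^ q) <= (pnorm q%:E (fun j => r (lift i j))) `^ q.
  by apply: ge0_ler_powR; rewrite ?nnegrE ?(ltW q0) ?pnorm_ge0.
by rewrite /pnorm -powRrM mulVf ?gt_eqF// powRr1 ?sum_ge0.
Qed.

End power_mean.

(** * Minimisers below the threshold *)

Section minimiser.
Context {R : realType} {d : nat}.
Local Notation E := 'rV[R]_d.
Local Notation mu := (@lebesgue_rV R d).
Variables (Omega : set E) (V : E -> R).
Hypothesis oO : open Omega.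
Hypothesis d0 : (0 < d)%N.
Hypothesis mV : measurable_fun Omega V.
Hypothesis V0 : {ae mu, forall x, Omega x -> 0 <= V x}.
Implicit Types (u v : E -> R).

Let mO : measurable Omega. Proof. exact: open_measurable_rV. Qed.
Local Notation normsq := (normsq Omega).
Local Notation L2ip := (L2ip Omega).
Local Notation energy := (energy Omega V).
Local Notation rayleigh := (rayleigh Omega V).
Local Notation G := (energy_space oO d0 mV V0).
Local Notation L := (L2_space oO).

Local Notation H10V := (H10V Omega V).
Lemma rayleighE u : H10V u -> rayleigh u = energy u u / normsq u.
Proof.
move=> hu; rewrite -(energyE oO mV V0 hu hu) /normsq L2ipE; congr (_ / _).
by apply: eq_Rintegral => x _; rewrite expr2 mulrA; congr (_ + _).
Qed.

Lemma normsq_gt0 u : L2 Omega u -> ~ ae_zero Omega u -> 0 < normsq u.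
Proof.
move=> uL nz; rewrite lt0r normsq_ge0// andbT; apply/eqP => u0; apply: nz.
exact: (ae_zero_normsq oO).
Qed.

Lemma rayleigh_ge0 u : H10V u -> 0 <= rayleigh u.
Proof.
move=> hu; rewrite rayleighE// divr_ge0 ?energy_ge0//; exact: normsq_ge0 (H10V_L2 hu).
Qed.

Lemma L2_normalise u : H10V u -> ~ ae_zero Omega u -> exists c,
  let v := c *: (u : E -> R^o) in
  [/\ H10V v, normsq v = 1 & energy v v = rayleigh u].
Proof.
move=> hu nz; have uL := H10V_L2 hu; have n0 := normsq_gt0 uL nz.
pose c := (Num.sqrt (normsq u))^-1; exists c.
have c2 : c ^+ 2 = (normsq u)^-1 by rewrite /c exprVn sqr_sqrtr// ltW.
have hv : dom G (c *: (u : E -> R^o)) by apply: domZ.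
have nv : normsq (c *: (u : E -> R^o)) = 1 by rewrite (normsqZ oO)// c2 mulVf// gt_eqF.
split=> //.
have e1 := ipG oO d0 mV V0 (c *: (u : E -> R^o)) (c *: (u : E -> R^o)).
have e2 := @ipZl _ _ G c u (c *: (u : E -> R^o)) hu hv.
have e3 := @ipZr _ _ G c u u hu hu.
have e4 := ipG oO d0 mV V0 u u.
have : energy (c *: (u : E -> R^o)) (c *: (u : E -> R^o)) + 1 = c ^+ 2 * (energy u u + normsq u).
  by rewrite -[X in _ + X = _]nv -[LHS]e1 e2 e3 e4 mulrA expr2.
by rewrite rayleighE// c2 mulrDr mulVf ?gt_eqF// mulrC => /addIr.
Qed.

Lemma relaxed_functionalE p k (u : 'I_k -> E -> R) :
  relaxed_functional Omega V p u = pnorm p (fun i => rayleigh (u i)).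
Proof. by case: p. Qed.

Lemma relaxed_inf_ge0 p k : (0 <= relaxed_inf Omega V p k)%E.
Proof.
case: k => [//|k]; apply/ereal_infP => _ [u _ <-].
by rewrite lee_fin relaxed_functionalE pnorm_ge0.
Qed.

Lemma relaxed_inf_le p k (u : 'I_k.+1 -> E -> R) : admissible Omega V u ->
  (relaxed_inf Omega V p k.+1 <= (pnorm p (fun i => rayleigh (u i)))%:E)%E.
Proof.
by move=> hu; apply: ereal_inf_lbound; exists u => //; rewrite relaxed_functionalE.
Qed.

(** Deleting a component of an admissible tuple leaves an admissible tuple. *)
Lemma relaxed_inf_lift p k (u : 'I_k.+1 -> E -> R) i : admissible Omega V u ->
  (relaxed_inf Omega V p k <= (pnorm p (fun j => rayleigh (u (lift i j))))%:E)%E.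
Proof.
case: k u i => [|k] u i [h1 h2]; first by rewrite lee_fin pnorm_ge0.
apply: relaxed_inf_le; split=> [j|j j' jj']; first exact: h1.
by apply: h2; rewrite (inj_eq lift_inj).
Qed.

Lemma minimising_sequence p k : (relaxed_inf Omega V p k.+1 < +oo)%E ->
  exists (l : R) (u : nat -> 'I_k.+1 -> E -> R),
  [/\ relaxed_inf Omega V p k.+1 = l%:E, forall n, admissible Omega V (u n),
      forall n, pnorm p (fun i => rayleigh (u n i)) <= l + 1 &
      pnorm p (fun i => rayleigh (u n i)) @[n --> \oo] --> l].
Proof.
move=> Ioo; have I0 := relaxed_inf_ge0 p k.+1.
have fI : relaxed_inf Omega V p k.+1 \is a fin_num by rewrite ge0_fin_numE.
pose l := fine (relaxed_inf Omega V p k.+1).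
have lE : relaxed_inf Omega V p k.+1 = l%:E by rewrite fineK.
have /choice[u hu] n : exists u : 'I_k.+1 -> E -> R, admissible Omega V u /\
    pnorm p (fun i => rayleigh (u i)) < l + n.+1%:R^-1.
  have e0 : 0 < n.+1%:R^-1 :> R by rewrite invr_gt0.
  have [_ [u au <-]] := lb_ereal_inf_adherent e0 fI.
  rewrite -[ereal_inf _]/(relaxed_inf Omega V p k.+1) lE -EFinD lte_fin relaxed_functionalE => h.
  by exists u.
have lo n : l <= pnorm p (fun i => rayleigh (u n i)).
  by rewrite -lee_fin -lE; apply: relaxed_inf_le; exact: (hu n).1.
exists l, u; split=> [//|n|n|]; first exact: (hu n).1.
  apply: (le_trans (ltW (hu n).2)); rewrite lerD2l invf_le1// ler1n//.
have : (pnorm p (fun i => rayleigh (u n i)) - l) @[n --> \oo] --> (0 : R).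
  apply: (cvg0_squeeze _ _ (@cvg_harmonic R)) => n.
  by rewrite subr_ge0 lo /= lerBlDl ltW// (hu n).2.
by move/subr_cvg0.
Qed.

(** Below the essential spectrum the limit cannot vanish.  The form minus [s] is weakly
    lower semicontinuous for [r <= s < Sigma], which bounds it by [r - s] at the
    limit: for [s > r] this is negative, so the limit is not zero, and for
    [s = r] it is the bound on the Rayleigh quotient. *)
Lemma rayleigh_weak_limit (T : Type) (F : set_system T) (FF : ProperFilter F)
    (f : T -> E -> R^o) (u : E -> R^o) (r : R) :
  (forall n, H10V (f n)) -> (forall n, normsq (f n) = 1) -> H10V u ->
  weakly G F f u -> energy (f n) (f n) @[n --> F] --> r -> (r%:E < Sigma Omega V)%E ->
  ~ ae_zero Omega u /\ rayleigh u <= r.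
Proof.
move=> hf nf hu fu fr rS; have uL := H10V_L2 hu.
have lsc s : (s%:E < Sigma Omega V)%E -> energy u u - s * normsq u <= r - s.
  move=> /(Sigma_almost_nonneg oO d0 mV V0) hs.
  have h : shifted_form G L s (f n) (f n) @[n --> F] --> r - s.
    have : energy (f n) (f n) - s @[n --> F] --> r - s by apply: cvgB => //; exact: cvg_cst.
    apply: cvg_trans; apply: near_eq_cvg; apply: nearW => n.
    by rewrite formE -/(normsq (f n)) nf mulr1.
  have := almost_nonneg_lsc (@energy_space_L2 _ _ _ _ oO d0 mV V0) (@L2ip_le_energy_space _ _ _ _ oO d0 mV V0)
    FF hs hf hu fu h.
  by rewrite formE.
have [s rs sS] : exists2 s, r < s & (s%:E < Sigma Omega V)%E.
  move: rS; case: (Sigma Omega V) => [S|_|//].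
    by rewrite lte_fin => rS; exists ((r + S) / 2); rewrite ?lte_fin ?midf_lt.
  by exists (r + 1); rewrite ?ltrDl ?ltr01 ?ltry.
have nz : ~ ae_zero Omega u.
  move=> /(ae_zero_normsq0 oO (proj1 uL)) u0.
  have := lsc s sS; have := energy_ge0 oO mV V0 hu.
  rewrite u0; lra.
split=> //; have n0 := normsq_gt0 uL nz.
by rewrite rayleighE// ler_pdivrMr//; have := lsc r rS; rewrite subrr subr_le0.
Qed.

(** If a Rayleigh quotient reaches [Sigma] in the limit, the other components,
    which compete for the problem with one function less, bring the functional up
    to the threshold. *)
Lemma threshold_le (T : Type) (F : set_system T) (FF : ProperFilter F) p k
    (u : T -> 'I_k.+1 -> E -> R) (r : 'I_k.+1 -> R) i :
  (1 <= p)%E -> (forall n, admissible Omega V (u n)) -> (forall j, 0 <= r j) ->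
  (forall j, rayleigh (u n j) @[n --> F] --> r j) ->
  (Sigma Omega V <= (r i)%:E)%E -> (threshold Omega V p k.+1 <= (pnorm p r)%:E)%E.
Proof.
case: p => [q|p1|//] => [|_ r0 _ Sr]; last first.
  by rewrite /threshold (le_trans Sr)// lee_fin; exact: pnorm_ge.
rewrite lee_fin => q1 au r0 ur Sr.
have [n0 _] := filter_ex (filterT : F setT).
have S0 := Sigma_ge0 oO d0 mV V0.
have fS : Sigma Omega V \is a fin_num.
  by rewrite ge0_fin_numE// (le_lt_trans Sr)// ltry.
have I0 := relaxed_inf_ge0 q%:E k.
have fI : relaxed_inf Omega V q%:E k \is a fin_num.
  by rewrite ge0_fin_numE// (le_lt_trans (relaxed_inf_lift q%:E i (au n0)))// ltry.
pose m := fine (relaxed_inf Omega V q%:E k); pose s := fine (Sigma Omega V).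
have mE : relaxed_inf Omega V q%:E k = m%:E by rewrite fineK.
have sE : Sigma Omega V = s%:E by rewrite fineK.
rewrite /threshold /=.
rewrite mE sE (poweR_EFin m) (poweR_EFin s) -EFinD poweR_EFin lee_fin.
rewrite mE lee_fin in I0; rewrite sE !lee_fin in S0 Sr.
have ray0 n j : 0 <= rayleigh (u n j) by apply: rayleigh_ge0; exact: ((au n).1 j).1.
apply: (@pnorm_split _ _ _ _ i) => //.
apply: (cvgr_to_ge (pnorm_cvg FF q1 (fun n j => ray0 n (lift i j)) (fun j => r0 (lift i j)) (fun j => ur (lift i j)))).
by apply: nearW => n; rewrite -lee_fin -mE; exact: relaxed_inf_lift.
Qed.

Lemma minimiser_below_threshold p k : (1 <= p)%E ->
  (relaxed_inf Omega V p k.+1 < threshold Omega V p k.+1)%E ->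
  exists u : 'I_k.+1 -> E -> R, admissible Omega V u /\
    (relaxed_functional Omega V p u)%:E = relaxed_inf Omega V p k.+1.
Proof.
move=> p1 LT.
have [l [u [lE au ule ul]]] := minimising_sequence (lt_le_trans LT (leey _)).
have ray0 n i : 0 <= rayleigh (u n i) by apply: rayleigh_ge0; exact: ((au n).1 i).1.
have rayle n i : rayleigh (u n i) <= l + 1.
  by apply: le_trans (ule n); exact: pnorm_ge.
(* Along an ultrafilter all the finitely many limits exist at once. *)
have [U [UU oU]] := ultraFilterLemma (eventually_filter).
have Ul : pnorm p (fun i => rayleigh (u n i)) @[n --> U] --> l.
  by move=> A /ul; exact: oU.
have /choice[r ur] i : exists ri : R, rayleigh (u n i) @[n --> U] --> ri.
  apply: (ultra_bounded_cvg UU (K := l + 1)) => n.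
  by rewrite ger0_norm.
have r0 i : 0 <= r i by apply: (cvgr_to_ge (ur i)); apply: nearW.
have rl : pnorm p r <= l by exact: (pnorm_limit_le _ p1 ray0 r0 ur Ul).
have rS i : ((r i)%:E < Sigma Omega V)%E.
  rewrite ltNge; apply/negP => Sr; move: LT; rewrite lE ltNge => /negP; apply.
  by apply: (le_trans (threshold_le _ p1 au r0 ur Sr)); rewrite lee_fin.
have /choice[c hc] n : exists c : 'I_k.+1 -> R, forall i,
    let v := c i *: (u n i : E -> R^o) in
    [/\ H10V v, normsq v = 1 & energy v v = rayleigh (u n i)].
  have /choice[c hc] := fun i => L2_normalise ((au n).1 i).1 ((au n).1 i).2.
  by exists c.
pose v n i : E -> R^o := c n i *: (u n i : E -> R^o).
have hv n i : H10V (v n i) by have [] := hc n i.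
have nv n i : normsq (v n i) = 1 by have [] := hc n i.
have ev n i : energy (v n i) (v n i) = rayleigh (u n i) by have [] := hc n i.
have gv n i : ip G (v n i) (v n i) <= l + 1 + 1.
  by rewrite ipG -/(normsq (v n i)) nv ev lerD2r.
have /choice[w hw] i : exists w : E -> R^o, dom G w /\ weakly G U (fun n => v n i) w.
  by have [w] := @ultra_weak_limit _ _ G _ _ UU (fun n => v n i) _ (fun n => hv n i) (fun n => gv n i); exists w.
have rw i : ~ ae_zero Omega (w i) /\ rayleigh (w i) <= r i.
  apply: (@rayleigh_weak_limit _ U _ (fun n => v n i)) => //; [exact: (hw i).1|exact: (hw i).2|].
  by under eq_fun do rewrite ev; exact: ur.
have aw : admissible Omega V w.
  split=> [i|i j ij]; first by split; [exact: (hw i).1|exact: (rw i).1].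
  have PU : ProperFilter U by exact: ultra_proper.
  apply: (@weak_limit_disjoint _ _ _ _ oO d0 mV V0 _ U PU (fun n => v n i) (fun n => v n j) _ _ _
    (fun n => hv n i) (fun n => hv n j) (fun n => gv n i) (fun n => gv n j) (hw i).1 (hw j).1 (hw i).2 (hw j).2) => n.
  have := (au n).2 i j ij; apply: filterS => x h Ox.
  change (c n i * u n i x * (c n j * u n j x) = 0).
  by rewrite mulrACA h// mulr0.
exists w; split=> //; apply/eqP; rewrite eq_le; apply/andP; split; last first.
  by rewrite relaxed_functionalE; exact: relaxed_inf_le.
rewrite relaxed_functionalE lE lee_fin; apply: le_trans rl; apply: pnorm_le => // i.
by rewrite (rw i).2 andbT; apply: rayleigh_ge0; exact: (hw i).1.
Qed.

End minimiser.

Theorem theorem1p4 (R : realType) (d : nat) (hd : (2 <= d)%N)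
    (Omega : set 'rV[R]_d) (hOmega : open Omega)
    (V : 'rV[R]_d -> R) (hV : Linfty_loc Omega V)
    (hV0 : {ae @lebesgue_rV R d, forall x, Omega x -> 0 <= V x})
    (k : nat) (hk : (1 <= k)%N) (p : \bar R) (hp : (1 <= p)%E) :
  (relaxed_inf Omega V p k < threshold Omega V p k)%E ->
  exists u : 'I_k -> 'rV[R]_d -> R,
    [/\ forall i, H10V Omega V (u i) /\ ~ ae_zero Omega (u i),
        forall i j, i != j -> ae_zero Omega (fun x => u i x * u j x) &
        (relaxed_functional Omega V p u)%:E = relaxed_inf Omega V p k].
Proof.
case: k hk => [//|k] _ LT.
have [u [[h1 h2] h3]] := minimiser_below_threshold hOmega (ltnW hd) hV.1 hV0 hp LT.
by exists u.
Qed.
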